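(* Let $\mathsf{M}$ be a $d\times d$ expansive integer matrix. Let $\Psi$ be a countable subset of $L_2(\mathbb{R}^d)$ such that $\sum_{\psi\in\Psi}\|\psi\|_{L_2(\mathbb{R}^d)}^2<\infty$. Define $$H:=\{|\det(\mathsf{M})|^{-j}\psi(\mathsf{M}^{-j}\cdot) : j\in\mathbb{N},\ \psi\in\Psi\}.$$ Suppose that $r:=\operatorname{len}(\mathtt{S}(H))<\infty$. Then $\Psi$ is a homogeneous $\mathsf{M}$-framelet in $L_2(\mathbb{R}^d)$, satisfying $$C_1\|f\|^2_{L_2(\mathbb{R}^d)}\le \sum_{j\in\mathbb{Z}}\sum_{\psi\in\Psi}\sum_{k\in\mathbb{Z}^d}|\langle f,\psi_{\mathsf{M}^j;k}\rangle|^2\le C_2\|f\|^2_{L_2(\mathbb{R}^d)},\qquad \forall f\in L_2(\mathbb{R}^d),$$ if and only if there exists a subset $\Phi:=\{\varphi^1,\ldots,\varphi^r\}\subset \mathtt{S}(H)$ such that $\mathtt{S}(\Phi)=\mathtt{S}(H)$, $$\sum_{\varphi\in\Phi}\sum_{k\in\mathbb{Z}^d}|\langle f,\varphi(\cdot-k)\rangle|^2=\sum_{j=1}^\infty\sum_{\psi\in\Psi}\sum_{k\in\mathbb{Z}^d}\big|\big\langle f,|\det(\mathsf{M})|^{-j}\psi(\mathsf{M}^{-j}(\cdot-k))\big\rangle\big|^2,\qquad\forall f\in L_2(\mathbb{R}^d),$$ and $\{\Phi;\Psi\}$ is an $\mathsf{M}$-framelet in $L_2(\mathbb{R}^d)$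 with the same lower and upper frame bounds, i.e., for all $f\in L_2(\mathbb{R}^d)$, $$C_1\|f\|^2_{L_2(\mathbb{R}^d)}\le\sum_{\varphi\in\Phi}\sum_{k\in\mathbb{Z}^d}|\langle f,\varphi(\cdot-k)\rangle|^2+\sum_{j=0}^\infty\sum_{\psi\in\Psi}\sum_{k\in\mathbb{Z}^d}|\langle f,\psi_{\mathsf{M}^j;k}\rangle|^2\le C_2\|f\|^2_{L_2(\mathbb{R}^d)}.$$
   Context: $\langle f,g\rangle:=\int_{\mathbb{R}^d}f(x)\overline{g(x)}\,dx$ for $f,g\in L_2(\mathbb{R}^d)$ (complex-valued), and $\mathbb{N}=\{1,2,\ldots\}$. For a $d\times d$ real matrix $U$ and $k\in\mathbb{R}^d$, $f_{U;k}(x):=|\det(U)|^{1/2}f(Ux-k)$. A $d\times d$ real matrix is expansive if all its eigenvalues are greater than one in modulus. Shift-invariant spaces: for $\Phi\subset L_2(\mathbb{R}^d)$, $\mathtt{S}(\Phi)$ is the closure in $L_2(\mathbb{R}^d)$ of the linear span of $\{\phi(\cdot-k): k\in\mathbb{Z}^d,\phi\in\Phi\}$. The length of a shift-invariant closed subspace $S$ is $\operatorname{len}(S):=\min\{\#\Phi : S=\mathtt{S}(\Phi)\}$. Framelets: a countable $\Psi\subset L_2(\mathbb{R}^d)$ is a homogeneous $\mathsf{M}$-framelet in $L_2(\mathbb{R}^d)$ if $\{\psi_{\mathsf{M}^j;k}: j\in\mathbb{Z},k\in\mathbb{Z}^d,\psi\in\Psi\}$ is a frame for $L_2(\mathbb{R}^d)$,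 i.e. the first displayed two-sided inequality holds for some constants $C_1,C_2>0$; the optimal $C_1$ and $C_2$ are the lower and upper frame bounds. $\{\Phi;\Psi\}$ is an $\mathsf{M}$-framelet in $L_2(\mathbb{R}^d)$ if $\{\phi(\cdot-k): k\in\mathbb{Z}^d,\phi\in\Phi\}\cup\{\psi_{\mathsf{M}^j;k}: j\ge 0,k\in\mathbb{Z}^d,\psi\in\Psi\}$ is a frame for $L_2(\mathbb{R}^d)$, i.e. the last displayed inequality holds for some positive constants. *)

(* Defs.v *)
From HB Require Import structures.
From mathcomp Require Import all_boot all_order all_algebra.
From mathcomp Require Import complex.
From mathcomp Require Import all_classical all_reals all_analysis.
Import Order.TTheory GRing.Theory Num.Theory.
Import numFieldNormedType.Exports.

Set Implicit Arguments.
Unset Strict Implicit.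
Unset Printing Implicit Defensive.

Local Open Scope classical_set_scope.
Local Open Scope ring_scope.
Local Open Scope complex_scope.

(* R^d is 'cV[R]_d with its Borel sigma-algebra, generated by the coordinates,
   and Lebesgue measure, built by iterated products along R^(d+1) = R x R^d. *)

Definition coord (R : realType) (d : nat) (i : 'I_d) (x : 'cV[R]_d) :
  measurableTypeR R := x i 0.

Definition cV_display : measure_display.
Proof. exact: default_measure_display. Qed.

Section cV_measurable.
Context (R : realType) (d : nat).

Let cV_set0 : g_sigma_preimage (@coord R d) set0.
Proof. exact: sigma_algebra0. Qed.

Let cV_setC A :
  g_sigma_preimage (@coord R d) A -> g_sigma_preimage (@coord R d) (~` A).
Proof. exact: sigma_algebraC. Qed.

Let cV_bigcup (F : (set 'cV[R]_d)^nat) :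
  (forall i, g_sigma_preimage (@coord R d) (F i)) ->
  g_sigma_preimage (@coord R d) (\bigcup_i F i).
Proof. exact: sigma_algebra_bigcup. Qed.

HB.instance Definition _ := @isMeasurable.Build cV_display 'cV[R]_d
  (g_sigma_preimage (@coord R d)) cV_set0 cV_setC cV_bigcup.

End cV_measurable.

Lemma measurable_coord (R : realType) (d : nat) (i : 'I_d) :
  measurable_fun setT (@coord R d i).
Proof.
move=> _ Y mY; rewrite setTI; apply: sub_sigma_algebra => /=.
rewrite -bigcup_seq/=; exists i => /=; first by rewrite mem_index_enum.
by exists Y => //; rewrite setTI.
Qed.

Lemma measurable_fun_coordP (R : realType) (d : nat) (disp : measure_display)
    (T : measurableType disp) (f : T -> 'cV[R]_d) :
  (forall i, measurable_fun setT (@coord R d i \o f)) -> measurable_fun setT f.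
Proof.
move=> mf.
suff : g_sigma_preimage (fun i => @coord R d i \o f) `<=` measurable.
  rewrite g_sigma_preimage_comp => sub _ A mA.
  by apply: sub; exists A.
apply: smallest_sub; first exact: sigma_algebra_measurable.
case: d => [|d] in f mf *; first by rewrite big_ord0.
rewrite -bigcup_mkord_ord; apply: bigcup_sub => i Ii A [B mB <-].
exact: mf.
Qed.

Definition cV_cons (R : realType) (d : nat)
  (p : measurableTypeR R * 'cV[R]_d) : 'cV[R]_d.+1 :=
  \col_i (if unlift ord0 i is Some j then p.2 j 0 else p.1).

Definition cV_uncons (R : realType) (d : nat) (x : 'cV[R]_d.+1) :
  measurableTypeR R * 'cV[R]_d :=
  (x ord0 0, \col_i x (lift ord0 i) 0).

Lemma cV_consK (R : realType) (d : nat) : cancel (@cV_cons R d) (@cV_uncons R d).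
Proof.
move=> [a v]; rewrite /cV_uncons /cV_cons; congr (_, _).
  by rewrite mxE unlift_none.
by apply/colP => i; rewrite !mxE liftK.
Qed.

Lemma measurable_cV_cons (R : realType) (d : nat) :
  measurable_fun setT (@cV_cons R d).
Proof.
apply: measurable_fun_coordP => i.
have [j ->|->] := unliftP ord0 i.
  rewrite (_ : _ \o _ = @coord R d j \o snd); last first.
    by apply/funext => p /=; rewrite /coord mxE liftK.
  exact: measurableT_comp (measurable_coord j) measurable_snd.
rewrite (_ : _ \o _ = fst); first exact: measurable_fst.
by apply/funext => p /=; rewrite /coord mxE unlift_none.
Qed.

Lemma measurable_cV_uncons (R : realType) (d : nat) :
  measurable_fun setT (@cV_uncons R d).
Proof.
apply/measurable_fun_pairP; split; first exact: (measurable_coord ord0).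
apply: measurable_fun_coordP => i.
rewrite (_ : _ \o _ = @coord R d.+1 (lift ord0 i)).
  exact: measurable_coord.
by apply/funext => x /=; rewrite /coord mxE.
Qed.

Section lebesgue_step.
Context (R : realType) (d : nat).
Variable mu : {sigma_finite_measure set 'cV[R]_d -> \bar R}.

Definition lebesgue_step : set 'cV[R]_d.+1 -> \bar R :=
  pushforward (@lebesgue_measure R \x mu)%E (@cV_cons R d).

Let mcons A : measurable A -> measurable (@cV_cons R d @^-1` A).
Proof.
by move=> mA; rewrite -[X in measurable X]setTI; exact: measurable_cV_cons.
Qed.

Let step0 : lebesgue_step set0 = 0%E.
Proof. by rewrite /lebesgue_step /pushforward preimage_set0 measure0. Qed.

Let step_ge0 A : (0 <= lebesgue_step A)%E.
Proof. by rewrite /lebesgue_step /pushforward; exact: measure_ge0. Qed.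

Let step_sigma_additive : semi_sigma_additive lebesgue_step.
Proof.
move=> F mF tF mUF; rewrite /lebesgue_step /pushforward preimage_bigcup.
apply: measure_semi_sigma_additive.
- by move=> n; exact: mcons.
- apply/trivIsetP => /= i j _ _ ij; rewrite -preimage_setI.
  by move/trivIsetP : tF => /(_ _ _ _ _ ij) ->//; rewrite preimage_set0.
- by rewrite -preimage_bigcup; exact: mcons.
Qed.

HB.instance Definition _ := isMeasure.Build _ _ _ lebesgue_step
  step0 step_ge0 step_sigma_additive.

Let step_sigma_finite : sigma_finite setT lebesgue_step.
Proof.
have /sigma_finiteP[F [TF ndF mF]] := sigma_finiteT (@lebesgue_measure R).
have /sigma_finiteP[G [TG ndG mG]] := sigma_finiteT mu.
exists (fun n => @cV_uncons R d @^-1` (F n `*` G n)) => [|n].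
  apply/seteqP; split=> // x _.
  have [k _ Fk] : (\bigcup_k F k) (x ord0 0) by rewrite -TF.
  have [l _ Gl] : (\bigcup_k G k) (\col_i x (lift ord0 i) 0) by rewrite -TG.
  exists (maxn k l) => //; split=> /=.
    by move: Fk; exact/subsetPset/ndF/leq_maxl.
  by move: Gl; exact/subsetPset/ndG/leq_maxr.
have [mFn Fn_fin] := mF n; have [mGn Gn_fin] := mG n; split.
  rewrite -[X in measurable X]setTI.
  by apply: measurable_cV_uncons => //; exact: measurableX.
rewrite /lebesgue_step /pushforward -comp_preimage.
rewrite (_ : _ \o _ = id); last by apply/funext => p /=; rewrite cV_consK.
by rewrite preimage_id product_measure1E// lte_mul_pinfty// ge0_fin_numE.
Qed.

HB.instance Definition _ := Measure_isSigmaFinite.Build _ _ _ lebesgue_step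
  step_sigma_finite.

End lebesgue_step.

Fixpoint lebesgue_cV (R : realType) (d : nat) :
    {sigma_finite_measure set 'cV[R]_d -> \bar R} :=
  if d is d'.+1 then lebesgue_step (lebesgue_cV R d') else \d_(0 : 'cV[R]_0).

Lemma lebesgue_cV_box (R : realType) (d : nat)
    (A : 'I_d -> set (measurableTypeR R)) :
  (forall i, measurable (A i)) ->
  lebesgue_cV R d [set x | forall i, A i (x i 0)] =
  (\prod_(i < d) @lebesgue_measure R (A i))%E.
Proof.
elim: d A => [A _|d IH A mA].
  by rewrite big_ord0 /= diracE mem_set// => -[].
rewrite big_ord_recl -IH// -product_measure1E//; last first.
  rewrite [X in measurable X](_ : _ =
    \bigcap_(i in [set: 'I_d]) (@coord R d i @^-1` A (lift ord0 i))).
    by apply: fin_bigcap_measurable => // i _;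
      rewrite -[X in measurable X]setTI; exact: measurable_coord.
  by apply/seteqP; split=> [x /= + i _|x /= + i]; [exact|move/(_ i I)].
rewrite [LHS]/= /lebesgue_step /pushforward; congr product_measure1.
apply/seteqP; split=> [[a v] /= Aav|[a v] /= [Aa Av] i].
  split=> [|i]; first by have := Aav ord0; rewrite mxE unlift_none.
  by have := Aav (lift ord0 i); rewrite mxE liftK.
have [j ->|->] := unliftP ord0 i; rewrite mxE ?liftK ?unlift_none//.
Qed.

(* Elements of L_2(R^d) are represented by Borel functions R^d -> C; two of
   them denote the same element when they are equal almost everywhere. *)

Definition L2norm (R : realType) (d : nat) (f : 'cV[R]_d -> R[i]) : \bar R :=
  Lnorm (lebesgue_cV R d) 2%:E (fun x => (Normc.normc (f x))%:E).

Definition L2 (R : realType) (d : nat) : set ('cV[R]_d -> R[i]) :=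
  [set f | [/\ measurable_fun setT (fun x => complex.Re (f x)),
               measurable_fun setT (fun x => complex.Im (f x)) &
               (L2norm f < +oo)%E]].

(* A set of representatives, exactly one for each of its classes, i.e., a
   subset of L_2(R^d); so its cardinality is that of the set of classes. *)
Definition L2_subset (R : realType) (d : nat) (A : set ('cV[R]_d -> R[i])) :=
  A `<=` @L2 R d /\
  forall f g, A f -> A g ->
    {ae lebesgue_cV R d, forall x, f x = g x} -> f = g.

Definition inner (R : realType) (d : nat) (f g : 'cV[R]_d -> R[i]) : R[i] :=
  let h x := f x * (g x)^* in
  (\int[lebesgue_cV R d]_x complex.Re (h x)) +i*
  (\int[lebesgue_cV R d]_x complex.Im (h x)).

Definition inner_sqr (R : realType) (d : nat) (f g : 'cV[R]_d -> R[i]) : \bar R :=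
  (Normc.normc (inner f g) ^+ 2)%:E.

Definition intvec (R : realType) (d : nat) (k : 'cV[int]_d) : 'cV[R]_d :=
  map_mx intr k.

Definition expansive (R : realType) (d : nat) (U : 'M[R]_d) :=
  forall z : R[i], eigenvalue (map_mx (real_complex R) U) z -> 1 < `|z|.

Definition mx_expz (R : realType) (d : nat) (U : 'M[R]_d) (j : int) : 'M[R]_d :=
  match j with Posz n => U ^+ n | Negz n => invmx U ^+ n.+1 end.

(* f_{U;k} = |det U|^(1/2) f(U . - k) *)
Definition affine (R : realType) (d : nat) (U : 'M[R]_d) (k : 'cV[int]_d)
    (f : 'cV[R]_d -> R[i]) : 'cV[R]_d -> R[i] :=
  fun x => (Num.sqrt `|\det U|)%:C * f (U *m x - intvec R k).

(* f( . - k) *)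
Definition translate (R : realType) (d : nat) (k : 'cV[int]_d)
    (f : 'cV[R]_d -> R[i]) : 'cV[R]_d -> R[i] :=
  fun x => f (x - intvec R k).

(* |det U|^(-j) f(U^(-j) . ) *)
Definition coarsen (R : realType) (d : nat) (U : 'M[R]_d) (j : nat)
    (f : 'cV[R]_d -> R[i]) : 'cV[R]_d -> R[i] :=
  fun x => (`|\det U| ^- j)%:C * f (mx_expz U (- j%:Z) *m x).

Definition translates_span (R : realType) (d : nat)
    (Phi : set ('cV[R]_d -> R[i])) : set ('cV[R]_d -> R[i]) :=
  [set g | exists n (c : 'I_n -> R[i]) (phi : 'I_n -> 'cV[R]_d -> R[i])
             (k : 'I_n -> 'cV[int]_d),
     (forall i, Phi (phi i)) /\
     g = fun x => \sum_(i < n) c i * translate (k i) (phi i) x].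

Definition shift_space (R : realType) (d : nat)
    (Phi : set ('cV[R]_d -> R[i])) : set ('cV[R]_d -> R[i]) :=
  [set f | L2 f /\
     forall eps : R, 0 < eps ->
       exists2 g, translates_span Phi g &
         (L2norm (fun x => (f x - g x)%R) < eps%:E)%E].

(* len S = r; no r satisfies it when len S is infinite *)
Definition has_len (R : realType) (d : nat) (S : set ('cV[R]_d -> R[i]))
    (r : nat) :=
  (exists Phi, [/\ L2_subset Phi, (Phi #= `I_r)%card & S = shift_space Phi]) /\
  (forall Phi n, L2_subset Phi -> (Phi #= `I_n)%card -> S = shift_space Phi ->
     (r <= n)%N).

Definition translates_energy (R : realType) (d : nat)
    (Phi : set ('cV[R]_d -> R[i])) (f : 'cV[R]_d -> R[i]) : \bar R :=
  \esum_(phi in Phi) \esum_(k in [set: 'cV[int]_d])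
    inner_sqr f (translate k phi).

Definition affine_energy (R : realType) (d : nat) (U : 'M[R]_d)
    (Psi : set ('cV[R]_d -> R[i])) (J : set int) (f : 'cV[R]_d -> R[i]) :
    \bar R :=
  \esum_(j in J) \esum_(psi in Psi) \esum_(k in [set: 'cV[int]_d])
    inner_sqr f (affine (mx_expz U j) k psi).

Definition coarse_energy (R : realType) (d : nat) (U : 'M[R]_d)
    (Psi : set ('cV[R]_d -> R[i])) (f : 'cV[R]_d -> R[i]) : \bar R :=
  \esum_(j in [set j | (0 < j)%N]) \esum_(psi in Psi)
    \esum_(k in [set: 'cV[int]_d]) inner_sqr f (translate k (coarsen U j psi)).

Definition frame_inequality (R : realType) (d : nat)
    (energy : ('cV[R]_d -> R[i]) -> \bar R) (C1 C2 : R) :=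
  forall f, L2 f ->
    (C1%:E * L2norm f ^+ 2 <= energy f <= C2%:E * L2norm f ^+ 2)%E.

Definition frame_energy (R : realType) (d : nat)
    (energy : ('cV[R]_d -> R[i]) -> \bar R) :=
  exists C1 C2 : R, [/\ 0 < C1, 0 < C2 & frame_inequality energy C1 C2].

Definition homogeneous_energy (R : realType) (d : nat) (U : 'M[R]_d)
    (Psi : set ('cV[R]_d -> R[i])) (f : 'cV[R]_d -> R[i]) : \bar R :=
  affine_energy U Psi setT f.

Definition nonhomogeneous_energy (R : realType) (d : nat) (U : 'M[R]_d)
    (Phi Psi : set ('cV[R]_d -> R[i])) (f : 'cV[R]_d -> R[i]) : \bar R :=
  (translates_energy Phi f + affine_energy U Psi [set j | (0 <= j)%R] f)%E.

Definition homogeneous_framelet (R : realType) (d : nat) (U : 'M[R]_d)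
    (Psi : set ('cV[R]_d -> R[i])) :=
  frame_energy (homogeneous_energy U Psi).

Definition framelet (R : realType) (d : nat) (U : 'M[R]_d)
    (Phi Psi : set ('cV[R]_d -> R[i])) :=
  frame_energy (nonhomogeneous_energy U Phi Psi).

Definition coarse_generators (R : realType) (d : nat) (U : 'M[R]_d)
    (Psi : set ('cV[R]_d -> R[i])) : set ('cV[R]_d -> R[i]) :=
  [set h | exists j psi, [/\ (0 < j)%N, Psi psi & h = coarsen U j psi]].

(* Main.v *)
(* Affine versus quasi-affine energies.  Averaged over translates of f by residues
   modulo M^J, the level -i of the homogeneous energy becomes the i-th level of
   the coarse energy for i <= J, while the levels j >= 0 do not change.  Dually,
   dilating f by M^N shifts the levels of the homogeneous energy by N.  Upper
   bounds transfer at once.  For lower bounds it is enough to treat f supported in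
   an annulus: the dilates of an annulus overlap boundedly, so that the leftover
   tail is O(|det M|^-J) in the first case and summable in N in the second.

   Generators.  Let A be the analysis operator of the translates of H, and let
   gamma_1, ..., gamma_r generate S(H).  The operator
   B x = (<x, A (translates of gamma_i)>)_i is closed, densely defined and
   commutes with translations; its kernel is the orthogonal complement of the
   range of A.  The partial isometry P of its polar decomposition preserves the
   norm on the range of A, so that the coordinates of P A are the inner products
   with the translates of r functions having the same energy as H.  No fiberization
   is needed. *)
From HB Require Import structures.
From mathcomp Require Import all_boot all_order all_algebra all_fingroup.
From mathcomp Require Import complex.
From mathcomp Require Import all_classical all_reals all_analysis.
From mathcomp Require Import measurable_realfun finmap ring lra zify.
Require Import Defs.
Import Order.TTheory GRing.Theory Num.Theory.
Import numFieldNormedType.Exports.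

Set Implicit Arguments.
Unset Strict Implicit.
Unset Printing Implicit Defensive.

Local Open Scope classical_set_scope.
Local Open Scope ring_scope.

(** * Unordered sums *)

(** An upper bound may drop the levels that averaging or dilation leaves over; a lower bound must
    control them, and the only smallness available is that of the sum of the |psi|^2. A
    Cauchy-Schwarz inequality restricted to the support of f bounds each inner product by the mass
    of psi on a set, and bounded overlap of these sets adds the masses up. The lower bound then
    extends to all f because the upper bound makes the energy continuous.

    The operator B may be unbounded: the gamma_i are only known to generate. It is therefore handled
    through its graph, and replaced by the contraction B (1 + B^* B)^-1, which keeps the kernel and
    the symmetries. The partial isometry of a contraction T is the limit of T times polynomials in
    T^* T, so that commutation is inherited from T without a spectral theorem. Scalars are real
    throughout: multiplication by i is one more isometry to commute with. The target of P has r
    families of coordinates, hence r functions; that they are pairwise different in L2 follows from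
    the minimality of r. *)

Section esum_extra.
Local Open Scope ereal_scope.
Context {R : realType}.

Lemma esum_le (T : choiceType) (I : set T) (a : T -> \bar R) c :
  (forall X : {fset T}, (forall x, x \in X -> I x) ->
    \sum_(i <- X) a i <= c) -> \esum_(i in I) a i <= c.
Proof.
move=> H; apply: ge_ereal_sup => _ [X [finX XI] <-].
rewrite fsbig_finite//=; apply: H => x; rewrite in_fset_set// => /set_mem; exact: XI.
Qed.

Lemma sum_le_esum (T : choiceType) (I : set T) (a : T -> \bar R) (X : {fset T}) :
  (forall x, x \in X -> I x) -> \sum_(i <- X) a i <= \esum_(i in I) a i.
Proof.
move=> XI; apply: esum_ge; exists [set` X].
  by split; [exact: finite_fset|].
by rewrite fsbig_finite ?finite_fset//= set_fsetK.
Qed.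

(** The inequality [<=] comes from finite partial sums; used for [r^-1] and [r * a] it yields the
    converse. *)
Lemma esumZ (T : choiceType) (I : set T) (a : T -> \bar R) (r : R) :
  (0 <= r)%R -> (forall i, I i -> 0 <= a i) ->
  \esum_(i in I) (r%:E * a i) = r%:E * \esum_(i in I) a i.
Proof.
move=> r0 a0; have [->|rn0] := eqVneq r 0%R.
  by rewrite mul0e esum1// => i _; rewrite mul0e.
have {rn0}r0 : (0 < r)%R by rewrite lt_def rn0.
have le (s : R) (b : T -> \bar R) : (0 < s)%R -> (forall i, I i -> 0 <= b i) ->
    \esum_(i in I) (s%:E * b i) <= s%:E * \esum_(i in I) b i.
  move=> s0 b0; apply: esum_le => X XI.
  rewrite [leLHS]big_seq -ge0_sume_distrr -?big_seq; last by move=> i /XI/b0.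
  by apply: lee_wpmul2l; [rewrite lee_fin ltW|exact: sum_le_esum].
apply/eqP; rewrite eq_le le//=.
rewrite -(@lee_pdivlMl _ r)//.
apply: le_trans (le r^-1%R (fun i => r%:E * a i) _ _).
- apply: le_esum => i Ii; rewrite muleA -EFinM mulVf ?gt_eqF//.
  by rewrite mul1e.
- by rewrite invr_gt0.
- by move=> i Ii; apply: mule_ge0; [rewrite lee_fin ltW|exact: a0].
Qed.

Lemma esum_swap (T1 T2 : choiceType) (I : set T1) (J : set T2)
    (a : T1 -> T2 -> \bar R) : (forall i j, I i -> J j -> 0 <= a i j) ->
  \esum_(i in I) \esum_(j in J) a i j = \esum_(j in J) \esum_(i in I) a i j.
Proof.
move=> a0; rewrite !esum_esum//; last by move=> j i Jj Ii; exact: a0.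
rewrite (reindex_esum (J `*`` fun=> I) _ (fun x => (x.2, x.1)))//; split=> //=.
- by move=> [i j] [/=].
- by move=> [i1 i2] [j1 j2] /= _ _ [] -> ->.
- by move=> [i1 i2] [Pi1 Qi2] /=; exists (i2, i1).
Qed.

Lemma esum_bij (T T' : choiceType) (e : T -> T') (e' : T' -> T)
    (a : T' -> \bar R) : cancel e e' -> cancel e' e ->
  \esum_(i in setT) a (e i) = \esum_(j in setT) a j.
Proof.
move=> ee' e'e; rewrite (reindex_esum setT setT e)//; split => //.
- by move=> i j _ _ /(can_inj ee').
- by move=> j _; exists (e' j).
Qed.

Lemma esum_ord n (a : 'I_n -> \bar R) : (forall i, 0 <= a i) ->
  \esum_(i in setT) a i = \sum_(i < n) a i.
Proof.
move=> a0; rewrite esum_fset ?fsbig_finite//=.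
apply: perm_big; apply: uniq_perm; [exact: fset_uniq| |move=> i].
  exact: index_enum_uniq.
by rewrite mem_index_enum [LHS](in_fset_set finite_finset) mem_set.
Qed.

Lemma esum_bool (a : bool -> \bar R) : (forall i, 0 <= a i) ->
  \esum_(i in setT) a i = a false + a true.
Proof.
move=> a0; rewrite (esumID [set false])// setTI esum_set1//; congr (_ + _).
rewrite setTI (_ : ~` _ = [set true]) ?esum_set1//.
by apply/seteqP; split=> [[] //= /(_ erefl)//|_ ->].
Qed.

Lemma esum_prod (T1 T2 : choiceType) (a : T1 * T2 -> \bar R) :
  (forall i, 0 <= a i) ->
  \esum_(k in setT) a k = \esum_(i in setT) \esum_(j in setT) a (i, j).
Proof.
move=> a0; rewrite esum_esum//.
have -> : (setT `*`` fun=> setT) = [set: T1 * T2] by apply/seteqP; split.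
by apply: eq_esum => -[].
Qed.

End esum_extra.

(** * Real Hilbert spaces *)

(* Real and possibly degenerate: a space of functions up to a.e. equality is
   an instance, and a complex space is an instance with an extra isometry. *)
Record hilbert (R : realType) := Hilbert {
  hcar :> lmodType R;
  ip : hcar -> hcar -> R;
  ipC : forall x y, ip x y = ip y x;
  ipDl : forall x y z, ip (x + y) z = ip x z + ip y z;
  ipZl : forall a x y, ip (a *: x) y = a * ip x y;
  ip_ge0 : forall x, 0 <= ip x x;
  hilbert_complete : forall u : nat -> hcar,
    (forall e : R, 0 < e -> exists N, forall m n, (N <= m)%N -> (N <= n)%N ->
       ip (u m - u n) (u m - u n) <= e) ->
    exists x, forall e : R, 0 < e -> exists N, forall n, (N <= n)%N ->
       ip (u n - x) (u n - x) <= e }.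

Definition definite (R : realType) (V : hilbert R) :=
  forall x : V, ip x x = 0 -> x = 0.

Definition hcvg (R : realType) (V : hilbert R) (u : nat -> V) (x : V) :=
  forall e : R, 0 < e -> exists N, forall n, (N <= n)%N ->
    ip (u n - x) (u n - x) <= e.

(** The quadratic is tested at its minimum [b / c]. When [c = 0] it is affine in t, and at
    [(a + 1) / b] it would equal [- a - 2], so b must vanish. *)
Lemma discriminant_le (R : realType) (a b c : R) : 0 <= a -> 0 <= c ->
  (forall t, 0 <= a - 2 * t * b + t ^+ 2 * c) -> b ^+ 2 <= a * c.
Proof.
move=> a0 c0 H; have [c1|c1] := ltP 0 c.
  have := H (b / c).
  have -> : a - 2 * (b / c) * b + (b / c) ^+ 2 * c = (a * c - b ^+ 2) / c.
    by field; rewrite gt_eqF.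
  by rewrite pmulr_lge0 ?invr_gt0// subr_ge0.
have c00 : c = 0 by apply/eqP; rewrite eq_le c1 c0.
rewrite c00 mulr0; have [->|b0] := eqVneq b 0; first by rewrite expr0n.
have := H ((a + 1) / b); rewrite c00 mulr0 addr0.
have -> : a - 2 * ((a + 1) / b) * b = - a - 2 by field.
lra.
Qed.

Lemma invS_small (R : realType) (e : R) : 0 < e ->
  exists N : nat, forall n, (N <= n)%N -> n.+1%:R^-1 <= e.
Proof.
move=> e0; exists (Num.truncn e^-1) => n Nn.
rewrite -[leRHS]invrK lef_pV2 ?posrE ?invr_gt0//.
by rewrite (le_trans (ltW (truncnS_gt _)))// ler_nat ltnS.
Qed.

Section hilbert_theory.
Context {R : realType} {V : hilbert R}.
Implicit Types (x y z w : V) (a : R).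

Lemma ipDr x y z : ip x (y + z) = ip x y + ip x z.
Proof. by rewrite ipC ipDl !(ipC x). Qed.

Lemma ipZr a x y : ip x (a *: y) = a * ip x y.
Proof. by rewrite ipC ipZl ipC. Qed.

Lemma ipNl x y : ip (- x) y = - ip x y.
Proof. by rewrite -scaleN1r ipZl mulN1r. Qed.

Lemma ipNr x y : ip x (- y) = - ip x y.
Proof. by rewrite ipC ipNl ipC. Qed.

Lemma ip0l y : ip 0 y = 0.
Proof. by rewrite -(scale0r 0) ipZl mul0r. Qed.

Lemma ip0r y : ip y 0 = 0.
Proof. by rewrite ipC ip0l. Qed.

Definition ipE := (ipDl, ipDr, ipNl, ipNr, ipZl, ipZr, ip0l, ip0r).

Lemma ip_suml (I : Type) (s : seq I) (P : pred I) (F : I -> V) y :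
  ip (\sum_(i <- s | P i) F i) y = \sum_(i <- s | P i) ip (F i) y.
Proof.
apply: (big_morph (fun x => ip x y)) => [u v|]; first exact: ipDl.
exact: ip0l.
Qed.

Lemma cauchy_schwarz x y : ip x y ^+ 2 <= ip x x * ip y y.
Proof.
apply: discriminant_le => [||t]; rewrite ?ip_ge0//.
have := ip_ge0 (x - t *: y); rewrite !ipE (ipC y x).
rewrite (_ : ip x x - _ + _ = ip x x - 2 * t * ip x y + t ^+ 2 * ip y y)//.
ring.
Qed.

Lemma ip_eq0 x y : ip x x = 0 -> ip x y = 0.
Proof.
move=> x0; apply/eqP; rewrite -sqrf_eq0 eq_le sqr_ge0 andbT.
by rewrite (le_trans (cauchy_schwarz _ _))// x0 mul0r.
Qed.

Lemma ip_addr_le x y : ip (x + y) (x + y) <= 2 * ip x x + 2 * ip y y.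
Proof. by have := ip_ge0 (x - y); rewrite !ipE (ipC y x); lra. Qed.

Definition hn x := Num.sqrt (ip x x).

Lemma hn_ge0 x : 0 <= hn x. Proof. exact: sqrtr_ge0. Qed.

Lemma hn_sqr x : hn x ^+ 2 = ip x x.
Proof. by rewrite sqr_sqrtr// ip_ge0. Qed.

Lemma ip_le_hn x y : `|ip x y| <= hn x * hn y.
Proof.
rewrite -(@ler_pXn2r _ 2) ?nnegrE ?mulr_ge0 ?hn_ge0//.
by rewrite exprMn !hn_sqr real_normK ?num_real// cauchy_schwarz.
Qed.

Lemma hnD x y : hn (x + y) <= hn x + hn y.
Proof.
rewrite -(@ler_pXn2r _ 2) ?nnegrE ?addr_ge0 ?hn_ge0//.
rewrite sqrrD !hn_sqr !ipE (ipC y x).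
by have := ler_normlW (ip_le_hn x y); lra.
Qed.

Lemma hnN x : hn (- x) = hn x.
Proof. by rewrite /hn !ipE opprK. Qed.

Lemma hnBC x y : hn (x - y) = hn (y - x).
Proof. by rewrite -hnN opprB. Qed.

Lemma hnZ a x : hn (a *: x) = `|a| * hn x.
Proof.
by rewrite /hn !ipE mulrA -expr2 sqrtrM ?sqr_ge0// sqrtr_sqr.
Qed.

Lemma hn_le x c : 0 <= c -> (ip x x <= c ^+ 2) = (hn x <= c).
Proof. by move=> c0; rewrite -hn_sqr ler_pXn2r// nnegrE ?hn_ge0. Qed.

Lemma hcvgP (u : nat -> V) x : hcvg u x <->
  forall e : R, 0 < e -> exists N, forall n, (N <= n)%N -> hn (u n - x) <= e.
Proof.
split=> H e e0.
  have [N HN] := H (e ^+ 2) (exprn_gt0 _ e0).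
  by exists N => n /HN; rewrite hn_le// ltW.
have se0 : 0 < Num.sqrt e by rewrite sqrtr_gt0.
have [N HN] := H _ se0; exists N => n /HN.
by rewrite -hn_le ?sqrtr_ge0// sqr_sqrtr// ltW.
Qed.

Lemma hcvg_unique (u : nat -> V) x y : hcvg u x -> hcvg u y ->
  ip (x - y) (x - y) = 0.
Proof.
move=> /hcvgP ux /hcvgP uy; apply/eqP; rewrite -hn_sqr sqrf_eq0 eq_le hn_ge0.
rewrite andbT; apply/ler_addgt0Pr => e e0; rewrite add0r.
have e20 : 0 < e / 2 by rewrite divr_gt0.
have [N1 H1] := ux _ e20; have [N2 H2] := uy _ e20.
have {}H1 := H1 _ (leq_maxl N1 N2); have {}H2 := H2 _ (leq_maxr N1 N2).
move: H1 H2; set w := u _ => H1 H2; rewrite (splitr e).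
have -> : x - y = (x - w) + (w - y) by rewrite addrA subrK.
by rewrite (le_trans (hnD _ _))// lerD// hnBC.
Qed.

Lemma hcvg_lin (u v : nat -> V) x y a : hcvg u x -> hcvg v y ->
  hcvg (fun n => a *: u n + v n) (a *: x + y).
Proof.
move=> /hcvgP ux /hcvgP vy; apply/hcvgP => e e0.
have e20 : 0 < e / 2 by rewrite divr_gt0.
have a0 : 0 < `|a| + 1 by rewrite ltr_wpDl.
have [N1 H1] := ux _ (divr_gt0 e20 a0); have [N2 H2] := vy _ e20.
exists (maxn N1 N2) => n; rewrite geq_max => /andP[/H1 {}H1 /H2 {}H2].
have -> : a *: u n + v n - (a *: x + y) = a *: (u n - x) + (v n - y).
  by rewrite scalerBr opprD addrACA.
rewrite (le_trans (hnD _ _))// (splitr e) lerD// hnZ.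
rewrite (le_trans (ler_wpM2l (normr_ge0 _) H1))//.
rewrite mulrA ler_pdivrMr// [leLHS]mulrC; apply: ler_wpM2l; first exact: ltW.
by rewrite lerDl.
Qed.

Lemma hcvg_hn (u : nat -> V) x : hcvg u x ->
  forall e : R, 0 < e -> exists N, forall n, (N <= n)%N -> `|hn (u n) - hn x| <= e.
Proof.
move=> /hcvgP ux e e0; have [N H] := ux e e0; exists N => n /H {}H.
rewrite ler_norml; have := hnD (u n - x) x; rewrite subrK.
have := hnD (x - u n) (u n); rewrite subrK (hnBC x) => *; apply/andP; split; lra.
Qed.

Definition subspace (W : set V) :=
  W 0 /\ forall a x y, W x -> W y -> W (a *: x + y).

Definition hclosure (W : set V) : set V :=
  [set x | forall e : R, 0 < e -> exists2 w, W w & ip (x - w) (x - w) <= e].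

Lemma sub_hclosure (W : set V) : W `<=` hclosure W.
Proof. by move=> x Wx e e0; exists x => //; rewrite subrr ip0l ltW. Qed.

Lemma hclosure_sub (W : set V) : subspace W -> subspace (hclosure W).
Proof.
move=> [W0 Wl]; split; first exact: sub_hclosure.
move=> a x y cx cy e e0.
have A : 0 < 2 * (a ^+ 2 + 1) by rewrite mulr_gt0// ltr_wpDl ?sqr_ge0.
have e2 : 0 < e / 2 by rewrite divr_gt0.
have [w Ww xw] := cx _ (divr_gt0 e2 A).
have [v Wv yv] := cy (e / 4) (divr_gt0 e0 (ltr0n _ 4)).
exists (a *: w + v); first exact: Wl.
have -> : a *: x + y - (a *: w + v) = a *: (x - w) + (y - v).
  by rewrite scalerBr opprD addrACA.
rewrite (le_trans (ip_addr_le _ _))// ipZl ipZr.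
move: xw yv; set p := ip (x - w) _; set q := ip (y - v) _ => xw yv.
have : p * (2 * (a ^+ 2 + 1)) <= e / 2 by rewrite -ler_pdivlMr.
have p0 : 0 <= p by exact: ip_ge0.
have : 0 <= a ^+ 2 * p by rewrite mulr_ge0// sqr_ge0.
have -> : 2 * (a * (a * p)) = 2 * (a ^+ 2 * p) by ring.
have -> : p * (2 * (a ^+ 2 + 1)) = 2 * (a ^+ 2 * p) + 2 * p by ring.
lra.
Qed.

Lemma hclosure_idem (W : set V) : hclosure (hclosure W) `<=` hclosure W.
Proof.
move=> x cx e e0; have e4 : 0 < e / 4 by rewrite divr_gt0.
have [y cy xy] := cx _ e4; have [w Ww yw] := cy _ e4; exists w => //.
have -> : x - w = (x - y) + (y - w) by rewrite addrA subrK.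
rewrite (le_trans (ip_addr_le _ _))//; lra.
Qed.

(** A sequence whose squared distances come within 1/(n+1) of the infimum is Cauchy by the
    parallelogram law. Orthogonality holds in the limit: moving the n-th approximant along v cannot
    beat the infimum, which by the discriminant bounds [ip (x - w n) v ^+ 2] by [ip v v] over
    n+1. *)
Lemma projection (W : set V) x : subspace W -> hclosure W `<=` W ->
  exists2 p, W p & forall w, W w -> ip (x - p) w = 0.
Proof.
move=> [W0 Wl] Wc.
pose D := [set r | exists2 w, W w & r = ip (x - w) (x - w)].
have D0 : D !=set0 by exists (ip (x - 0) (x - 0)); exists 0.
have Dlb : lbound D 0 by move=> _ [w _ ->]; exact: ip_ge0.
have hD : has_inf D by split => //; exists 0.
have dP w : W w -> inf D <= ip (x - w) (x - w).
  by move=> Ww; apply: ge_inf; [exists 0|exists w].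
have /choice[w wP] (n : nat) : exists w, W w /\
    ip (x - w) (x - w) <= inf D + n.+1%:R^-1.
  have [_ [w Ww ->] H] : exists2 r, D r & r < inf D + n.+1%:R^-1.
    by apply: inf_adherent => //; rewrite invr_gt0.
  by exists w; split => //; exact: ltW.
have wW n : W (w n) by have [] := wP n.
have wle n : ip (x - w n) (x - w n) <= inf D + n.+1%:R^-1 by have [] := wP n.
have [p wp] : exists p, hcvg w p.
  apply: hilbert_complete => e e0.
  have e4 : 0 < e / 4 by rewrite divr_gt0.
  have [N HN] := invS_small e4; exists N => m n /HN Hm /HN Hn.
  have Wmn : W (2^-1 *: w m + 2^-1 *: w n).
    by apply: (Wl) => //; rewrite -[X in W X]addr0; exact: Wl.
  have := dP _ Wmn; have := wle m; have := wle n.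
  move: Hm Hn; move: (m.+1%:R^-1 : R) (n.+1%:R^-1 : R) => rm rn Hm Hn.
  rewrite !ipE !(ipC (w m) x) !(ipC (w n) x) (ipC (w n) (w m)); lra.
have Wp : W p.
  apply: Wc => e e0; have [N HN] := wp e e0; exists (w N) => //.
  by rewrite -opprB ipNl ipNr opprK HN.
exists p => // v Wv.
have key n : ip (x - w n) v ^+ 2 <= n.+1%:R^-1 * ip v v.
  apply: discriminant_le => [||t]; rewrite ?ip_ge0 ?invr_ge0//.
  have : W (t *: v + w n) by exact: Wl.
  move/dP; have := wle n.
  have -> : x - (t *: v + w n) = (x - w n) - t *: v.
    by rewrite opprD addrA addrAC.
  move: (n.+1%:R^-1 : R) => rn; move: (x - w n) => z; rewrite !ipE (ipC v z) expr2. lra.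
apply/eqP; rewrite -sqrf_eq0 eq_le sqr_ge0 andbT.
apply/ler_addgt0Pr => e e0; rewrite add0r.
have vv := ip_ge0 v.
(* Two squared errors, each doubled by (A + B)^2 <= 2 A^2 + 2 B^2, give the 4; the added 1 keeps the
   divisor positive. *)
have C0 : 0 < 4 * (ip v v + 1) by rewrite mulr_gt0// ltr_wpDl.
have eC : 0 < e / (4 * (ip v v + 1)) by rewrite divr_gt0.
have [N1 H1] := invS_small eC; have [N2 H2] := wp _ eC.
have {}H1 := H1 _ (leq_maxl N1 N2); have {}H2 := H2 _ (leq_maxr N1 N2).
have := key (maxn N1 N2); have := cauchy_schwarz (w (maxn N1 N2) - p) v.
move: H1 H2; set n := maxn _ _.
have -> : ip (x - p) v = ip (x - w n) v + ip (w n - p) v.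
  by rewrite -ipDl addrA subrK.
set A := ip (x - w n) v; set B := ip (w n - p) v.
set r : R := n.+1%:R^-1; set s := ip (w n - p) _.
set k : R := e / _ => H1 H2.
have kE : 4 * (k * ip v v) + 4 * k = e.
  rewrite [RHS](_ : _ = k * (4 * (ip v v + 1))); first ring.
  by rewrite /k divfK// gt_eqF.
have h1 : r * ip v v <= k * ip v v by exact: ler_wpM2r.
have h2 : s * ip v v <= k * ip v v by exact: ler_wpM2r.
have : (A + B) ^+ 2 <= 2 * A ^+ 2 + 2 * B ^+ 2.
  by rewrite -subr_ge0 (_ : _ - _ = (A - B) ^+ 2) ?sqr_ge0//; ring.
have k0 : 0 < k by [].
clearbody A B r s k; lra.
Qed.

Lemma hclosure_orth (W : set V) x : (forall w, W w -> ip x w = 0) ->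
  forall w, hclosure W w -> ip x w = 0.
Proof.
move=> xW w cw; apply/eqP; rewrite -sqrf_eq0 eq_le sqr_ge0 andbT.
apply/ler_addgt0Pr => e e0; rewrite add0r.
have x1 : 0 < ip x x + 1 by rewrite ltr_wpDl// ip_ge0.
have [v Wv wv] := cw _ (divr_gt0 e0 x1).
have -> : ip x w = ip x (w - v) by rewrite ipDr ipNr (xW v)// subr0.
rewrite (le_trans (cauchy_schwarz _ _))//.
rewrite (le_trans (ler_wpM2l (ip_ge0 _) wv))// mulrA ler_pdivrMr// mulrC.
by apply: ler_wpM2l; [exact: ltW|rewrite lerDl].
Qed.

(** The kernel of l is closed by the bound. If z is the component of some [x0] outside the kernel
    that is orthogonal to it, subtracting a multiple of z moves any x into the kernel, so l is a
    multiple of the inner product with z. *)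
Lemma riesz (l : V -> R) (c : R) :
  (forall a x y, l (a *: x + y) = a * l x + l y) ->
  (forall x, l x ^+ 2 <= c * ip x x) -> exists y, forall x, l x = ip x y.
Proof.
move=> ll lc; have [l0|] := pselect (forall x, l x = 0).
  by exists 0 => x; rewrite ip0r l0.
move=> /existsNP[x0 /eqP lx0].
have l0 : l 0 = 0 by have := ll (-1) 0 0; rewrite scaler0 addr0 mulN1r addNr.
have lZ a x : l (a *: x) = a * l x by rewrite -[a *: x]addr0 ll l0 addr0.
have lB x y : l (x - y) = l x - l y.
  by rewrite addrC -scaleN1r ll mulN1r addrC.
have c0 : 0 < c.
  have : 0 < l x0 ^+ 2 by rewrite lt_def sqr_ge0 sqrf_eq0 lx0.
  move=> /lt_le_trans/(_ (lc x0)); have := ip_ge0 x0; nra.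
have [||q /= lq qP] := @projection [set x | l x = 0] x0.
- by split => //= a x y lx ly; rewrite ll lx ly mulr0 addr0.
- move=> x cx /=; apply/eqP; rewrite -sqrf_eq0 eq_le sqr_ge0 andbT.
  apply/ler_addgt0Pr => e e0; rewrite add0r.
  have [w /= lw xw] := cx _ (divr_gt0 e0 c0).
  have -> : l x = l (x - w) by rewrite lB lw subr0.
  by rewrite (le_trans (lc _))// -ler_pdivlMl// mulrC.
pose z := x0 - q.
have lz : l z = l x0 by rewrite /z lB lq subr0.
have z0 : 0 < ip z z.
  rewrite lt_def ip_ge0 andbT; apply: contra lx0 => /eqP z0.
  rewrite -lz -sqrf_eq0 eq_le sqr_ge0 andbT.
  by rewrite (le_trans (lc _))// z0 mulr0.
exists ((l x0 / ip z z) *: z) => x; rewrite ipZr.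
have : ip z (x - (l x / l x0) *: z) = 0.
  by apply: qP => /=; rewrite lB lZ lz divfK// subrr.
rewrite ipDr ipNr ipZr (ipC z x) => /eqP; rewrite subr_eq0 => /eqP ->.
by field; rewrite lx0 gt_eqF.
Qed.

End hilbert_theory.

(** * Polar decomposition *)

Definition lin (R : realType) (V W : lmodType R) (f : V -> W) :=
  forall a x y, f (a *: x + y) = a *: f x + f y.

Section lin_theory.
Context {R : realType} {V W : lmodType R} (f : V -> W) (fl : lin f).

Lemma lin0 : f 0 = 0.
Proof. by have := fl (-1) 0 0; rewrite scaler0 addr0 scaleN1r addNr. Qed.

Lemma linZ a x : f (a *: x) = a *: f x.
Proof. by rewrite -[a *: x]addr0 fl lin0 addr0. Qed.

Lemma linD x y : f (x + y) = f x + f y.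
Proof. by rewrite -[x]scale1r fl !scale1r. Qed.

Lemma linN x : f (- x) = - f x.
Proof. by rewrite -scaleN1r linZ scaleN1r. Qed.

Lemma linB x y : f (x - y) = f x - f y.
Proof. by rewrite linD linN. Qed.

Lemma lin_sum (I : Type) (s : seq I) (P : pred I) (F : I -> V) :
  f (\sum_(i <- s | P i) F i) = \sum_(i <- s | P i) f (F i).
Proof. by apply: (big_morph f) => [u v|]; [exact: linD|exact: lin0]. Qed.

End lin_theory.

Section hprod.
Context {R : realType} (V W : hilbert R).

Definition hprod_ip (x y : (V * W)%type) := ip x.1 y.1 + ip x.2 y.2.

Lemma hprod_complete (u : nat -> (V * W)%type) :
  (forall e : R, 0 < e -> exists N, forall m n, (N <= m)%N -> (N <= n)%N ->
       hprod_ip (u m - u n) (u m - u n) <= e) ->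
    exists x, forall e : R, 0 < e -> exists N, forall n, (N <= n)%N ->
       hprod_ip (u n - x) (u n - x) <= e.
Proof.
move=> uc.
have [x1 H1] : exists x, hcvg (fun n => (u n).1) x.
  apply: hilbert_complete => e /uc[N HN]; exists N => m n Nm Nn.
  by apply: le_trans (HN m n Nm Nn); rewrite /hprod_ip /= lerDl ip_ge0.
have [x2 H2] : exists x, hcvg (fun n => (u n).2) x.
  apply: hilbert_complete => e /uc[N HN]; exists N => m n Nm Nn.
  by apply: le_trans (HN m n Nm Nn); rewrite /hprod_ip /= lerDr ip_ge0.
exists (x1, x2) => e e0; have e2 : 0 < e / 2 by rewrite divr_gt0.
have [N1 K1] := H1 _ e2; have [N2 K2] := H2 _ e2.
exists (maxn N1 N2) => n; rewrite geq_max => /andP[/K1 {}K1 /K2 {}K2].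
by rewrite (splitr e) lerD.
Qed.

Definition hprod : hilbert R.
Proof.
apply: (@Hilbert R (V * W)%type hprod_ip _ _ _ _ hprod_complete).
- by move=> x y; rewrite /hprod_ip ipC (ipC x.2).
- by move=> x y z; rewrite /hprod_ip !ipDl addrACA.
- by move=> a x y; rewrite /hprod_ip !ipZl mulrDr.
- by move=> x; rewrite addr_ge0// ip_ge0.
Defined.

Lemma hprod_ipE (x y : hprod) : ip x y = ip x.1 y.1 + ip x.2 y.2.
Proof. by []. Qed.

End hprod.

(** * Polynomials in an operator *)

Section poly_op.
Context {R : realType} {V : lmodType R} (F : V -> V) (Fl : lin F).
Implicit Types p q : {poly R}.

Definition op p v := \sum_(i < size p) p`_i *: iter i F v.

Lemma opE n p v : (size p <= n)%N -> op p v = \sum_(i < n) p`_i *: iter i F v.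
Proof.
move=> pn; rewrite /op (big_ord_widen n (fun i => p`_i *: iter i F v))//.
rewrite [RHS](bigID (fun i : 'I_n => (i < size p)%N)) /=.
rewrite [X in _ + X]big1 ?addr0// => i.
by rewrite -leqNgt => /(nth_default 0) ->; rewrite scale0r.
Qed.

Lemma opD p q v : op (p + q) v = op p v + op q v.
Proof.
rewrite (opE _ (size_polyD p q)) (opE _ (leq_maxl (size p) (size q))).
rewrite (opE _ (leq_maxr (size p) (size q))) -big_split /=.
by apply: eq_bigr => i _; rewrite coefD scalerDl.
Qed.

Lemma opZ a p v : op (a *: p) v = a *: op p v.
Proof.
rewrite (opE _ (size_scale_leq a p)) scaler_sumr.
by apply: eq_bigr => i _; rewrite coefZ scalerA.
Qed.

Lemma opN p v : op (- p) v = - op p v.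
Proof. by rewrite -(scaleN1r p) opZ scaleN1r. Qed.

Lemma opC c v : op c%:P v = c *: v.
Proof.
by rewrite (opE _ (size_polyC_leq1 c)) big_ord_recl big_ord0 addr0 coefC.
Qed.

Lemma op1 v : op 1 v = v.
Proof. by rewrite opC scale1r. Qed.

Lemma op0 v : op 0 v = 0.
Proof. by rewrite opC scale0r. Qed.

Lemma lin_iter n : lin (iter n F).
Proof. by elim: n => [//|n IH] a x y; rewrite !iterS IH Fl. Qed.

Lemma lin_op p : lin (op p).
Proof.
move=> a x y; rewrite /op scaler_sumr -big_split /=; apply: eq_bigr => i _.
by rewrite lin_iter scalerDr !scalerA mulrC.
Qed.

Lemma op_comm (U : V -> V) : lin U -> (forall v, U (F v) = F (U v)) ->
  forall p v, U (op p v) = op p (U v).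
Proof.
move=> Ul UF p v; rewrite /op lin_sum//; apply: eq_bigr => i _.
rewrite linZ//; congr (_ *: _).
by elim: (nat_of_ord i) => //= n IH; rewrite UF IH.
Qed.

Lemma opMX p v : op (p * 'X) v = op p (F v).
Proof.
rewrite (@opE (size p).+1); last first.
  by rewrite (leq_trans (size_polyMleq _ _))// size_polyX addn2.
rewrite big_ord_recl coefMX scale0r add0r; apply: eq_bigr => i _.
by rewrite coefMX /= -iterSr.
Qed.

Lemma opX v : op 'X v = F v.
Proof. by rewrite -['X]mul1r opMX op1. Qed.

Lemma opM p q v : op (p * q) v = op p (op q v).
Proof.
elim/poly_ind: p v => [|p c IH] v; first by rewrite mul0r !op0.
rewrite mulrDl -mulrA (mulrC 'X) mulrA !opD !opMX IH mul_polyC opZ opC.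
by rewrite (op_comm Fl).
Qed.

End poly_op.

(** * The partial isometry of a contraction as a limit of polynomials *)

Section polar.
Context {R : realType} {V K : hilbert R} (T : V -> K).
Hypothesis Kd : definite K.
Hypotheses (Tl : lin T) (T1 : forall x, ip (T x) (T x) <= ip x x).
Variable F : V -> V.
Hypotheses (Fl : lin F) (FE : forall x y, ip (F x) y = ip (T x) (T y)).
Implicit Types p q : {poly R}.
Local Notation op := (op F).

Lemma F_sym x y : ip (F x) y = ip x (F y).
Proof. by rewrite FE ipC -FE ipC. Qed.

Lemma op_sym p x y : ip (op p x) y = ip x (op p y).
Proof.
rewrite /op ip_suml [RHS]ipC ip_suml; apply: eq_bigr => i _.
rewrite !ipZl; congr (_ * _); rewrite (ipC _ x).
elim: (nat_of_ord i) x y => //= n IH x y.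
by rewrite F_sym IH -iterSr.
Qed.

(** Positivity of p(F) in the operator order. Polynomials in F commute, so each operator inequality
    below is a [ring] identity that writes a polynomial through products and sums already known to
    be positive. *)
Definition pos p := forall v, 0 <= ip (op p v) v.

Lemma posX : pos 'X.
Proof. by move=> v; rewrite opX FE ip_ge0. Qed.

Lemma pos1X : pos (1 - 'X).
Proof. by move=> v; rewrite opD op1 opN opX ipDl ipNl subr_ge0 FE. Qed.

Lemma posD p q : pos p -> pos q -> pos (p + q).
Proof. by move=> hp hq v; rewrite opD ipDl addr_ge0. Qed.

Lemma posZ a p : 0 <= a -> pos p -> pos (a *: p).
Proof. by move=> a0 hp v; rewrite opZ ipZl mulr_ge0. Qed.

Lemma pos1 : pos 1.
Proof. by move=> v; rewrite op1 ip_ge0. Qed.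

Lemma pos_sqrM p q : pos q -> pos (p ^+ 2 * q).
Proof.
move=> hq v; rewrite expr2 -mulrA (opM Fl) op_sym mulrC (opM Fl).
exact: hq.
Qed.

Lemma pos_sqr p : pos (p ^+ 2).
Proof. by rewrite -[_ ^+ 2]mulr1; exact: pos_sqrM pos1. Qed.

(* The Riesz-Nagy argument: p is the sum of the squares of the polynomials
   a_n defined by a_0 = p and a_(n+1) = a_n - a_n ^ 2. *)
Lemma posM p q : pos p -> pos (1 - p) -> pos q -> pos (p * q).
Proof.
move=> hp hp1 hq v.
pose a n := iter n (fun s : {poly R} => s - s ^+ 2) p.
have aS n : a n.+1 = a n - a n ^+ 2 by [].
have a01 n : pos (a n) /\ pos (1 - a n).
  elim: n => [//|n [h0 h1]]; rewrite aS; split.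
    rewrite (_ : _ - _ = a n ^+ 2 * (1 - a n) + (1 - a n) ^+ 2 * a n); last ring.
    by apply: posD; exact: pos_sqrM.
  rewrite (_ : _ - _ = (1 - a n) + a n ^+ 2); last ring.
  by apply: posD h1 (pos_sqr _).
have pE N : p = \sum_(n < N) a n ^+ 2 + a N.
  elim: N => [|N IH]; first by rewrite big_ord0 add0r.
  by rewrite big_ord_recr aS -addrA (addrC (a N ^+ 2)) subrK.
have op_sum N (G : 'I_N -> {poly R}) w :
    op (\sum_i G i) w = \sum_i op (G i) w.
  by apply: (big_morph (fun s => op s w)) => [s t|]; rewrite ?opD ?op0.
(* The squared norms of the [op (a n) v] add up to at most [ip (op p v) v], so they cannot all
   exceed e. *)
have small e : 0 < e -> exists n, ip (op (a n) v) (op (a n) v) <= e.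
  move=> e0; apply: contrapT => /forallNP H.
  have He n : e < ip (op (a n) v) (op (a n) v) by rewrite ltNge; apply/negP/H.
  have B N : e *+ N <= ip (op p v) v.
    rewrite (pE N) opD ipDl op_sum ip_suml ler_wpDr//; first by have [] := a01 N.
    rewrite -[in leLHS](card_ord N) -sumr_const ler_sum// => i _.
    by rewrite expr2 opM// op_sym ltW.
  have := B (Num.truncn (ip (op p v) v / e)).+1.
  rewrite leNgt -mulr_natl -ltr_pdivrMr// => /negP; apply.
  exact: truncnS_gt.
(* Dropping the nonnegative terms [a i ^+ 2 * q] leaves a remainder that Cauchy-Schwarz makes
   small. *)
have low n : ip (op (a n) v) (op q v) <= ip (op (p * q) v) v.
  have -> : p * q = \sum_(i < n) a i ^+ 2 * q + a n * q.
    by rewrite -mulr_suml -mulrDl -pE.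
  rewrite opD ipDl op_sum (mulrC (a n)) (opM Fl) (op_sym q).
  rewrite lerDr [leRHS]ip_suml sumr_ge0// => i _; exact: pos_sqrM.
set X := ip (op (p * q) v) v in low *.
rewrite leNgt; apply/negP => X0.
have Q0 := ip_ge0 (op q v).
have Q1 : 0 < ip (op q v) (op q v) + 1 by rewrite ltr_wpDl.
have X2 : 0 < X ^+ 2 by rewrite lt_def sqr_ge0 sqrf_eq0 lt_eqF.
have [n Hn] := small _ (divr_gt0 X2 Q1).
have := cauchy_schwarz (op (a n) v) (op q v).
have := low n; set Y := ip (op (a n) v) (op q v) => YX Y2.
have : X ^+ 2 <= Y ^+ 2 by rewrite -[X ^+ 2]sqrrN -[Y ^+ 2]sqrrN; nra.
apply/negP; rewrite -ltNge (le_lt_trans Y2)//.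
rewrite (le_lt_trans (ler_wpM2r Q0 Hn))// mulrAC ltr_pdivrMr//.
by rewrite mulrDr mulr1 ltrDl.
Qed.

Lemma posMn p n : pos p -> pos (p *+ n).
Proof. by move=> hp; rewrite -scaler_nat; exact: posZ. Qed.

(** [ring] sees [half] as an unknown; its defining relation enters the identities below as explicit
    terms that vanish, such as multiples of [4 * half ^+ 2 - 1]. *)
Let half : {poly R} := (2^-1)%:P.

Let pos_half p : pos p -> pos (half * p).
Proof. by move=> hp; rewrite mul_polyC; apply: posZ; rewrite // invr_ge0. Qed.

Let half4 : 4 * half ^+ 2 = 1.
Proof.
rewrite /half -[4]/(4%:R) -polyC_natr -rmorphXn -rmorphM /=.
by rewrite (_ : _ * _ = 1) ?polyC1//; field.
Qed.

(* Newton's iteration for the inverse square root *)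
Fixpoint newton n : {poly R} :=
  if n is n'.+1 then newton n' * (half * (3 - 'X * newton n' ^+ 2)) else 1.

(** [ip (op (f n) v) v] is the squared norm of T applied to [op (newton n) v]. As functions on
    [0, 1] the [f n] increase to the indicator of ]0, 1], so [f n] approximates the projection onto
    the orthogonal complement of the kernel of F. *)
Let f n := 'X * newton n ^+ 2.

Let fS n : f n.+1 = f n * (half * (3 - f n)) ^+ 2.
Proof. by rewrite /f /=; ring. Qed.

(** [1 - f n.+1] is a quarter of [(1 - f n) ^+ 2] times [4 - f n], so the iteration stays between 0
    and 1. *)
Let f01 n : pos (f n) /\ pos (1 - f n).
Proof.
elim: n => [|n [h0 h1]].
  by rewrite /f /= expr1n mulr1; split; [exact: posX|exact: pos1X].
rewrite fS; split; first by rewrite mulrC; exact: pos_sqrM.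
rewrite (_ : _ - _ = (half * (1 - f n)) ^+ 2 * (1 *+ 3 + (1 - f n))); last first.
  by rewrite -[X in X - _]half4; ring.
by apply: pos_sqrM; apply: posD h1; apply: posMn; exact: pos1.
Qed.

Let f0 n : pos (f n). Proof. by have [] := f01 n. Qed.
Let y0 n : pos (1 - f n). Proof. by have [] := f01 n. Qed.
Let y1 n : pos (1 - (1 - f n)). Proof. by rewrite opprB addrC subrK. Qed.

Let fP n p : pos p -> pos (f n * p). Proof. exact: posM. Qed.
Let yP n p : pos p -> pos ((1 - f n) * p). Proof. exact: posM. Qed.

Let f_step n : pos (f n.+1 - f n).
Proof.
rewrite fS (_ : _ - _ = half * (half * (f n * ((1 - f n) * (1 *+ 4 + (1 - f n)))))
    + f n * (4 * half ^+ 2 - 1)); last by ring.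
rewrite half4 subrr mulr0 addr0.
do 2!apply: pos_half; apply: fP; apply: yP; apply: posD (y0 n).
by apply: posMn; exact: pos1.
Qed.

Let f_geX n : pos (f n - 'X).
Proof.
elim: n => [|n IH].
  by rewrite /f /= expr1n mulr1 subrr => v; rewrite op0 ip0l.
rewrite (_ : _ - _ = (f n.+1 - f n) + (f n - 'X)); last ring.
by apply: posD.
Qed.

(** [newton l] is [newton n] times factors [half * (3 - f)], each a combination of 1 and [1 - f]
    with nonnegative coefficients; so what starts as [f n * p] stays positive. *)
Let newton_cross n l p : (n <= l)%N -> pos p ->
  pos ('X * newton n * newton l * p).
Proof.
move=> /subnKC <-; elim: (l - n)%N p => [|k IH] p hp.
    rewrite addn0 (_ : _ * p = f n * p); first exact: fP.
    by rewrite /f; ring.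
rewrite addnS /= -/(f (n + k)).
rewrite (_ : _ * p = 'X * newton n * newton (n + k) *
    (half * (p *+ 2 + (1 - f (n + k)) * p))); last by ring.
by apply/IH/pos_half/posD; [exact: posMn|exact: yP].
Qed.

(** The difference is twice ['X * newton n * (newton m - newton n)], and the iterates increase.
    Consequently the increments of [Tn] are controlled by those of the monotone bounded sequence
    [c n v]. *)
Let newton_diff n m : (n <= m)%N ->
  pos (f m - f n - 'X * (newton m - newton n) ^+ 2).
Proof.
move=> nm.
rewrite (_ : _ - _ = ('X * newton n * (newton m - newton n)) *+ 2); last first.
  by rewrite /f; ring.
apply: posMn; move: nm => /subnKC <-; elim: (m - n)%N => [|k IH].
  by rewrite addn0 subrr mulr0 => v; rewrite op0 ip0l.
have h2 : half * 2 = 1.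
  by rewrite /half -[2]/(2%:R) -polyC_natr -rmorphM /= mulVf ?pnatr_eq0//.
rewrite addnS (_ : _ * _ = 'X * newton n * (newton (n + k) - newton n) +
    'X * newton n * newton (n + k) * (half * (1 - f (n + k))) +
    'X * newton n * newton (n + k) * (half * 2 - 1)); last first.
  by rewrite /f /=; ring.
rewrite h2 subrr mulr0 addr0.
apply: posD => //; apply: newton_cross; first exact: leq_addr.
by apply: pos_half.
Qed.

Let c n v := ip (op (f n) v) v.
Let Tn n v := T (op (newton n) v).

Let ip_T x : ip (T x) (T x) = ip (F x) x. Proof. by rewrite FE. Qed.

Let ip_Tp p v : ip (T (op p v)) (T (op p v)) = ip (op ('X * p ^+ 2) v) v.
Proof.
by rewrite ip_T mulrC expr2 -mulrA (opM Fl) op_sym mulrC (opM Fl) opX.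
Qed.

Let c_Tn n v : ip (Tn n v) (Tn n v) = c n v.
Proof. exact: ip_Tp. Qed.

Let c_le1 n v : c n v <= ip v v.
Proof. by have := y0 n v; rewrite opD op1 opN ipDl ipNl subr_ge0. Qed.

Let c_nd n v : c n v <= c n.+1 v.
Proof. by have := f_step n v; rewrite opD opN ipDl ipNl subr_ge0. Qed.

Let c_mono n m v : (n <= m)%N -> c n v <= c m v.
Proof.
move=> /subnKC <-; elim: (m - n)%N => [|k IH]; first by rewrite addn0.
by rewrite addnS (le_trans IH)// c_nd.
Qed.

Let Tn_diff n m v : (n <= m)%N ->
  ip (Tn m v - Tn n v) (Tn m v - Tn n v) <= c m v - c n v.
Proof.
move=> /newton_diff/(_ v).
rewrite /Tn -(linB Tl) -(opN F) -(opD F) ip_Tp.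
by rewrite 2!opD !opN !ipDl !ipNl subr_ge0.
Qed.

Let Tn_cvg v : exists w, hcvg (fun n => Tn n v) w.
Proof.
apply: hilbert_complete => e e0.
pose D := [set c n v | n in setT].
have hD : has_sup D.
  by split; [exists (c 0%N v), 0%N|exists (ip v v) => _ [n _ <-]; exact: c_le1].
have [_ [N _ <-] HN] := sup_adherent e0 hD.
have cle n : c n v <= sup D by apply: ub_le_sup; [case: hD|exists n].
have main m n : (N <= n)%N -> (n <= m)%N ->
    ip (Tn m v - Tn n v) (Tn m v - Tn n v) <= e.
  move=> Nn nm; rewrite (le_trans (Tn_diff _ nm))//.
  by have := c_mono v Nn; have := cle m; lra.
exists N => m n Nm Nn; have [mn|nm] := leqP m n; last exact: main (ltnW nm).
by rewrite -opprB ipNl ipNr opprK; exact: main.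
Qed.

Let y n v := ip (op (1 - f n) v) v.

Let y_c n v : y n v = ip v v - c n v.
Proof. by rewrite /y opD op1 opN ipDl ipNl. Qed.

(** As ['X <= 1], the value of [y n] at [F g] is at most [a n]. The increment [f n.+1 - f n]
    dominates ['X * (1 - f n)] because [f n >= 'X]; so the sums of the [a n] telescope, stay below
    [y 0 g], and some [a n] is small. *)
Let y_small_ran g e : 0 < e -> exists n, y n (F g) <= e.
Proof.
move=> e0; pose a n := ip (op ('X * (1 - f n)) g) g.
have ya n : y n (F g) <= a n.
  have : pos ((1 - f n) * ((1 - 'X) * 'X)).
    apply: yP; rewrite mulrC.
    by apply: posM; [exact: posX|exact: pos1X|exact: pos1X].
  move/(_ g); rewrite (_ : _ * (_ * _) = 'X * (1 - f n) - 'X * ((1 - f n) * 'X)); last ring.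
  rewrite opD opN ipDl ipNl subr_ge0; apply: le_trans.
  by rewrite (opM Fl) opX opMX F_sym.
have astep n : a n <= y n g - y n.+1 g.
  have : pos ((1 - f n) * (f n - 'X) + half * (half * (f n * ((1 - f n) * (1 - f n))))).
    apply: posD; first exact: yP (f_geX n).
    by do 2!apply: pos_half; apply/fP/yP.
  move/(_ g); rewrite (_ : _ + _ = ((1 - f n) - (1 - f n.+1)) - 'X * (1 - f n)
    + f n * (2 - f n) * (1 - 4 * half ^+ 2)); last by rewrite fS; ring.
  rewrite half4 subrr mulr0 addr0.
  by rewrite !opD !opN !ipDl !ipNl /a /y !opD !opN !ipDl !ipNl; lra.
apply: contrapT => /forallNP H.
have aN n : e <= a n.
  by rewrite (le_trans _ (ya n))// ltW// ltNge; apply/negP/H.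
have B N : e *+ N <= y 0%N g - y N g.
  elim: N => [|N IH]; first by rewrite subrr.
  by rewrite mulrS; have := astep N; have := aN N; lra.
have := B (Num.truncn (y 0%N g / e)).+1.
have := y0 (Num.truncn (y 0%N g / e)).+1 g; rewrite -/(y _ _) => h0 h1.
have : e *+ (Num.truncn (y 0%N g / e)).+1 <= y 0%N g by lra.
by rewrite leNgt -mulr_natl -ltr_pdivrMr// => /negP; apply; exact: truncnS_gt.
Qed.

(** A vector orthogonal to the kernel of T lies in the closure of the range of F, where
    [y_small_ran] applies; the remainder costs a multiple of its squared norm, [y n] being a
    positive quadratic form below [ip]. *)
Let y_small v : (forall x, T x = 0 -> ip v x = 0) ->
  forall e, 0 < e -> exists n, y n v <= e.
Proof.
move=> vT e e0.
pose W : set V := [set F g | g in setT].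
have Wsub : subspace W.
  split; first by exists 0 => //; exact: lin0.
  by move=> a _ _ [g _ <-] [h _ <-]; exists (a *: g + h) => //; exact: Fl.
have [p cp pP] := projection v (hclosure_sub Wsub) (@hclosure_idem _ _ W).
set q := v - p in pP.
have qF g : ip q (F g) = 0 by apply/pP/sub_hclosure; exists g.
have Tq : T q = 0 by apply: Kd; rewrite ip_T F_sym.
have vcl : hclosure W v.
  move=> r r0; have [w Ww pw] := cp _ (divr_gt0 r0 (ltr0n _ 2)); exists w => //.
  have -> : v - w = q + (p - w) by rewrite addrA subrK.
  rewrite (le_trans (ip_addr_le _ _))//.
  have -> : ip q q = 0.
    by rewrite {1}/q ipDl ipNl (vT _ Tq) (ipC p) (pP _ cp) subr0.
  by rewrite mulr0 add0r -ler_pdivlMl// mulrC.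
have [_ [g _ <-] gv] := vcl _ (divr_gt0 e0 (ltr0n _ 4)).
have [n Hn] := y_small_ran g (divr_gt0 e0 (ltr0n _ 4)); exists n.
have [a aE] : exists a : V, v = a + F g by exists (v - F g); rewrite subrK.
have {}gv : ip a a <= e / 4 by move: gv; rewrite aE addrK.
have := y0 n (a - F g); have := c_le1 n a; have := f0 n a.
rewrite aE; move: Hn; rewrite /y -/(c n a); move: (F g : V) => b Hn ca0 ca1.
have opB u w : op (1 - f n) (u - w) = op (1 - f n) u - op (1 - f n) w.
  by apply: linB; exact: lin_op.
have opD' u w : op (1 - f n) (u + w) = op (1 - f n) u + op (1 - f n) w.
  by apply: linD; exact: lin_op.
have aa : ip (op (1 - f n) a) a <= ip a a by rewrite -/(y n a) y_c gerBl.
rewrite opB opD' !ipDl !ipDr !ipNl !ipNr; lra.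
Qed.

(** P is the pointwise limit of [Tn]. Its squared norms are limits of [c n v], which tend to
    [ip v v] when [y n v] tends to 0; an isometry pair that intertwines T and commutes with F
    commutes with every polynomial, hence with the limit. *)
Lemma polar_limit : exists P : V -> K,
  [/\ lin P,
      forall v, (forall x, T x = 0 -> ip v x = 0) -> ip (P v) (P v) = ip v v &
      forall (U : V -> V) (U' : K -> K), lin U -> lin U' ->
        (forall x, ip (U' x) (U' x) = ip x x) ->
        (forall x, U (F x) = F (U x)) -> (forall x, T (U x) = U' (T x)) ->
        forall x, P (U x) = U' (P x)].
Proof.
have [P PP] := choice Tn_cvg; exists P.
have Puniq (u : nat -> K) (x z : K) : hcvg u x -> hcvg u z -> x = z.
  by move=> ux uz; apply: subr0_eq; apply: Kd; exact: hcvg_unique ux uz.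
split.
- move=> a x z; apply: Puniq (PP _) _.
  have := hcvg_lin a (PP x) (PP z).
  by rewrite (_ : (fun n => _) = Tn ^~ (a *: x + z))//; apply/funext => n;
    rewrite /Tn (lin_op Fl) Tl.
- move=> v vT; apply/eqP; rewrite eq_le; apply/andP; split.
    rewrite -!hn_sqr ler_pXn2r ?nnegrE ?hn_ge0//; apply/ler_addgt0Pr => e e0.
    have [N HN] := hcvg_hn (PP v) e0.
    have := HN _ (leqnn N); rewrite ler_norml => /andP[h _].
    have : hn (Tn N v) <= hn v by rewrite -hn_le ?hn_ge0// hn_sqr c_Tn c_le1.
    by lra.
  apply/ler_addgt0Pr => e e0.
  have [n Hn] := y_small vT (divr_gt0 e0 (ltr0n _ 2)).
  have lim : forall d : R, 0 < d -> hn (Tn n v) <= hn (P v) + d.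
    move=> d d0; have [N HN] := hcvg_hn (PP v) d0.
    have := HN _ (leq_maxl N n); rewrite ler_norml => /andP[_ h].
    have : hn (Tn n v) <= hn (Tn (maxn N n) v).
      rewrite -(@ler_pXn2r _ 2) ?nnegrE ?hn_ge0// !hn_sqr !c_Tn.
      by rewrite c_mono// leq_maxr.
    by lra.
  have : hn (Tn n v) <= hn (P v) by apply/ler_addgt0Pr.
  rewrite -(@ler_pXn2r _ 2) ?nnegrE ?hn_ge0// !hn_sqr c_Tn.
  by move: Hn; rewrite y_c; lra.
- move=> U U' Ul U'l U'i UF UT x; apply: Puniq (PP _) _.
  have TnU n : Tn n (U x) = U' (Tn n x) by rewrite /Tn -(op_comm Ul UF) UT.
  move=> e /(PP x)[N HN]; exists N => n /HN; apply: le_trans.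
  by rewrite TnU -(linB U'l) U'i.
Qed.

End polar.

(** F is T^* T, obtained from Riesz representation. The adjoints [Ui] and [Ui'] are carried along
    because the proof that U commutes with T^* T takes both intertwining relations. *)
Lemma polar (R : realType) (V K : hilbert R) (T : V -> K) :
  definite V -> definite K -> lin T -> (forall x, ip (T x) (T x) <= ip x x) ->
  exists P : V -> K,
  [/\ lin P,
      forall v, (forall x, T x = 0 -> ip v x = 0) -> ip (P v) (P v) = ip v v &
      forall (U Ui : V -> V) (U' Ui' : K -> K), lin U -> lin U' ->
        (forall x, ip (U' x) (U' x) = ip x x) ->
        (forall x y, ip (U x) y = ip x (Ui y)) ->
        (forall x y, ip (U' x) y = ip x (Ui' y)) ->
        (forall x, T (U x) = U' (T x)) -> (forall x, T (Ui x) = Ui' (T x)) ->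
        forall x, P (U x) = U' (P x)].
Proof.
move=> Vd Kd Tl T1.
have /choice[F FP] x : exists z, forall y, ip (T y) (T x) = ip y z.
  apply: (@riesz _ _ _ (ip x x)) => [a u w|w]; first by rewrite Tl ipDl ipZl.
  rewrite (le_trans (cauchy_schwarz _ _))// mulrC.
  by apply: ler_pM; rewrite ?ip_ge0.
have FE x y : ip (F x) y = ip (T x) (T y) by rewrite ipC -FP ipC.
have ext (x y : V) : (forall z, ip x z = ip y z) -> x = y.
  by move=> xy; apply: subr0_eq; apply: Vd; rewrite ipDl ipNl xy subrr.
have Fl : lin F.
  by move=> a x y; apply: ext => z; rewrite ipDl ipZl !FE Tl ipDl ipZl.
have [P [Pl Pi PU]] := polar_limit Kd Tl T1 Fl FE; exists P; split => //.
move=> U Ui U' Ui' Ul U'l U'i Ua U'a UT UiT; apply: PU => // x.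
by apply: ext => z; rewrite Ua !FE UT U'a UiT.
Qed.

(* [T] is x |-> G (1 + G^* G)^-1 x for the densely defined operator whose
   graph is [G]. *)
Lemma graph_contraction (R : realType) (V K : hilbert R)
    (G : set (hprod V K)) :
  definite V -> definite K -> subspace G -> hclosure G `<=` G ->
  (forall w : V, (forall v c, G (v, c) -> ip w v = 0) -> w = 0) ->
  exists T : V -> K,
  [/\ lin T, forall x, ip (T x) (T x) <= ip x x,
      forall x, T x = 0 -> G (x, 0) &
      forall (U Ui : V -> V) (U' Ui' : K -> K), lin U ->
        (forall x y, ip (U x) y = ip x (Ui y)) ->
        (forall x y, ip (U' x) y = ip x (Ui' y)) ->
        (forall v c, G (v, c) -> G (U v, U' c)) ->
        (forall v c, G (v, c) -> G (Ui v, Ui' c)) ->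
        forall x, T (U x) = U' (T x)].
Proof.
move=> Vd Kd Gs Gc Gd.
(* The projection of (x, 0) onto the graph of an operator B has components (1 + B^* B)^-1 x and B (1
   + B^* B)^-1 x. *)
have /choice[p pP] (x : V) : exists p : V * K, G p /\
    forall v c, G (v, c) -> ip (x - p.1) v = ip p.2 c.
  have [p Gp pP] := @projection R (hprod V K) G (x, 0 : K) Gs Gc; exists p; split => // v c Gvc.
  by have /eqP := pP _ Gvc; rewrite /= /hprod_ip /= sub0r ipNl subr_eq0 => /eqP.
(* The orthogonality relations determine the pair, so linearity and the symmetries are proved by
   checking them on a candidate. *)
have uniq x (u : V) (t : K) : G (u, t) ->
    (forall v c, G (v, c) -> ip (x - u) v = ip t c) -> p x = (u, t).
  move=> Gut utP; have [Gp xP] := pP x.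
  have Gd' : G (p x - (u, t)).
    by have [_ Gl] := Gs; rewrite addrC -scaleN1r; exact: Gl.
  move: Gp xP Gd'; case: (p x) => u' t' /= Gp xP Gd'.
  have h1 : ip (u' - u) (u' - u) + ip (t' - t) (t' - t) = 0.
    have := xP _ _ Gd'; have := utP _ _ Gd'; rewrite /= => e1 e2.
    have -> : ip (u' - u) (u' - u) = ip (x - u) (u' - u) - ip (x - u') (u' - u).
      by rewrite -ipNl -ipDl opprB [x - u + _]addrC addrA subrK.
    by rewrite e1 e2 (ipDl t') ipNl; ring.
  have := ip_ge0 (u' - u); have := ip_ge0 (t' - t) => h2 h3.
  congr (_, _); apply: subr0_eq; [apply: Vd|apply: Kd]; lra.
exists (fun x => (p x).2); split.
- move=> a x y; have [Gx xP] := pP x; have [Gy yP] := pP y.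
  rewrite (@uniq _ (a *: (p x).1 + (p y).1) (a *: (p x).2 + (p y).2))//.
    have [_ Gl] := Gs; have := Gl a (p x) (p y) Gx Gy.
    by case: (p x) (p y) => [? ?] [? ?].
  move=> v c Gvc; rewrite [RHS]ipDl ipZl -(xP _ _ Gvc) -(yP _ _ Gvc).
  by rewrite !ipDl !ipNl !ipDl !ipZl; ring.
- move=> x; have [Gx xP] := pP x.
  (* Testing the relations against the projection (u, t) itself gives |x|^2 = |x - u|^2 + |u|^2 + 2
     |t|^2. *)
  have := xP (p x).1 (p x).2; rewrite -surjective_pairing => /(_ Gx) h.
  have := ip_ge0 (x - (p x).1); have := ip_ge0 (p x).1.
  have := ip_ge0 (p x).2; move: h; move: (p x) => [u t] /=.
  have -> : x = (x - u) + u by rewrite subrK.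
  by rewrite addrK; move: (x - u) => z; rewrite !ipE (ipC u z); lra.
- move=> x tx; have [Gx xP] := pP x.
  have : x - (p x).1 = 0.
    by apply: Gd => v c Gvc; rewrite (xP _ _ Gvc) tx ip0l.
  by move=> /subr0_eq xE; rewrite -tx {1}xE -surjective_pairing.
- move=> U Ui U' Ui' Ul Ua U'a GU GUi x; have [Gx xP] := pP x.
  rewrite (@uniq _ (U (p x).1) (U' (p x).2))//.
    by apply: GU; rewrite -surjective_pairing.
  by move=> v c Gvc; rewrite -(linB Ul) Ua U'a; apply/xP/GUi.
Qed.

(** * Square-summable families *)

Section ell2.
Context (R : realType) (I : choiceType).
Implicit Types x y z : I -> R.

Definition sqsum x : \bar R := \esum_(i in setT) ((x i) ^+ 2)%:E.

Definition ell2pred : {pred I -> R} := mem [set x | (sqsum x < +oo)%E].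

Lemma ell2predP x : x \in ell2pred <-> (sqsum x < +oo)%E.
Proof. by split=> [/set_mem//|h]; exact: mem_set. Qed.

Lemma sqsum_ge0 x : (0 <= sqsum x)%E.
Proof. by apply: esum_ge0 => i _; rewrite lee_fin sqr_ge0. Qed.

Lemma sqsum_lin_le a x y :
  (sqsum (fun i => a * x i + y i)%R <= (2 * a ^+ 2)%:E * sqsum x + 2%:E * sqsum y)%E.
Proof.
have a0 : 0 <= 2 * a ^+ 2 by rewrite mulr_ge0// sqr_ge0.
have sq0 z i : setT i -> (0 <= (z i ^+ 2)%:E)%E by rewrite lee_fin sqr_ge0.
rewrite -!esumZ//; [|exact: sq0|exact: sq0].
rewrite -esumD; last 2 first.
  by move=> i _; rewrite -EFinM lee_fin mulr_ge0// sqr_ge0.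
  by move=> i _; rewrite -EFinM lee_fin mulr_ge0// sqr_ge0.
apply: le_esum => i _; rewrite -!EFinM -EFinD lee_fin /=.
rewrite -subr_ge0 (_ : _ - _ = (a * x i - y i) ^+ 2) ?sqr_ge0//.
by ring.
Qed.

Lemma ell2_submod_closed : submod_closed ell2pred.
Proof.
split=> [|a x y].
  apply/ell2predP; rewrite /sqsum esum1 ?ltry// => i _.
  by rewrite [X in X ^+ 2](_ : _ = 0)//= expr0n.
move=> /ell2predP xf /ell2predP yf; apply/ell2predP.
apply: le_lt_trans (sqsum_lin_le a x y) _.
have a0 : 0 <= 2 * a ^+ 2 by rewrite mulr_ge0// sqr_ge0.
by apply: lte_add_pinfty; apply: lte_mul_pinfty.
Qed.

HB.instance Definition _ :=
  GRing.isSubmodClosed.Build _ _ ell2pred ell2_submod_closed.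

Record ell2 := Ell2 { ell2val :> I -> R; ell2P : ell2val \in ell2pred }.
HB.instance Definition _ := [isSub for ell2val].
HB.instance Definition _ := [Choice of ell2 by <:].
HB.instance Definition _ := [SubChoice_isSubLmodule of ell2 by <:].

Implicit Types u v w : ell2.

Definition sqn u : R := fine (sqsum u).

Lemma sqnE u : (sqn u)%:E = sqsum u.
Proof.
have /ell2predP uf := ell2P u.
by rewrite fineK// ge0_fin_numE// sqsum_ge0.
Qed.

Lemma sqn_ge0 u : 0 <= sqn u.
Proof. by rewrite -lee_fin sqnE sqsum_ge0. Qed.

Lemma ell2D u v i : (u + v) i = u i + v i. Proof. by []. Qed.
Lemma ell2N u i : (- u) i = - u i. Proof. by []. Qed.
Lemma ell2Z a u i : (a *: u) i = a * u i. Proof. by []. Qed.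
Lemma ell20 i : (0 : ell2) i = 0. Proof. by []. Qed.
Definition ell2E := (ell2D, ell2N, ell2Z, ell20).

Lemma ell2_ext u v : (forall i, u i = v i) -> u = v.
Proof. by move=> uv; apply/val_inj/funext. Qed.

(* By polarization; every algebraic identity about it reduces to a termwise
   identity between sums of squares. *)
Definition ell2_ip u v : R := (sqn (u + v) - sqn (u - v)) / 4.

Lemma ell2_ipC u v : ell2_ip u v = ell2_ip v u.
Proof.
rewrite /ell2_ip (addrC v); congr ((_ - _) / _).
apply: EFin_inj; rewrite !sqnE; apply: eq_esum => i _.
by rewrite !ell2E -sqrrN opprB.
Qed.

Lemma sqn_sum (s : seq ell2) : (\sum_(u <- s) sqn u)%:E =
  \esum_(i in setT) (\sum_(u <- s) u i ^+ 2)%:E.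
Proof.
rewrite -sumEFin; under [RHS]eq_esum do rewrite -sumEFin.
rewrite esum_sum; last by move=> i u _ _; rewrite lee_fin sqr_ge0.
by apply: eq_bigr => u _; rewrite sqnE.
Qed.

Lemma sqn_sum_eq (s t : seq ell2) :
  (forall i, \sum_(u <- s) u i ^+ 2 = \sum_(u <- t) u i ^+ 2) ->
  \sum_(u <- s) sqn u = \sum_(u <- t) sqn u.
Proof.
by move=> st; apply: EFin_inj; rewrite !sqn_sum; apply: eq_esum => i _; rewrite st.
Qed.

Lemma ell2_ipDl u v w : ell2_ip (u + v) w = ell2_ip u w + ell2_ip v w.
Proof.
(* The two triples have the same sum of squares: in each of them the products with w cancel and 2 u
   v remains. *)
have := @sqn_sum_eq [:: u + v + w; u - w; v - w] [:: u + v - w; u + w; v + w].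
rewrite !big_cons !big_nil /ell2_ip => H.
suff : sqn (u + v + w) + (sqn (u - w) + (sqn (v - w) + 0)) =
  sqn (u + v - w) + (sqn (u + w) + (sqn (v + w) + 0)) by lra.
by apply: H => i; rewrite !big_cons !big_nil !ell2E; ring.
Qed.

Lemma sqnZ a u : sqn (a *: u) = a ^+ 2 * sqn u.
Proof.
apply: EFin_inj; rewrite EFinM !sqnE -esumZ ?sqr_ge0//; last first.
  by move=> i _; rewrite lee_fin sqr_ge0.
by apply: eq_esum => i _; rewrite ell2E exprMn EFinM.
Qed.

Lemma ell2_ipZl_ge0 a u v : 0 <= a -> ell2_ip (a *: u) v = a * ell2_ip u v.
Proof.
(* Writing a as a square turns [a * sqn (u - v)] into a sum of squares, hence the restriction to a
   >= 0. *)
move=> a0; have := @sqn_sum_eq [:: a *: u + v; Num.sqrt a *: (u - v)]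
  [:: a *: u - v; Num.sqrt a *: (u + v)].
rewrite !big_cons !big_nil !sqnZ sqr_sqrtr// /ell2_ip => H.
suff : sqn (a *: u + v) + (a * sqn (u - v) + 0) =
  sqn (a *: u - v) + (a * sqn (u + v) + 0) by lra.
by apply: H => i; rewrite !big_cons !big_nil !ell2E !exprMn sqr_sqrtr//; ring.
Qed.

Lemma ell2_ipNl u v : ell2_ip (- u) v = - ell2_ip u v.
Proof.
have := ell2_ipDl u (- u) v; rewrite subrr => h.
have : ell2_ip 0 v = 0 by have := ell2_ipZl_ge0 0 v (lexx 0); rewrite scale0r mul0r.
by rewrite h => /eqP; rewrite addrC addr_eq0 => /eqP.
Qed.

Lemma ell2_ipZl a u v : ell2_ip (a *: u) v = a * ell2_ip u v.
Proof.
have [/ell2_ipZl_ge0//|a0] := leP 0 a.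
by rewrite -[a]opprK scaleNr ell2_ipNl ell2_ipZl_ge0 ?mulNr// oppr_ge0 ltW.
Qed.

Lemma ell2_ipxx u : ell2_ip u u = sqn u.
Proof.
have -> : ell2_ip u u = (sqn (2 *: u) - sqn (0 *: u)) / 4.
  by rewrite /ell2_ip subrr scaler_nat mulr2n scale0r.
by rewrite !sqnZ; lra.
Qed.

Lemma coord_le_sqn u i : u i ^+ 2 <= sqn u.
Proof.
rewrite -lee_fin sqnE; have := @sum_le_esum R I setT (fun i => (u i ^+ 2)%:E) [fset i]%fset.
by rewrite big_seq_fset1; apply.
Qed.

(** Coordinates converge; the norm of the limit is controlled through finite partial sums, which
    suffices since [sqsum] is their supremum. *)
Lemma ell2_complete (u : nat -> ell2) :
  (forall e : R, 0 < e -> exists N, forall m n, (N <= m)%N -> (N <= n)%N ->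
       ell2_ip (u m - u n) (u m - u n) <= e) ->
    exists x : ell2, forall e : R, 0 < e -> exists N, forall n, (N <= n)%N ->
       ell2_ip (u n - x) (u n - x) <= e.
Proof.
move=> uc.
have cv i : cvg ((u n i) @[n --> \oo]).
  apply/cauchy_cvgP/cauchy_exP => e e0.
  have e2 : 0 < (e / 2) ^+ 2 by rewrite exprn_gt0// divr_gt0.
  have [N HN] := uc _ e2.
  exists (u N i); exists N => // n /= Nn.
  have := HN N n (leqnn N) Nn; rewrite ell2_ipxx => h.
  have := le_trans (coord_le_sqn (u N - u n) i) h.
  rewrite !ell2E -[(_ - _) ^+ 2]real_normK ?num_real//.
  rewrite ler_pXn2r ?nnegrE ?normr_ge0 ?(ltW (divr_gt0 e0 _))// => h'.
  rewrite /ball /=; apply: le_lt_trans h' _.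
  by rewrite ltr_pdivrMr// ltr_pMr// ltr1n.
pose x i := lim ((u n i) @[n --> \oo]).
have fatou n (e : R) : (exists N, forall m, (N <= m)%N -> sqn (u n - u m) <= e) ->
    (sqsum (fun i => u n i - x i)%R <= e%:E)%E.
  move=> [N HN]; apply: esum_le => X _; rewrite sumEFin lee_fin.
  have cvX : (\sum_(i <- X) (u n i - u m i) ^+ 2) @[m --> \oo] -->
      \sum_(i <- X) (u n i - x i) ^+ 2.
    apply: cvg_big => [|i _]; first exact: add_continuous.
    rewrite expr2; apply: cvgM; apply: cvgB; [exact: cvg_cst|exact: cv|
      exact: cvg_cst|exact: cv].
  rewrite -(cvg_lim _ cvX)//; apply: limr_le; first by apply/cvg_ex; eexists; exact: cvX.
  exists N => // m /= Nm; have := HN m Nm.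
  rewrite -lee_fin sqnE -lee_fin -sumEFin; apply: le_trans.
  exact: sum_le_esum.
have [N0 HN0] := uc 1 ltr01.
have xP : x \in ell2pred.
  have h : (fun i => u N0 i - x i) \in ell2pred.
    apply/ell2predP; rewrite (@le_lt_trans _ _ 1%:E) ?ltry//; apply: fatou.
    by exists N0 => m ?; rewrite -ell2_ipxx; exact: HN0.
  rewrite (_ : x = (u N0 : I -> R) - (fun i => u N0 i - x i)).
    by apply: rpredB => //; exact: ell2P.
  apply/funext => i.
  have xE : x i = u N0 i - (u N0 i - x i) by ring.
  by rewrite {1}xE.
exists (Ell2 xP) => e e0; have [N HN] := uc e e0; exists N => n Nn.
rewrite ell2_ipxx -lee_fin sqnE; apply: fatou.
by exists N => m ?; rewrite -ell2_ipxx; exact: HN.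
Qed.

Definition ell2_hilbert : hilbert R.
Proof.
apply: (@Hilbert R ell2 ell2_ip ell2_ipC ell2_ipDl ell2_ipZl _ ell2_complete).
by move=> x; rewrite ell2_ipxx sqn_ge0.
Defined.

Lemma ell2_definite : definite ell2_hilbert.
Proof.
move=> x /=; rewrite ell2_ipxx => x0; apply: ell2_ext => i; apply/eqP.
by rewrite ell2E -sqrf_eq0 eq_le sqr_ge0 andbT -x0 coord_le_sqn.
Qed.

Lemma ell2_delta_subproof (i : I) : (fun j => (j == i)%:R : R) \in ell2pred.
Proof.
apply/ell2predP; rewrite /sqsum (esumID [set i]); last by move=> j _; rewrite lee_fin sqr_ge0.
rewrite setTI esum_set1 ?lee_fin ?sqr_ge0// eqxx esum1 ?adde0 ?ltry//.
by move=> j [_ /= /eqP/negbTE ->]; rewrite expr0n.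
Qed.

Definition delta i := Ell2 (ell2_delta_subproof i).

Lemma sqn_off i u v : (forall j, j != i -> u j = v j) ->
  sqn u - u i ^+ 2 = sqn v - v i ^+ 2.
Proof.
move=> uv; pose c w : \bar R := (\esum_(j in ~` [set i]) (w j ^+ 2)%:E)%E.
have split1 w : (sqn w)%:E = ((w i ^+ 2)%:E + c w)%E.
  rewrite sqnE /sqsum (esumID [set i]); last by move=> j _; rewrite lee_fin sqr_ge0.
  by rewrite !setTI esum_set1// lee_fin sqr_ge0.
have cuv : c u = c v by apply: eq_esum => j /= /eqP ji; rewrite uv.
have cE w : c w = (sqn w - w i ^+ 2)%:E.
  by rewrite EFinB split1 addeAC subee// add0e.
by apply: EFin_inj; rewrite -!cE.
Qed.

Lemma ip_delta u i : ell2_ip u (delta i) = u i.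
Proof.
have pE : (u + delta i) i = u i + 1 by rewrite ell2E /= eqxx.
have mE : (u - delta i) i = u i - 1 by rewrite !ell2E /= eqxx.
have : sqn (u + delta i) - (u + delta i) i ^+ 2 =
       sqn (u - delta i) - (u - delta i) i ^+ 2.
  by apply: sqn_off => j /negbTE ji; rewrite !ell2E /= ji subr0 addr0.
rewrite pE mE /ell2_ip; move: (sqn _) (sqn _) (u i : R) => a b x.
by rewrite !expr2 => h; lra.
Qed.

End ell2.

Section signed_permutation.
Context {R : realType} {I : choiceType} (s : I -> R) (p p' : I -> I).
Hypotheses (s2 : forall i, s i ^+ 2 = 1) (pK : cancel p p') (p'K : cancel p' p).
Local Notation E := (ell2_hilbert R I).

Lemma sqsum_sperm (x : I -> R) : sqsum (fun i => s i * x (p i)) = sqsum x.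
Proof.
rewrite /sqsum -(esum_bij (fun i => (x i ^+ 2)%:E) pK p'K).
by apply: eq_esum => i _; rewrite exprMn s2 mul1r.
Qed.

Lemma sperm_subproof (x : ell2 R I) : (fun i => s i * x (p i)) \in @ell2pred R I.
Proof. by apply/ell2predP; rewrite sqsum_sperm; apply/ell2predP/ell2P. Qed.

(** Multiplication by i and translations act in this way on families of coefficients. *)
Definition sperm (x : E) : E := Ell2 (sperm_subproof x).

Lemma spermE x i : sperm x i = s i * x (p i). Proof. by []. Qed.

Lemma sperm_lin : lin sperm.
Proof.
by move=> a x y; apply: ell2_ext => i; rewrite !(spermE, ell2E) mulrDr mulrCA.
Qed.

Lemma sqn_sperm x : sqn (sperm x) = sqn x.
Proof. by rewrite /sqn /= sqsum_sperm. Qed.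

Lemma ip_sperm (x y : E) : ip (sperm x) (sperm y) = ip x y.
Proof.
rewrite /= /ell2_ip; congr ((_ - _) / _).
  by rewrite -[RHS]sqn_sperm (linD sperm_lin).
by rewrite -[RHS]sqn_sperm (linB sperm_lin).
Qed.

End signed_permutation.

Lemma ip_sperm_adj (R : realType) (I : choiceType) (s s' : I -> R)
    (p p' : I -> I) (s2 : forall i, s i ^+ 2 = 1) (s2' : forall i, s' i ^+ 2 = 1)
    (pK : cancel p p') (p'K : cancel p' p) :
  (forall i, s i * s' (p i) = 1) ->
  forall x y : ell2_hilbert R I,
    ip (sperm s2 pK p'K x) y = ip x (sperm s2' p'K pK y).
Proof.
move=> ss' x y; rewrite -(ip_sperm s2 pK p'K x); congr (ip _ _).
by apply: ell2_ext => i; rewrite !spermE pK mulrA ss' mul1r.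
Qed.

(** * The space L2 *)

Section real_L2.
Context {disp : measure_display} {T : measurableType disp} {R : realType}.
Variable mu : {measure set T -> \bar R}.

Definition sqint (f : T -> R) : \bar R := (\int[mu]_x ((f x) ^+ 2)%:E)%E.

Local Arguments sqint f%_R.

Lemma sqint_ge0 f : (0 <= sqint f)%E.
Proof. by apply: integral_ge0 => x _; rewrite lee_fin sqr_ge0. Qed.

Lemma Lnorm2_sqr (f : T -> R) :
  (Lnorm mu 2%:E (EFin \o f) `^ 2 = sqint f)%E.
Proof.
rewrite powR_Lnorm ?pnatr_eq0//; apply: eq_integral => x _.
by rewrite /comp abse_EFin poweR_EFin powR_mulrn// real_normK ?num_real.
Qed.

Lemma Lfun2P (f : T -> R) : f \in Lfun mu 2%:E <->
  measurable_fun setT f /\ (sqint f < +oo)%E.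
Proof.
split=> [f2|[mf f2]].
  split; first by case/andP: f2 => /set_mem.
  have /integrableP[_] := Lfun2_integrable_sqr f2; apply: le_lt_trans.
  rewrite le_eqVlt; apply/orP; left; apply/eqP; apply: eq_integral => x _.
  by rewrite /= ger0_norm ?sqr_ge0.
apply/andP; split; first exact: mem_set.
apply/mem_set; rewrite /= /finite_norm; apply: (@lty_poweRy _ _ 2) => //.
by rewrite Lnorm2_sqr.
Qed.

Definition L2R := LfunType mu (lee1n 2).

Lemma L2R_measurable (f : L2R) : measurable_fun setT f.
Proof. by have /Lfun2P[] : (f : T -> R) \in Lfun mu 2%:E by exact: LfunP. Qed.

Lemma L2R_mul (f g : L2R) : mu.-integrable setT (EFin \o (f \* g)).
Proof.
by apply/Lfun1_integrable; apply: Lfun2_mul_Lfun1; exact: LfunP.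
Qed.

Definition L2ip (f g : L2R) : R := \int[mu]_x (f x * g x).

Lemma L2ipC f g : L2ip f g = L2ip g f.
Proof. by apply: eq_Rintegral => x _; rewrite mulrC. Qed.

Lemma L2ipDl f g h : L2ip (f + g) h = L2ip f h + L2ip g h.
Proof.
rewrite /L2ip -RintegralD//; last 2 first.
- exact: L2R_mul.
- exact: L2R_mul.
by apply: eq_Rintegral => x _; rewrite /= mulrDl.
Qed.

Lemma L2ipZl a f g : L2ip (a *: f) g = a * L2ip f g.
Proof.
rewrite /L2ip -RintegralZl//; last exact: L2R_mul.
by apply: eq_Rintegral => x _; rewrite -mulrA.
Qed.

Lemma L2ipxx f : (L2ip f f)%:E = sqint f.
Proof.
rewrite /L2ip /Rintegral fineK//.
  exact: integrable_fin_num (L2R_mul f f).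
Qed.

Lemma L2ip_ge0 f : 0 <= L2ip f f.
Proof. by rewrite -lee_fin L2ipxx sqint_ge0. Qed.

(** Fatou's lemma for the sequence shifted by N, as the bound holds only from N on. *)
Lemma fatou_cvg (f : nat -> T -> \bar R) (g : T -> \bar R) (c : \bar R) (N : nat) :
  (forall k, measurable_fun setT (f k)) -> (forall k x, (0 <= f k x)%E) ->
  (forall x, f k x @[k --> \oo] --> g x) ->
  (forall k, (N <= k)%N -> (\int[mu]_x f k x <= c)%E) ->
  (\int[mu]_x g x <= c)%E.
Proof.
move=> mf f0 fg fc.
have -> : (\int[mu]_x g x = \int[mu]_x limn_einf (fun k => f (k + N)%N x))%E.
  apply: eq_integral => x _; have fgx : f (k + N)%N x @[k --> \oo] --> g x.
    by apply: (@cvg_comp _ _ _ (addn^~ N) (f ^~ x)); [exact: cvg_addnr|exact: fg].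
  by rewrite is_cvg_limn_einfE ?(cvg_lim _ fgx)//; apply/cvg_ex; exists (g x).
apply: le_trans (fatou _ _ _ _) _ => //.
rewrite limn_einf_lim; apply: lime_le; first exact: is_cvg_einfs.
apply: nearW => n; apply: ereal_inf_le; exists (\int[mu]_x f (n + N)%N x)%E.
  by exists n => //=.
by apply: fc; rewrite leq_addl.
Qed.

(** Each increment is at most the square root of g divided by 2^k, so the telescoping series
    converges absolutely. *)
Lemma summable_increments_cvg (v : nat -> R) (g : R) :
  (forall k, 4 ^+ k * (v k.+1 - v k) ^+ 2 <= g) -> cvgn v.
Proof.
move=> vg; have g0 : 0 <= g.
  by apply: le_trans (vg 0%N); rewrite expr0 mul1r sqr_ge0.
have -> : v = (fun n => v 0%N + series (telescope v) n).
  by apply/funext => n; rewrite -eq_sum_telescope.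
apply: is_cvgD; first exact: is_cvg_cst.
apply: normed_cvg; apply: (@series_le_cvg _ _ (geometric (Num.sqrt g) 2^-1)).
- by move=> n; exact: normr_ge0.
- by move=> n; apply: geometric_ge0; rewrite ?sqrtr_ge0 ?invr_ge0.
- move=> n; rewrite /geometric /= /telescope.
  rewrite -[leLHS]sqrtr_sqr.
  have -> : (2^-1 ^+ n : R) = Num.sqrt (4^-1 ^+ n).
    rewrite (_ : 4^-1 ^+ n = (2^-1 ^+ n) ^+ 2) ?sqrtr_sqr ?ger0_norm ?exprn_ge0 ?invr_ge0//.
    by rewrite -exprM mulnC exprM expr2 -invfM -natrM.
  rewrite -sqrtrM// ler_sqrt ?mulr_ge0 ?exprn_ge0 ?invr_ge0//.
  by rewrite exprVn ler_pdivlMr ?exprn_gt0// mulrC.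
- by apply: is_cvg_geometric_series; rewrite ger0_norm ?invr_ge0// invf_lt1// ltr1n.
Qed.

(** Riesz-Fischer. Along a subsequence whose squared increments integrate to at most 8^-k, the sum G
    of these increments weighted by 4^k has integral at most 2. It is therefore finite almost
    everywhere, and there the subsequence converges geometrically. *)
Lemma L2R_complete (u : nat -> L2R) :
  (forall e : R, 0 < e -> exists N, forall m n, (N <= m)%N -> (N <= n)%N ->
       L2ip (u m - u n) (u m - u n) <= e) ->
  exists x : L2R, forall e : R, 0 < e -> exists N, forall n, (N <= n)%N ->
       L2ip (u n - x) (u n - x) <= e.
Proof.
move=> uc.
have /choice[N HN] k : exists N, forall m n, (N <= m)%N -> (N <= n)%N ->
    (sqint (u m - u n) <= (8^-1 ^+ k : R)%:E)%E.
  have k0 : 0 < 8^-1 ^+ k :> R by rewrite exprn_gt0// invr_gt0.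
  have [M HM] := uc _ k0; exists M => m n Mm Mn.
  by rewrite -L2ipxx lee_fin HM.
pose nk := fix nk k := if k is k'.+1 then maxn (nk k').+1 (N k) else N 0%N.
have nkN k : (N k <= nk k)%N by case: k => //= k; exact: leq_maxr.
have nk_lt k : (nk k < nk k.+1)%N by exact: leq_maxl.
have nk_mono k : (nk k <= nk k.+1)%N by exact: ltnW.
have nk_id k : (k <= nk k)%N by elim: k => // k IH; exact: leq_ltn_trans IH (nk_lt _).
pose v k : L2R := u (nk k).
have mv k : measurable_fun setT (v k) by exact: L2R_measurable.
pose g k x : \bar R := (4 ^+ k * (v k.+1 x - v k x) ^+ 2)%:E.
have g0 k x : (0 <= g k x)%E.
  by rewrite lee_fin; apply: mulr_ge0; [exact: exprn_ge0|exact: sqr_ge0].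
have mg k : measurable_fun setT (g k).
  apply/measurable_EFinP; apply: measurable_funM; first exact: measurable_cst.
  by apply: measurable_funX; apply: measurable_funB; exact: mv.
pose G x := (\sum_(k <oo) g k x)%E.
have mG : measurable_fun setT G.
  have := @ge0_emeasurable_sum _ T R setT g xpredT.
  by under eq_fun do rewrite (eq_eseriesl (Q := xpredT))//; apply.
have G0 x : (0 <= G x)%E by apply: nneseries_ge0.
have Gfin : (\int[mu]_x G x < +oo)%E.
  rewrite integral_nneseries//; apply: (@le_lt_trans _ _ 2%:E); last exact: ltry.
  apply: lime_le; first by apply: is_cvg_nneseries => k _ _; exact: integral_ge0.
  apply: nearW => n; rewrite big_mkord.
  have gi k : (\int[mu]_x g k x <= (2^-1 ^+ k : R)%:E)%E.
    have -> : (\int[mu]_x g k x = (4 ^+ k)%:E * sqint (v k.+1 - v k))%E.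
      rewrite /sqint -ge0_integralZl_EFin//.
      - by move=> x _; rewrite lee_fin sqr_ge0.
      - by apply/measurable_EFinP/measurable_funX; exact: L2R_measurable.
    have : (sqint (v k.+1 - v k) <= (8^-1 ^+ k : R)%:E)%E.
      by apply: HN; [exact: leq_trans (nkN _) (nk_mono _)|exact: nkN].
    move/(lee_wpmul2l (_ : 0 <= (4 ^+ k)%:E)%E) => h; apply: le_trans (h _) _.
      by rewrite lee_fin exprn_ge0.
    rewrite -EFinM lee_fin -exprMn (_ : 4 / 8 = 2^-1 :> R)//.
    by field.
  apply: (@le_trans _ _ (\sum_(k < n) (2^-1 ^+ k : R)%:E)%E).
    by apply: lee_sum => k _; exact: gi.
  rewrite sumEFin lee_fin.
  have -> : \sum_(k < n) (2^-1 ^+ k : R) = series (geometric 1 2^-1) n.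
    by rewrite seriesEord; apply: eq_bigr => k _; rewrite /geometric /= mul1r.
  have := @geometric_le_lim R n 1 2^-1 ler01.
  move=> h; apply: le_trans (h _ _) _; rewrite ?invr_gt0//.
    by rewrite ger0_norm ?invr_ge0// invf_lt1// ltr1n.
  by rewrite le_eqVlt; apply/orP; left; apply/eqP; field.
pose A := [set x | (G x < +oo)%E].
have mA : measurable A by rewrite -[A]setTI; exact: emeasurable_fun_infty_o.
have AE : {ae mu, forall x, A x}.
  have : mu.-integrable setT G.
    apply/integrableP; split => //; apply: le_lt_trans Gfin.
    by rewrite le_eqVlt; apply/orP; left; apply/eqP; apply: eq_integral => x _;
      rewrite gee0_abs.
  move/(integrable_ae measurableT); apply: filterS => x /(_ I).
  by rewrite ge0_fin_numE.
(* The cut makes the sequence converge everywhere, so that its limit is measurable, and changes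
   functions on a null set only. *)
pose w k x := v k x * \1_A x.
have mw k : measurable_fun setT (w k).
  by apply: measurable_funM; [exact: mv|exact: measurable_indic].
have cw x : cvgn (w ^~ x).
  rewrite /w indicE; have [/set_mem Ax|xA] := boolP (x \in A); last first.
    by apply: (cvgP 0); under eq_fun do rewrite mulr0; exact: cvg_cst.
  apply: (@summable_increments_cvg _ (fine (G x))) => k; rewrite !mulr1.
  rewrite -lee_fin fineK ?ge0_fin_numE//.
  apply: le_trans (nneseries_lim_ge k.+1 _) => //=.
  by rewrite big_nat_recr//= leeDr// sume_ge0.
pose f x := limn (w ^~ x).
have mf : measurable_fun setT f.
  by apply: (measurable_fun_cvg mw) => x _; exact: cw.
(* Fatou along the subsequence turns the Cauchy bound into a bound on the distance to the limit. *)
have key n (e : R) : (exists K, forall m, (K <= m)%N -> L2ip (u n - u m) (u n - u m) <= e) ->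
    (sqint (fun x => (u n x - f x)%R) <= e%:E)%E.
  move=> [K HK].
  have muA : measurable_fun setT (fun x => u n x * \1_A x).
    by apply: measurable_funM; [exact: L2R_measurable|exact: measurable_indic].
  have -> : sqint (fun x => (u n x - f x)%R) =
      (\int[mu]_x (((u n x * \1_A x - f x) ^+ 2)%:E))%E.
    apply: ge0_ae_eq_integral => //.
    - apply/measurable_EFinP/measurable_funX.
      by apply: measurable_funB; [exact: L2R_measurable|exact: mf].
    - apply/measurable_EFinP/measurable_funX.
      by apply: measurable_funB; [exact: muA|exact: mf].
    - by move=> x _; rewrite lee_fin sqr_ge0.
    - by move=> x _; rewrite lee_fin sqr_ge0.
    - by apply: filterS AE => x Ax _; rewrite indicE mem_set// mulr1.
  apply: (@fatou_cvg (fun k x => ((u n x * \1_A x - w k x) ^+ 2)%:E) _ _ K).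
  - move=> k; apply/measurable_EFinP/measurable_funX.
    by apply: measurable_funB; [exact: muA|exact: mw].
  - by move=> k x; rewrite lee_fin sqr_ge0.
  - move=> x; apply: cvg_EFin; first by near=> k.
    under eq_fun do rewrite expr2.
    rewrite expr2; apply: cvgM; apply: cvgB; (exact: cvg_cst || exact: cw).
  - move=> k /leq_trans/(_ (nk_id k)) /HK; rewrite -lee_fin L2ipxx; apply: le_trans.
    apply: ge0_le_integral => //.
    + by move=> x _; rewrite lee_fin sqr_ge0.
    + apply/measurable_EFinP/measurable_funX.
      by apply: measurable_funB; [exact: muA|exact: mw].
    + by apply/measurable_EFinP/measurable_funX; exact: L2R_measurable.
    + move=> x _; rewrite lee_fin /w -mulrBl exprMn indicE.
      by case: (x \in A); rewrite ?expr1n ?mulr1// expr0n mulr0 sqr_ge0.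
have [N0 HN0] := uc 1 ltr01.
have f2 : f \in Lfun mu 2%:E.
  have h : (fun x => u N0 x - f x) \in Lfun mu 2%:E.
    apply/Lfun2P; split; first by apply: measurable_funB; [exact: L2R_measurable|exact: mf].
    apply: (@le_lt_trans _ _ 1%:E); last exact: ltry.
    by apply: key; exists N0 => m Nm; exact: HN0.
  have -> : f = (u N0 : T -> R) - (fun x => u N0 x - f x).
    apply/funext => x; have xE : f x = u N0 x - (u N0 x - f x) by ring.
    by rewrite {1}xE.
  by apply: rpredB => [|?|?]; [exact: lee1n|exact: (LfunP (u N0))|exact: h].
exists (Lfun_Sub (lee1n 2) f2) => e e0; have [M HM] := uc e e0; exists M => n Mn.
by rewrite -lee_fin L2ipxx; apply: key; exists M => m Mm; exact: HM.
Unshelve. all: by end_near.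
Qed.

Definition L2_hilbert : hilbert R :=
  Hilbert L2ipC L2ipDl L2ipZl L2ip_ge0 L2R_complete.

End real_L2.

(** * Lebesgue measure under linear maps *)

Definition push_measure (d1 d2 : measure_display) (X : measurableType d1)
    (Y : measurableType d2) (R : realType) (mu : {measure set X -> \bar R})
    (T : X -> Y) (mT : measurable_fun setT T) : {measure set Y -> \bar R}.
Proof. by unshelve refine (pushforward mu T). Defined.

Section scaled_map.
Context {d1 d2 : measure_display} {X : measurableType d1} {Y : measurableType d2}.
Context {R : realType}.
Variables (mu : {measure set X -> \bar R}) (nu : {measure set Y -> \bar R}).

(** Preimages are measured, so for an invertible matrix c is the inverse of the absolute value of
    the determinant. *)
Definition scales (T : X -> Y) (c : R) :=
  [/\ 0 <= c, measurable_fun setT T &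
      forall A, measurable A -> mu (T @^-1` A) = (c%:E * nu A)%E].

Lemma integral_scales (T : X -> Y) (c : R) (f : Y -> \bar R) :
  scales T c -> measurable_fun setT f -> (forall y, (0 <= f y)%E) ->
  (\int[mu]_x f (T x) = c%:E * \int[nu]_y f y)%E.
Proof.
move=> [c0 mT Tc] mf f0.
have <- := @ge0_integral_pushforward _ _ _ _ _ _ mT mu setT f measurableT mf _.
  pose cn : {nonneg R} := NngNum c0.
  rewrite -[c]/(cn%:num) -(ge0_integral_mscale nu measurableT cn mf)//.
  apply: (eq_measure_integral (mscale cn nu)) => A mA _.
  exact: Tc.
by move=> y _; exact: f0.
Qed.

End scaled_map.
Arguments scales {d1 d2 X Y R}.

Lemma scales_comp (d1 d2 d3 : measure_display) (X : measurableType d1)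
    (Y : measurableType d2) (Z : measurableType d3) (R : realType)
    (mu : {measure set X -> \bar R}) (nu : {measure set Y -> \bar R})
    (rho : {measure set Z -> \bar R}) (T : X -> Y) (S : Y -> Z) (c c' : R) :
  scales mu nu T c -> scales nu rho S c' -> scales mu rho (S \o T) (c * c').
Proof.
move=> [c0 mT Tc] [c'0 mS Sc]; split; first exact: mulr_ge0.
  exact: measurableT_comp.
move=> A mA; rewrite comp_preimage Tc ?Sc ?EFinM ?muleA//.
by rewrite -[X in measurable X]setTI; exact: mS.
Qed.

(** [|a|] times the pushforward agrees with Lebesgue measure on half-open intervals. A negative a
    exchanges the open and the closed end without changing the length. *)
Lemma scales_affine1 (R : realType) (a b : R) : a != 0 ->
  scales (@lebesgue_measure R) (@lebesgue_measure R)
    (fun t : measurableTypeR R => a * t + b) `|a|^-1.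
Proof.
move=> a0; have Na0 : 0 < `|a| by rewrite normr_gt0.
have mT : @measurable_fun _ _ (measurableTypeR R) (measurableTypeR R) setT
    (fun t => a * t + b).
  by apply: measurable_funD => //; exact: measurable_funM.
split=> // A mA.
pose cn : {nonneg R} := NngNum (ltW Na0).
pose nu := mscale cn (push_measure (@lebesgue_measure R) mT).
have H : forall X, ocitv X -> @lebesgue_measure R X = nu X.
  move=> _ [[x y] _ <-].
  have [yx|xy] := leP y x.
    by rewrite !set_itv_ge ?measure0// bnd_simp -leNgt.
  rewrite /nu /mscale /push_measure /pushforward /=.
  have [ap|an] := ltP 0 a.
    rewrite [X in (_ * lebesgue_measure X)%E](_ : _ =
        `](x - b) / a, (y - b) / a]%classic); last first.
      by apply/seteqP; split=> t /=; rewrite in_itv/=; rewrite in_itv/= ltr_pdivrMr// ler_pdivlMr// ltrBlDr lerBrDr mulrC.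
    rewrite !lebesgue_measure_itv/= !lte_fin xy ltr_pM2r ?invr_gt0// ltrD2r xy.
    by rewrite -!EFinB -EFinM; congr (_%:E); rewrite gtr0_norm//; field.
  have {}an : a < 0 by rewrite lt_neqAle a0.
  rewrite [X in (_ * lebesgue_measure X)%E](_ : _ =
      `[(y - b) / a, (x - b) / a[%classic); last first.
    by apply/seteqP; split=> t /=; rewrite in_itv/=; rewrite in_itv/= ler_ndivrMr// ltr_ndivlMr// ltrBlDr lerBrDr mulrC andbC.
  rewrite !lebesgue_measure_itv/= !lte_fin xy ltr_nM2r ?invr_lt0// ltrD2r xy.
  by rewrite -!EFinB -EFinM; congr (_%:E); rewrite ltr0_norm//; field.
have h := lebesgue_measure_unique H mA.
rewrite [X in (_ * X)%E]h /nu /mscale /push_measure /pushforward /= muleA -EFinM.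
by rewrite mulVf ?gt_eqF// mul1e.
Qed.

Section linear_maps.
Context {R : realType}.
Local Notation mu d := (lebesgue_cV R d : {measure set 'cV[R]_d -> \bar R}).
Local Notation scal d T c := (scales (mu d) (mu d) T c).

Lemma measurable_affine_map d (U : 'M[R]_d) (v : 'cV[R]_d) :
  measurable_fun setT (fun x : 'cV[R]_d => U *m x + v).
Proof.
apply: measurable_fun_coordP => i.
rewrite (_ : _ \o _ = fun x => \sum_j U i j * coord j x + v i 0); last first.
  by apply/funext => x; rewrite /coord /= !mxE.
apply: measurable_funD; last exact: measurable_cst.
apply: measurable_sum => j; apply: measurable_funM; first exact: measurable_cst.
exact: measurable_coord.
Qed.

Lemma lebesgue_cVS d (A : set 'cV[R]_d.+1) :
  mu d.+1 A = (\int[@lebesgue_measure R]_t mu d [set w | A (cV_cons (t, w))])%E.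
Proof.
rewrite /= /lebesgue_step /pushforward /product_measure1; apply: eq_integral => t _ /=.
congr (mu d _); apply/seteqP; split=> w; first by move/set_mem.
by move=> Aw; exact/mem_set.
Qed.

(* Induction on the dimension: slicing along the first coordinate. *)
Lemma scales_lower d (L : 'M[R]_d) (v : 'cV[R]_d) :
  (forall i j : 'I_d, (i < j)%N -> L i j = 0) -> (forall i, L i i != 0) ->
  scal d (fun x => L *m x + v) `|\prod_i L i i|^-1.
Proof.
elim: d L v => [|d IH] L v Ltrig Ldiag.
  split => //; first exact: measurable_affine_map.
  move=> A mA; rewrite big_ord0 normr1 invr1 mul1e.
  congr (mu 0 _); apply/seteqP; split=> x /=; rewrite (_ : _ + _ = x)//;
    by apply/matrixP => -[].
split => //; first exact: measurable_affine_map.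
move=> A mA.
pose L' : 'M[R]_d := \matrix_(i, j) L (lift ord0 i) (lift ord0 j).
(* The first coordinate of the image depends on t alone, and the slice over t undergoes an affine
   map whose translation depends on t; this is why the induction carries a translation. *)
pose w' t : 'cV[R]_d := \col_i (L (lift ord0 i) ord0 * t + v (lift ord0 i) 0).
have Tcons t w : L *m cV_cons (t, w) + v =
    cV_cons (L ord0 ord0 * t + v ord0 0, L' *m w + w' t).
  apply/colP => i; rewrite !mxE big_ord_recl !mxE unlift_none /=.
  have [j ->|->] := unliftP ord0 i.
    rewrite !mxE addrAC addrC; congr (_ + _).
    by apply: eq_bigr => k _; rewrite !mxE liftK.
  by rewrite big1 ?addr0// => k _; rewrite Ltrig// mul0r.
have mAt t : measurable [set w | A (cV_cons (t, w))].
  have := measurable_xsection t (measurable_cV_cons measurableT mA).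
  rewrite setTI; congr measurable; apply/seteqP; split=> w; first by move/set_mem.
  by move=> Aw; exact/mem_set.
pose phi t := mu d [set w | A (cV_cons (t, w))].
have mphi : measurable_fun setT phi.
  have := measurable_fun_xsection (mu d) (measurable_cV_cons measurableT mA).
  rewrite setTI; congr measurable_fun; apply/funext => t; congr (mu d _).
  apply/seteqP; split=> w; first by move/set_mem.
  by move=> Aw; exact/mem_set.
have IHt t := IH L' (w' t).
have c'E : \prod_i L' i i = \prod_(i < d) L (lift ord0 i) (lift ord0 i).
  by apply: eq_bigr => i _; rewrite mxE.
have slice (t : measurableTypeR R) : mu d [set w : 'cV[R]_d | A (L *m cV_cons (t, w) + v)] =
    (`|\prod_i L' i i|^-1%:E * phi (L ord0 ord0 * t + v ord0 0)%R)%E.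
  have [||_ _ IHA] := IHt t.
  - by move=> i j ij; rewrite mxE Ltrig.
  - by move=> i; rewrite mxE.
  rewrite -IHA; last exact: mAt.
  by congr (mu d _); apply/seteqP; split=> w; rewrite /= Tcons.
rewrite !lebesgue_cVS big_ord_recl normrM invfM EFinM -muleA muleCA.
under eq_integral do rewrite slice.
rewrite ge0_integralZl_EFin//; last first.
  by apply: (measurableT_comp mphi); have [] := scales_affine1 (v ord0 0) (Ldiag ord0).
rewrite -c'E; congr (_ * _)%E.
by rewrite (integral_scales (scales_affine1 (v ord0 0) (Ldiag ord0)) mphi).
Qed.

Lemma scales_shift d (v : 'cV[R]_d) : scal d (fun x => x + v) 1.
Proof.
have := @scales_lower d 1%:M v; rewrite big1 ?normr1 ?invr1; last by move=> i _; rewrite mxE eqxx.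
rewrite (_ : (fun x => _) = fun x => x + v); last by apply/funext => x; rewrite mul1mx.
apply; first by move=> i j ij; rewrite mxE -val_eqE ltn_eqF.
by move=> i; rewrite mxE eqxx oner_eq0.
Qed.

Lemma cV_boxes d : @measurable _ 'cV[R]_d =
  <<s [set B | exists2 A : 'I_d -> set (measurableTypeR R),
         forall i, measurable (A i) & B = [set x : 'cV[R]_d | forall i, A i (x i 0)]] >>.
Proof.
apply/seteqP; split.
  apply: smallest_sub; first exact: smallest_sigma_algebra.
  move=> B /=; rewrite -bigcup_seq => -[i _ [C mC <-]].
  apply: sub_sigma_algebra; exists (fun j => if j == i then C else setT).
    by move=> j; case: ifP.
  rewrite setTI; apply/seteqP; split=> x /= Cx; last by have := Cx i; rewrite eqxx.
  by move=> j; case: eqP => // ->.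
apply: smallest_sub; first exact: sigma_algebra_measurable.
move=> _ [A mA ->].
rewrite [X in measurable X](_ : _ = \bigcap_(i in [set: 'I_d]) (@coord R d i @^-1` A i)).
  by apply: fin_bigcap_measurable => // i _;
    rewrite -[X in measurable X]setTI; exact: measurable_coord.
by apply/seteqP; split=> [x /= + i _|x /= + i]; [exact|move/(_ i I)].
Qed.

Lemma measure_box d (A : 'I_d -> set (measurableTypeR R)) :
  (forall i, measurable (A i)) ->
  mu d [set x | forall i, A i (x i 0)] = (\prod_(i < d) @lebesgue_measure R (A i))%E.
Proof. exact: lebesgue_cV_box. Qed.

(** Permuting the sides of a box permutes the factors of its volume. Boxes are stable under
    intersection and generate, and the cubes [-n, n]^d exhaust the space, so the two measures
    coincide. *)
Lemma scales_perm d (s : 'S_d) : scal d (fun x => perm_mx s *m x) 1.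
Proof.
have mT : measurable_fun setT (fun x : 'cV[R]_d => perm_mx s *m x).
  have := measurable_affine_map (perm_mx s) 0.
  by rewrite (_ : (fun x => _) = fun x => perm_mx s *m x)//; apply/funext => x; rewrite addr0.
split => // A mA; rewrite mul1e.
pose nu := push_measure (mu d) mT.
apply/esym; rewrite -[RHS]/(nu A).
apply: (@measure_unique _ _ _ _ (fun n => [set x : 'cV[R]_d | forall i, `[(- n%:R)%R, n%:R]%classic (x i 0)]) (@cV_boxes d)) => //.
- move=> _ _ [A1 mA1 ->] [A2 mA2 ->]; exists (fun i => A1 i `&` A2 i).
    by move=> i; exact: measurableI.
  by apply/seteqP; split=> x /= => [[h1 h2] i|h]; [split|split=> i; have [] := h i].
- by move=> n; exists (fun=> `[(- n%:R)%R, n%:R]%classic).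
- apply/seteqP; split=> // x _.
  have [N HN] : exists N : nat, forall i, `|x i 0| <= N%:R.
    exists (\max_i (Num.truncn `|x i 0%R|).+1)%N => i.
    apply: (le_trans (ltW (truncnS_gt _))); rewrite ler_nat.
    exact: (@leq_bigmax_cond _ xpredT (fun i => (Num.truncn `|x i 0|).+1)).
  by exists N => // i; rewrite /= in_itv/= -ler_norml.
- move=> _ [B mB ->]; rewrite /= measure_box// /nu /push_measure /pushforward /=.
  have -> : (fun x : 'cV[R]_d => perm_mx s *m x) @^-1` [set x | forall i, B i (x i 0)] =
     [set x | forall i, B ((s^-1)%g i) (x i 0)].
    apply/seteqP; split=> x /= H i.
      by have := H ((s^-1)%g i); rewrite -row_permE mxE permKV.
    by have := H (s i); rewrite -row_permE mxE permK.
  apply: (etrans _ (esym (@measure_box d (fun i => B ((s^-1)%g i)) _))) => //.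
  rewrite [RHS](reindex_inj (@perm_inj _ s)) /=.
  by apply: eq_bigr => i _; rewrite permK.
- move=> n.
  apply: (@le_lt_trans _ _ (\prod_(i < d) @lebesgue_measure R `[(- n%:R)%R, n%:R]%classic)%E).
    by rewrite -measure_box.
  have [r ->] : exists r : R, @lebesgue_measure R `[(- n%:R)%R, n%:R]%classic = r%:E.
    rewrite lebesgue_measure_itv/=; case: ifP => _; last by exists 0.
    by rewrite -EFinB; eexists.
  by rewrite prodEFin ltry.
Qed.

Lemma scales_comp_lin d (U V : 'M[R]_d) c c' :
  scal d (fun x => V *m x) c -> scal d (fun x => U *m x) c' ->
  scal d (fun x => (U *m V) *m x) (c * c').
Proof.
move=> hV hU; have := scales_comp hV hU.
by rewrite (_ : _ \o _ = fun x : 'cV[R]_d => (U *m V) *m x)//; apply/funext => x /=; rewrite mulmxA.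
Qed.

Lemma scales_lower_lin d (L : 'M[R]_d) :
  (forall i j : 'I_d, (i < j)%N -> L i j = 0) -> (forall i, L i i != 0) ->
  scal d (fun x => L *m x) `|\prod_i L i i|^-1.
Proof.
move=> Lt Ld; have := scales_lower 0 Lt Ld.
by rewrite (_ : (fun x => _) = fun x => L *m x)//; apply/funext => x; rewrite addr0.
Qed.

(** Conjugation by the permutation that reverses the coordinates gives a lower triangular matrix
    with the same diagonal entries in reverse order. *)
Lemma scales_upper_lin d (U : 'M[R]_d) :
  (forall i j : 'I_d, (j < i)%N -> U i j = 0) -> (forall i, U i i != 0) ->
  scal d (fun x => U *m x) `|\prod_i U i i|^-1.
Proof.
move=> Ut Ud; pose s : 'S_d := perm (@rev_ord_inj d).
pose L := \matrix_(i, j) U (s i) (s j).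
have ss i : s (s i) = i by rewrite !permE rev_ordK.
have -> : U = perm_mx s *m (L *m perm_mx s).
  apply/matrixP => i j; rewrite -row_permE mxE.
  rewrite [L *m _](_ : _ = col_perm (s^-1)%g L); last by rewrite col_permE invgK.
  by rewrite !mxE ss permKV.
have hs := scales_perm s.
have hL : scal d (fun x => L *m x) `|\prod_i L i i|^-1.
  apply: scales_lower_lin => [i j ij|i]; rewrite mxE ?Ud//.
  by rewrite Ut// !permE /=; have := ltn_ord i; have := ltn_ord j; lia.
have prodE : \prod_i (perm_mx s *m (L *m perm_mx s)) i i = \prod_i L i i.
  rewrite [RHS](reindex_inj (@perm_inj _ s)); apply: eq_bigr => i _.
  rewrite -row_permE mxE [L *m _](_ : _ = col_perm (s^-1)%g L); last by rewrite col_permE invgK.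
  by rewrite !mxE permKV ss.
rewrite prodE; have := scales_comp_lin (scales_comp_lin hs hL) hs.
by rewrite mul1r mulr1 mulmxA.
Qed.

(** The LUP decomposition leaves only triangular and permutation matrices. *)
Lemma scales_lin d (U : 'M[R]_d) : \det U != 0 ->
  scal d (fun x => U *m x) `|\det U|^-1.
Proof.
case: d U => [|d] U dU.
  have := @scales_lower_lin 0 U; rewrite big_ord0 det_mx00.
  by apply => -[].
have := cormen_lup_correct U; have := cormen_lup_perm U.
have := cormen_lup_detL U; have := @cormen_lup_lower _ _ U; have := @cormen_lup_upper _ _ U.
case: (cormen_lup U) => [[P L] V] /= Vu Ll dL Pp PU.
have [s Ps] := is_perm_mxP _ Pp.
have detPU : \det P * \det U = \det V.
  by rewrite -[LHS]det_mulmx -[P *m U]/(P * U) PU [LHS]det_mulmx dL mul1r.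
have nP : `|\det P| = 1 by rewrite Ps det_perm normrX normrN1 expr1n.
have dV : \det V = \prod_i V i i.
  rewrite -det_tr det_trig; first by apply: eq_bigr => i _; rewrite mxE.
  by apply/is_trig_mxP => i j ij; rewrite mxE Vu.
have Vd : \prod_i V i i != 0.
  rewrite -dV -detPU -normr_eq0 normrM nP mul1r normr_eq0//.
have -> : `|\det U| = `|\prod_i V i i| by rewrite -dV -detPU normrM nP mul1r.
have -> : U = perm_mx (s^-1)%g *m (L *m V).
  have : P *m U = L *m V := PU.
  by move=> <-; rewrite Ps mulmxA -perm_mxM mulVg perm_mx1 mul1mx.
have hV : scal d.+1 (fun x => V *m x) `|\prod_i V i i|^-1.
  apply: scales_upper_lin; first by move=> i j ij; exact: Vu.
  by move=> i; move/prodf_neq0: Vd; apply.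
have hL : scal d.+1 (fun x => L *m x) 1.
  have := @scales_lower_lin _ L; rewrite big1; last by move=> i _; rewrite Ll// eqxx.
  rewrite normr1 invr1; apply=> [i j ij|i]; last by rewrite Ll// eqxx oner_eq0.
  have -> : L i j = (i == j)%:R by apply: Ll; exact: ltnW.
  by rewrite -val_eqE /= (ltn_eqF ij).
have := scales_comp_lin (scales_comp_lin hV hL) (scales_perm (s^-1)%g).
by rewrite !mulr1.
Qed.

End linear_maps.

(** * Complex-valued functions *)

Local Open Scope complex_scope.

Section complex_L2.
Context {R : realType} {d : nat}.
Local Notation mu := (lebesgue_cV R d : {measure set 'cV[R]_d -> \bar R}).
Local Notation Cfun := ('cV[R]_d -> R[i]).
Implicit Types f g h : Cfun.

Definition sqc (z : R[i]) : R := complex.Re z ^+ 2 + complex.Im z ^+ 2.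

Lemma sqc_ge0 z : 0 <= sqc z.
Proof. by rewrite addr_ge0// sqr_ge0. Qed.

Lemma normc_sqr z : Normc.normc z ^+ 2 = sqc z.
Proof. by case: z => a b /=; rewrite sqr_sqrtr// addr_ge0// sqr_ge0. Qed.

Lemma normc_ge0 (z : R[i]) : 0 <= Normc.normc z.
Proof. by case: z => a b /=; rewrite sqrtr_ge0. Qed.

Lemma sqcM z w : sqc (z * w) = sqc z * sqc w.
Proof. by case: z w => a b [c e]; rewrite /sqc /=; ring. Qed.

Lemma L2norm_sqr f : (L2norm f ^+ 2 = \int[mu]_x (sqc (f x))%:E)%E.
Proof.
have -> : (L2norm f ^+ 2 = L2norm f `^ 2)%E.
  rewrite /L2norm; have := Lnorm_ge0 mu 2%:E (fun x => (Normc.normc (f x))%:E).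
  case: (Lnorm _ _ _) => [r|_|//]; last by rewrite poweRyr.
  by rewrite lee_fin => r0; rewrite poweR_EFin powR_mulrn// EFin_expe.
rewrite (@Lnorm2_sqr _ _ _ mu (fun x => Normc.normc (f x))).
by apply: eq_integral => x _; rewrite normc_sqr.
Qed.

(** Real and imaginary parts; the complex structure is the isometry [mul_i]. *)
Definition L2C : hilbert R := hprod (L2_hilbert mu) (L2_hilbert mu).
Local Notation H := L2C.

Definition toC (v : H) : Cfun := fun x => (v.1 : L2R mu) x +i* (v.2 : L2R mu) x.

Definition mul_i (v : H) : H := (- v.2, v.1).
Local Notation J := mul_i.

Lemma mul_i_lin : lin J.
Proof.
have opp a (u w : L2_hilbert mu) : - (a *: u + w) = a *: (- u) + - w.
  by rewrite scalerN opprD.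
by move=> a x y; rewrite /mul_i; congr (_, _); exact: opp.
Qed.

Lemma ip_mul_i2 (v w : H) : ip (J v) (J w) = ip v w.
Proof.
have h (x y : L2_hilbert mu) : ip (- x) (- y) = ip x y.
  by rewrite ipNl ipNr opprK.
by rewrite !hprod_ipE -(h v.2 w.2) addrC.
Qed.

Lemma mul_i2 (v : H) : J (J v) = - v.
Proof. by case: v. Qed.

Lemma ip_mul_i (v w : H) : ip (J v) w = - ip v (J w).
Proof. by rewrite -[w in LHS]opprK -(mul_i2 w) ipNr ip_mul_i2. Qed.

Lemma lin_toC (a : R) (v w : H) x : toC (a *: v + w) x = a%:C * toC v x + toC w x.
Proof. by rewrite /toC /=; apply/eqP; rewrite eq_complex /= !mul0r subr0 addr0 !eqxx. Qed.

Lemma toC_mul_i v x : toC (J v) x = 'i * toC v x.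
Proof.
by rewrite /toC /=; apply/eqP; rewrite eq_complex /= !mul0r !mul1r sub0r add0r !eqxx.
Qed.

Lemma toC_L2norm v : (L2norm (toC v) ^+ 2 = (ip v v)%:E)%E.
Proof.
rewrite L2norm_sqr /= /hprod_ip EFinD !L2ipxx -ge0_integralD//.
- by move=> x _; rewrite lee_fin sqr_ge0.
- by apply/measurable_EFinP/measurable_funX; exact: L2R_measurable.
- by move=> x _; rewrite lee_fin sqr_ge0.
- by apply/measurable_EFinP/measurable_funX; exact: L2R_measurable.
Qed.

Lemma L2norm_lty f : (L2norm f < +oo)%E <-> (\int[mu]_x (sqc (f x))%:E < +oo)%E.
Proof.
rewrite -L2norm_sqr; have : (0 <= L2norm f)%E by exact: Lnorm_ge0.
case: (L2norm f) => [r _|_|//]; first by rewrite -EFin_expe !ltry.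
by rewrite expe2 mulyy !ltxx.
Qed.

Lemma toC_L2 v : L2 (toC v).
Proof.
split; [exact: L2R_measurable|exact: L2R_measurable|].
by apply/L2norm_lty; rewrite -L2norm_sqr toC_L2norm ltry.
Qed.

Lemma L2_re_im f : L2 f -> (fun x => complex.Re (f x)) \in Lfun mu 2%:E /\
  (fun x => complex.Im (f x)) \in Lfun mu 2%:E.
Proof.
move=> [m1 m2 /L2norm_lty fi].
split; apply/Lfun2P; split => //; apply: le_lt_trans fi; apply: ge0_le_integral => //.
- by move=> x _; rewrite lee_fin sqr_ge0.
- by apply/measurable_EFinP/measurable_funX.
- by apply/measurable_EFinP/measurable_funD; exact: measurable_funX.
- by move=> x _; rewrite lee_fin lerDl sqr_ge0.
- by move=> x _; rewrite lee_fin sqr_ge0.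
- by apply/measurable_EFinP/measurable_funX.
- by apply/measurable_EFinP/measurable_funD; exact: measurable_funX.
- by move=> x _; rewrite lee_fin lerDr sqr_ge0.
Qed.

Lemma L2_toC f : L2 f -> exists v, f = toC v.
Proof.
move=> /L2_re_im[f1 f2]; exists (Lfun_Sub (lee1n 2) f1, Lfun_Sub (lee1n 2) f2).
by apply/funext => x; rewrite /toC /=; case: (f x).
Qed.

Lemma inner_toC (v w : H) : inner (toC v) (toC w) = ip v w +i* ip v (J w).
Proof.
rewrite /inner /= /hprod_ip /=; congr (_ +i* _).
  rewrite /L2ip -RintegralD//; [|exact: L2R_mul|exact: L2R_mul].
  by apply: eq_Rintegral => x _ /=; ring.
by rewrite /L2ip -RintegralD//; exact: L2R_mul.
Qed.

(** A squared complex coefficient is the sum of two squared real ones, against w and against i w; in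
    this way complex energies become values of [sqsum]. *)
Lemma inner_sqr_toC v w :
  inner_sqr (toC v) (toC w) = (ip v w ^+ 2 + ip v (J w) ^+ 2)%:E.
Proof. by rewrite /inner_sqr normc_sqr inner_toC. Qed.

Lemma inner_sqr_ge0 f g : (0 <= inner_sqr f g)%E.
Proof. by rewrite lee_fin sqr_ge0. Qed.

Lemma L2_scale (a : R[i]) f : L2 f -> L2 (fun x => a * f x).
Proof.
move=> /L2_toC[v ->].
rewrite (_ : (fun x => _) = toC (complex.Re a *: v + complex.Im a *: J v)); first exact: toC_L2.
apply/funext => x; rewrite lin_toC -[complex.Im a *: _]addr0 lin_toC toC_mul_i.
rewrite (_ : toC 0 x = 0)// addr0 mulrA -mulrDl; congr (_ * _).
by case: a => a b; apply/eqP; rewrite eq_complex /=; apply/andP; split; apply/eqP; ring.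
Qed.

Lemma L2_comp (T : 'cV[R]_d -> 'cV[R]_d) (c : R) f : scales mu mu T c -> L2 f ->
  L2 (f \o T) /\ (L2norm (f \o T) ^+ 2 = c%:E * L2norm f ^+ 2)%E.
Proof.
move=> hT [m1 m2 /L2norm_lty fi].
have [c0 mT _] := hT.
have m1T : measurable_fun setT (fun x => complex.Re ((f \o T) x)) by exact: measurableT_comp m1 mT.
have m2T : measurable_fun setT (fun x => complex.Im ((f \o T) x)) by exact: measurableT_comp m2 mT.
have E : (L2norm (f \o T) ^+ 2 = c%:E * L2norm f ^+ 2)%E.
  rewrite !L2norm_sqr -(integral_scales hT)//.
    by apply/measurable_EFinP/measurable_funD; exact: measurable_funX.
  by move=> y; rewrite lee_fin sqc_ge0.
split => //; split => //; apply/L2norm_lty; rewrite -L2norm_sqr E L2norm_sqr.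
by apply: lte_mul_pinfty => //; exact: fi.
Qed.

Lemma Rintegral_scales (T : 'cV[R]_d -> 'cV[R]_d) (c : R) (k : 'cV[R]_d -> R) :
  scales mu mu T c -> mu.-integrable setT (EFin \o k) ->
  \int[mu]_x k (T x) = c * \int[mu]_x k x.
Proof.
move=> hT ik; have mk := measurable_int _ ik.
rewrite /Rintegral [in LHS]integralE [in RHS]integralE.
have p : (\int[mu]_x ((EFin \o (fun x => k (T x)))^\+ x) = c%:E * \int[mu]_x ((EFin \o k)^\+ x))%E.
  rewrite -(integral_scales hT (measurable_funepos mk)); [by apply: eq_integral => x _; rewrite !funeposE|by move=> y; exact: funepos_ge0].
have n : (\int[mu]_x ((EFin \o (fun x => k (T x)))^\- x) = c%:E * \int[mu]_x ((EFin \o k)^\- x))%E.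
  rewrite -(integral_scales hT (measurable_funeneg mk)); [by apply: eq_integral => x _; rewrite !funenegE|by move=> y; exact: funeneg_ge0].
rewrite [X in (X - _)%E]p [X in (_ - X)%E]n.
have fp : (\int[mu]_x ((EFin \o k)^\+ x))%E \is a fin_num.
  by rewrite ge0_fin_numE ?integral_ge0//; exact: integral_funepos_lt_pinfty.
have fn : (\int[mu]_x ((EFin \o k)^\- x))%E \is a fin_num.
  by rewrite ge0_fin_numE ?integral_ge0//; exact: integral_funeneg_lt_pinfty.
by rewrite -(fineK fp) -(fineK fn) -!EFinM -!EFinB /= mulrBr.
Qed.

Lemma inner_comp (T : 'cV[R]_d -> 'cV[R]_d) (c : R) f g : scales mu mu T c ->
  L2 f -> L2 g -> inner (f \o T) (g \o T) = c%:C * inner f g.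
Proof.
move=> hT /L2_toC[v ->] /L2_toC[w ->].
have int (s t : L2R mu) : mu.-integrable setT (EFin \o (s \* t)) by exact: L2R_mul.
rewrite /inner /=; apply/eqP; rewrite eq_complex /= !mul0r subr0 addr0.
apply/andP; split; apply/eqP.
  rewrite -(@Rintegral_scales T c (fun x => complex.Re (toC v x * (toC w x)^*)))//.
  have := integrableD measurableT (int v.1 w.1) (int v.2 w.2).
  by congr (_.-integrable _ _); apply/funext => x /=; congr (_%:E); ring.
rewrite -(@Rintegral_scales T c (fun x => complex.Im (toC v x * (toC w x)^*)))//.
have := integrableB measurableT (int v.2 w.1) (int v.1 w.2).
by congr (_.-integrable _ _); apply/funext => x /=; congr (_%:E); ring.
Qed.

Lemma inner_sqr_comp (T : 'cV[R]_d -> 'cV[R]_d) (c : R) f g : scales mu mu T c ->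
  L2 f -> L2 g -> inner_sqr (f \o T) (g \o T) = ((c ^+ 2)%:E * inner_sqr f g)%E.
Proof.
move=> hT hf hg; rewrite /inner_sqr !normc_sqr (inner_comp hT hf hg) sqcM EFinM.
by rewrite /sqc /= expr0n addr0.
Qed.

Lemma inner_sqr_scaler (a : R) f g : L2 f -> L2 g ->
  inner_sqr f (fun x => a%:C * g x) = ((a ^+ 2)%:E * inner_sqr f g)%E.
Proof.
move=> /L2_toC[v ->] /L2_toC[w ->].
rewrite (_ : (fun x => _) = toC (a *: w)); last first.
  by apply/funext => x; rewrite -[a *: w]addr0 lin_toC addr0.
rewrite !inner_sqr_toC (linZ mul_i_lin) !ipZr -EFinM; congr (_%:E); ring.
Qed.

Lemma inner_sqr_scalel (a : R) f g : L2 f -> L2 g ->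
  inner_sqr (fun x => a%:C * f x) g = ((a ^+ 2)%:E * inner_sqr f g)%E.
Proof.
move=> /L2_toC[v ->] /L2_toC[w ->].
rewrite (_ : (fun x => _) = toC (a *: v)); last first.
  by apply/funext => x; rewrite -[a *: v]addr0 lin_toC addr0.
rewrite !inner_sqr_toC !ipZl -EFinM; congr (_%:E); ring.
Qed.

Lemma L2_sub f g : L2 f -> L2 g -> L2 (fun x => f x - g x).
Proof.
move=> /L2_toC[v ->] /L2_toC[w ->].
rewrite (_ : (fun x => _) = toC ((-1) *: w + v)); first exact: toC_L2.
by apply/funext => x; rewrite lin_toC addrC; congr (_ + _); rewrite rmorphN rmorph1 mulN1r.
Qed.

Lemma toC_sub (v w : H) : (fun x => toC v x - toC w x) = toC (v - w).
Proof.
rewrite addrC -scaleN1r; apply/funext => x; rewrite lin_toC addrC; congr (_ + _).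
by rewrite rmorphN rmorph1 mulN1r.
Qed.

(** The gap is a sum of squares divided by t. This replaces the triangle inequality for square roots
    of energies and involves no subtraction of infinite values. *)
Lemma inner_sqr_perturb (t : R) f g h : 0 < t -> L2 f -> L2 g -> L2 h ->
  (inner_sqr f h <= (1 + t)%:E * inner_sqr g h +
     (1 + t^-1)%:E * inner_sqr (fun x => (f x - g x)%R) h)%E.
Proof.
move=> t0 /L2_toC[v ->] /L2_toC[w ->] /L2_toC[u ->].
rewrite toC_sub !inner_sqr_toC -!EFinM -EFinD lee_fin !ipDl !ipNl.
have key (a b : R) : a ^+ 2 <= (1 + t) * b ^+ 2 + (1 + t^-1) * (a - b) ^+ 2.
  rewrite -subr_ge0 (_ : _ - _ = (t * b - (a - b)) ^+ 2 / t); last first.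
    by field; rewrite gt_eqF.
  by rewrite divr_ge0 ?sqr_ge0// ltW.
have := key (ip v u) (ip w u); have := key (ip v (J u)) (ip w (J u)); lra.
Qed.

Lemma L2norm_sqr_perturb (t : R) f g : 0 < t -> L2 f -> L2 g ->
  (L2norm f ^+ 2 <= (1 + t)%:E * L2norm g ^+ 2 +
     (1 + t^-1)%:E * L2norm (fun x => (f x - g x)%R) ^+ 2)%E.
Proof.
move=> t0 /L2_toC[v ->] /L2_toC[w ->].
rewrite toC_sub !toC_L2norm -!EFinM -EFinD lee_fin.
rewrite -subr_ge0 (_ : _ - _ = ip (t *: w - (v - w)) (t *: w - (v - w)) / t).
  by rewrite divr_ge0 ?ip_ge0// ltW.
rewrite !ipE (ipC w v).
by field; rewrite gt_eqF.
Qed.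

Lemma L2norm_sqr_ge0 f : (0 <= L2norm f ^+ 2)%E.
Proof. by rewrite L2norm_sqr integral_ge0// => x _; rewrite lee_fin sqc_ge0. Qed.

(** The factor 2 adds up two real Cauchy-Schwarz inequalities; it is not sharp, but constants do not
    matter in the tail estimates. *)
Lemma complex_cauchy_schwarz f g : L2 f -> L2 g ->
  (inner_sqr f g <= 2%:E * (L2norm f ^+ 2 * L2norm g ^+ 2))%E.
Proof.
move=> /L2_toC[v ->] /L2_toC[w ->].
rewrite inner_sqr_toC !toC_L2norm -!EFinM lee_fin.
have := cauchy_schwarz v w; have := cauchy_schwarz v (J w).
rewrite ip_mul_i2; lra.
Qed.

Lemma sqc_indic (A : set 'cV[R]_d) f x : sqc ((\1_A x)%:C * f x) = \1_A x * sqc (f x).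
Proof.
rewrite sqcM; congr (_ * _); rewrite /sqc /= expr0n addr0 indicE.
by case: (x \in A); rewrite ?expr1n ?expr0n.
Qed.

Lemma L2_indic (A : set 'cV[R]_d) f : measurable A -> L2 f ->
  L2 (fun x => (\1_A x)%:C * f x).
Proof.
move=> mA [m1 m2 /L2norm_lty gi].
have mi : measurable_fun setT (\1_A : 'cV[R]_d -> R) by exact: measurable_indic.
split.
- rewrite (_ : (fun x => _) = fun x => \1_A x * complex.Re (f x)).
    exact: measurable_funM.
  by apply/funext => x; case: (f x) => a b /=; rewrite mul0r subr0.
- rewrite (_ : (fun x => _) = fun x => \1_A x * complex.Im (f x)).
    exact: measurable_funM.
  by apply/funext => x; case: (f x) => a b /=; rewrite mul0r addr0.
apply/L2norm_lty; apply: le_lt_trans gi; apply: ge0_le_integral => //.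
- by move=> x _; rewrite lee_fin sqc_ge0.
- under eq_fun do rewrite sqc_indic; apply/measurable_EFinP/measurable_funM => //.
  by apply/measurable_funD; exact: measurable_funX.
- by apply/measurable_EFinP/measurable_funD; exact: measurable_funX.
- move=> x _; rewrite lee_fin sqc_indic; apply: ler_piMl; first exact: sqc_ge0.
  by rewrite indicE; case: (x \in A).
Qed.

(** All tail estimates rest on this localized inequality: integrals over A are what bounded overlap
    can sum. *)
Lemma inner_sqr_supp (A : set 'cV[R]_d) f g : measurable A ->
  (forall x, ~ A x -> f x = 0) -> L2 f -> L2 g ->
  (inner_sqr f g <= 2%:E * (L2norm f ^+ 2 *
     \int[mu]_x ((\1_A x)%:E * (sqc (g x))%:E)))%E.
Proof.
move=> mA fA hf hg; pose g' : Cfun := fun x => (\1_A x)%:C * g x.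
have hg' : L2 g' by exact: L2_indic.
rewrite (_ : inner_sqr f g = inner_sqr f g'); last first.
  rewrite /inner_sqr /inner; congr ((Normc.normc (_ +i* _) ^+ 2)%:E);
    apply: eq_Rintegral => x _; rewrite /g' indicE;
    have [/mem_set ->|nA] := pselect (A x); rewrite ?mul1r// fA//;
    by rewrite !mul0r.
apply: le_trans (complex_cauchy_schwarz hf hg') _.
by rewrite (L2norm_sqr g'); under eq_integral do rewrite sqc_indic EFinM.
Qed.

End complex_L2.

(** * Expansive matrices *)

Section powers.
Context {R : realType} {n : nat}.
Implicit Types (X A : 'M[R[i]]_n.+1).
Local Notation normc := (@Normc.normc R).

(** The gap [s' - s] absorbs the forcing term: K dominates the initial value and satisfies
    [c <= K * (s' - s)], and [r < s] closes the induction. *)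
Lemma geometric_recurrence (a b : nat -> R) (r s c : R) :
  0 <= r -> r < s -> 0 <= c -> (forall k, a k.+1 <= r * a k + c * s ^+ k) -> 
  forall k s', s < s' -> a k <= Num.max (a 0%N) (c / (s' - s)) * s' ^+ k.
Proof.
move=> r0 rs c0 ha k s' ss'; set K := Num.max _ _.
have s'0 : 0 < s' by lra.
have K1 : a 0%N <= K by rewrite le_max lexx.
have K2 : c <= K * (s' - s) by rewrite -ler_pdivrMr ?subr_gt0// le_max lexx orbT.
elim: k => [|k IH]; first by rewrite expr0 mulr1.
apply: le_trans (ha k) _.
have K0 : 0 <= K by rewrite le_max; apply/orP; right; apply: divr_ge0; lra.
have sk : s ^+ k <= s' ^+ k by apply: lerXn2r; rewrite ?nnegrE; lra.
have sk0 : 0 <= s' ^+ k by apply: exprn_ge0; lra.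
have : r * a k <= r * (K * s' ^+ k) by exact: ler_wpM2l.
have : c * s ^+ k <= (K * (s' - s)) * s' ^+ k.
  by apply: ler_pM => //; apply: exprn_ge0; lra.
have : 0 <= (s - r) * (K * s' ^+ k) by apply: mulr_ge0; [lra|exact: mulr_ge0].
by rewrite exprS; move: (s' ^+ k) => w; nra.
Qed.

(** Induction on the linear factors, in place of a Jordan form: X A^(k+1) = z X A^k + X (A - z) A^k,
    where the last term decays by the induction hypothesis with X (A - z) for X. *)
Lemma power_decay (zs : seq R[i]) X A : all (fun z => normc z < 1) zs ->
  X * \prod_(z <- zs) (A - z%:M) = 0 ->
  exists C s : R, [/\ 0 <= C, 0 < s, s < 1 &
    forall k i j, normc ((X * A ^+ k) i j) <= C * s ^+ k].
Proof.
elim: zs X => [|z zs IH] X /=.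
  move=> _; rewrite big_nil mulr1 => ->; exists 0, (2^-1); split; try lra.
  by move=> k i j; rewrite mul0r mxE Normc.normc0 mul0r.
case/andP=> z1 zs1; rewrite big_cons mulrA => /(IH _ zs1)[C [s [C0 s0 s1 hs]]].
pose r := normc z.
have r0 : 0 <= r by exact: normc_ge0.
(* The recurrence asks for a rate above |z| and returns a larger one; [t1] and [t2] leave room for
   both below 1. *)
pose t : R := Num.max r s; pose t1 := (t + 1) / 2; pose t2 := (t1 + 1) / 2.
have tr : r <= t by rewrite le_max lexx.
have ts : s <= t by rewrite le_max lexx orbT.
have t_1 : t < 1 by rewrite gt_max z1 s1.
have t10 : 0 < t1 by rewrite /t1; lra.
have t12 : t1 < t2 by rewrite /t2 /t1; lra.
pose a i j k := normc ((X * A ^+ k) i j).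
pose K i j := Num.max (a i j 0%N) (C / (t2 - t1)).
have aK i j k : a i j k <= K i j * t2 ^+ k.
  apply: (@geometric_recurrence (a i j) (fun=> 0) r t1 C) => //.
    by rewrite /t1; lra.
  move=> l; rewrite /a; have -> : X * A ^+ l.+1 = z *: (X * A ^+ l) + X * (A - z%:M) * A ^+ l.
    have -> : z *: (X * A ^+ l) = X * z%:M * A ^+ l.
      by rewrite -[X * z%:M]/(X *m z%:M) mul_mx_scalar scalerAl.
    by rewrite exprS mulrA mulrBr mulrBl addrC subrK.
  rewrite mxE [X in X + _]mxE; apply: le_trans (le_normcD (_ : Rcomplex R) (_ : Rcomplex R)) _.
  rewrite Normc.normcM lerD2l; apply: le_trans (hs l i j) _.
  by rewrite ler_wpM2l// lerXn2r// ?nnegrE; rewrite /t1; lra.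
have K0 i j : 0 <= K i j.
  by rewrite le_max; apply/orP; left; exact: normc_ge0.
exists (\sum_i \sum_j K i j), t2; split; rewrite /t2.
- by apply: sumr_ge0 => i _; apply: sumr_ge0.
- by lra.
- by rewrite /t1; lra.
move=> k i j; apply: le_trans (aK i j k) _; rewrite ler_wpM2r//.
  by apply: exprn_ge0; rewrite /t2; lra.
rewrite (bigD1 i)//= (bigD1 j)//= -addrA lerDl addr_ge0// ?sumr_ge0// => i' _.
exact: sumr_ge0.
Qed.

End powers.
Section expansive.
Context {R : realType} {n : nat}.
Variable M : 'M[R]_n.+1.
Hypothesis hM : expansive M.
Local Notation normc := (@Normc.normc R).
Local Notation rc := (real_complex R).

Lemma expansive_normc z : eigenvalue (map_mx rc M) z -> 1 < normc z.
Proof. by move=> /hM; rewrite -ltcR /Num.norm /=; case: z. Qed.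

Lemma expansive_unit : M \in unitmx.
Proof.
rewrite unitmxE unitfE; apply/negP => /eqP d0.
have /det0P[v v0 vM] : \det (map_mx rc M) == 0 by rewrite det_map_mx d0 rmorph0.
have /expansive_normc : eigenvalue (map_mx rc M) 0.
  by apply/eigenvalueP; exists v => //; rewrite scale0r.
by rewrite Normc.normc0 ltr10.
Qed.

Local Notation Bc := (map_mx rc (invmx M)).

Lemma inverse_char_poly : exists zs : seq R[i],
  [/\ all (fun z => normc z < 1) zs, size zs = n.+1 &
      char_poly Bc = \prod_(z <- zs) ('X - z%:P)].
Proof.
have [zs] := closed_field_poly_normal (char_poly Bc).
rewrite (monicP (char_poly_monic _)) scale1r => E; exists zs; split => //; last first.
  by have := size_char_poly Bc; rewrite E size_prod_XsubC => -[].
apply/allP => z zzs; have : root (char_poly Bc) z by rewrite E root_prod_XsubC.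
rewrite -eigenvalue_root_char => /eigenvalueP[v vB v0].
have vM : v = z *: (v *m map_mx rc M).
  rewrite scalemxAl -vB -mulmxA -map_mxM mulVmx ?expansive_unit//.
  by rewrite map_mx1 mulmx1.
have z0 : z != 0 by apply/eqP => z0; move: v0; rewrite vM z0 scale0r eqxx.
have /expansive_normc : eigenvalue (map_mx rc M) z^-1.
  by apply/eigenvalueP; exists v => //; rewrite [in RHS]vM scalerA mulVf// scale1r.
rewrite Normc.normcV invf_gt1//.
by rewrite lt_neqAle normc_ge0 andbT eq_sym; apply: contra z0 => /eqP/Normc.eq0_normc ->.
Qed.

Lemma inverse_decay : exists C s : R, [/\ 0 <= C, 0 < s, s < 1 &
  forall k i j, `|(invmx M ^+ k : 'M[R]_n.+1) i j| <= C * s ^+ k].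
Proof.
have [zs [zs1 _ E]] := inverse_char_poly.
(* Cayley-Hamilton, with X = 1. *)
have /(power_decay zs1) : (1 : 'M[R[i]]_n.+1) * \prod_(z <- zs) (Bc - z%:M) = 0.
  rewrite mul1r; have := Cayley_Hamilton Bc; rewrite E rmorph_prod /= => <-.
  by apply: eq_bigr => z _; rewrite rmorphB /= horner_mx_X horner_mx_C.
move=> [C [s [C0 s0 s1 h]]]; exists C, s; split => // k i j.
have := h k i j; rewrite mul1r -rmorphXn mxE /=.
by rewrite expr0n addr0 sqrtr_sqr.
Qed.

(** Up to sign, the determinant of M^-1 is the product of its eigenvalues; the inequality is strict
    since there is at least one of them. *)
Lemma expansive_det : 1 < `|\det M|.
Proof.
have [zs [zs1 sz E]] := inverse_char_poly.
have := char_poly_det Bc; rewrite E -horner_coef0 horner_prod.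
have -> : \prod_(z <- zs) ('X - z%:P).[0] = \prod_(z <- zs) (- z).
  by apply: eq_bigr => z _; rewrite hornerXsubC sub0r.
rewrite det_map_mx det_inv => /(congr1 normc); rewrite Normc.normcM.
have n1 (k : nat) : normc ((-1) ^+ k) = 1.
  elim: k => [|k IH]; first exact: Normc.normc1.
  by rewrite exprS Normc.normcM IH mulr1 (normcN (1 : Rcomplex R)) Normc.normc1.
rewrite n1 mul1r => D.
have : normc (\prod_(z <- zs) (- z)) < 1.
  case: zs zs1 sz {E D} => //= z zs /andP[z1 zs1] _; rewrite big_cons Normc.normcM.
  rewrite (normcN (z : Rcomplex R)); apply: le_lt_trans z1.
  rewrite ler_piMr ?normc_ge0//.
  elim: zs zs1 => [|y zs IH] /=; first by rewrite big_nil Normc.normc1.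
  move=> /andP[y1 /IH h]; rewrite big_cons Normc.normcM (normcN (y : Rcomplex R)).
  exact: le_trans (ler_piMr (normc_ge0 y) h) (ltW y1).
rewrite D /= expr0n addr0 sqrtr_sqr normfV invf_lt1// normr_gt0 -unitfE -unitmxE.
exact: expansive_unit.
Qed.

End expansive.

(** * Lattice residues *)

Lemma esum_pickle {R : realType} (T : countType) (a : T -> \bar R) (b : nat -> \bar R) :
  (forall k, b (choice.pickle k) = a k) -> (forall n, @choice.pickle_inv T n = None -> b n = 0%E) ->
  (\esum_(n in setT) b n = \esum_(k in setT) a k)%E.
Proof.
move=> ba b0; transitivity (\esum_(n in range (@choice.pickle T)) b n)%E.
  rewrite [RHS]esum_mkcond; apply: eq_esum => n _; case: ifPn => // /negP nr.
  case E : (@choice.pickle_inv T n) => [k|]; last exact: b0.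
  exfalso; apply: nr; apply: mem_set; exists k => //.
  by have := @choice.pickle_invK T n; rewrite E.
rewrite (reindex_esum setT _ (@choice.pickle T)); first exact: eq_esum.
split=> [k _|k l _ _ /(pcan_inj (@choice.pickleK_inv T))//|n [k _ <-]]; exists k => //.
Qed.

Lemma measure_fibers (disp : measure_display) (X : measurableType disp)
    {R : realType} (mu : {measure set X -> \bar R}) (T : countType) (g : X -> T) A :
  measurable A -> (forall k, measurable (g @^-1` [set k])) ->
  (mu A = \esum_(k in setT) mu (A `&` g @^-1` [set k]))%E.
Proof.
move=> mA mg.
pose F n := if @choice.pickle_inv T n is Some k then A `&` g @^-1` [set k] else set0.
have mF n : measurable (F n) by rewrite /F; case: choice.pickle_inv => // k; exact: measurableI.
rewrite {1}(_ : A = \bigcup_n F n); last first.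
  apply/seteqP; split=> [x Ax|x [n _]]; last by rewrite /F; case: choice.pickle_inv => // k [].
  by exists (choice.pickle (g x)) => //; rewrite /F choice.pickleK_inv.
rewrite measure_bigcup//; last first.
  apply/trivIsetP => i j _ _ ij; rewrite -subset0 => x []; rewrite /F.
  case Ei : (@choice.pickle_inv T i) => [k|//] [_ gk]; case Ej : (@choice.pickle_inv T j) => [l|//] [_ gl].
  have := @choice.pickle_invK T i; have := @choice.pickle_invK T j; rewrite Ei Ej /= -gk -gl => Ejx Eix.
  by rewrite -Ejx -Eix eqxx in ij.
rewrite nneseries_esum// (_ : [set x | _] = [set: nat]); last first.
  by apply/seteqP; split=> // x _ /=; rewrite in_setT.
apply: esum_pickle => [k|n]; last by rewrite /F => ->; exact: measure0.
by rewrite /F choice.pickleK_inv.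
Qed.

(** Bounded overlap: when no point lies in more than C of the sets, the integrals over them add up
    to at most C times the whole. Finite subfamilies suffice, so no infinite sum is exchanged with
    the integral. *)
Lemma esum_integral_le (disp : measure_display) (X : measurableType disp)
    {R : realType} (mu : {measure set X -> \bar R}) (T : choiceType) (I : set T)
    (B : T -> set X) (h : X -> R) (C : R) :
  (forall i, measurable (B i)) -> 0 <= C -> measurable_fun setT h -> (forall x, 0 <= h x) ->
  (forall x, \esum_(i in I) (\1_(B i) x : R)%:E <= C%:E)%E ->
  (\esum_(i in I) \int[mu]_x ((\1_(B i) x : R)%:E * (h x)%:E) <=
    C%:E * \int[mu]_x (h x)%:E)%E.
Proof.
move=> mB C0 mh h0 hC; apply: esum_le => F FI.
have m i : measurable_fun setT (fun x => (\1_(B i) x : R)%:E * (h x)%:E)%E.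
  apply: emeasurable_funM; apply/measurable_EFinP => //.
rewrite -ge0_integral_sum//; last by move=> i x _; rewrite mule_ge0 ?lee_fin.
rewrite -ge0_integralZl//; last 2 first.
- exact/measurable_EFinP.
- by move=> x _; rewrite lee_fin.
apply: ge0_le_integral => //.
- by move=> x _; apply: sume_ge0 => i _; rewrite mule_ge0 ?lee_fin.
- exact: emeasurable_sum.
- by apply: emeasurable_funM; apply/measurable_EFinP.
move=> x _; rewrite -ge0_sume_distrl; last by move=> i _; rewrite lee_fin.
apply: lee_wpmul2r; first by rewrite lee_fin.
by apply: le_trans (hC x); exact: sum_le_esum.
Qed.

Section lattice.
Context {R : realType} {d : nat}.
Local Notation mu := (lebesgue_cV R d : {measure set 'cV[R]_d -> \bar R}).
Implicit Types (x y : 'cV[R]_d) (k v : 'cV[int]_d).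
Local Notation iv := (@intvec R d).

Definition vfloor x : 'cV[int]_d := \col_i Num.floor (x i 0).

Lemma vfloorP x v :
  vfloor x = v <-> forall i, (v i 0)%:~R <= x i 0 < (v i 0 + 1)%:~R.
Proof.
split=> [<- i|h]; first by rewrite mxE; exact: floor_itv.
by apply/colP => i; rewrite mxE; exact: floor_def.
Qed.

Lemma intvecD k v : iv (k + v) = iv k + iv v.
Proof. exact: map_mxD. Qed.

Lemma intvecN k : iv (- k) = - iv k.
Proof. exact: map_mxN. Qed.

Lemma intvec0 : iv 0 = 0.
Proof. exact: map_mx0. Qed.

Lemma intvecM (Nz : 'M[int]_d) k : iv (Nz *m k) = map_mx intr Nz *m iv k.
Proof. exact: map_mxM. Qed.

Lemma vfloorD x k : vfloor (x + iv k) = vfloor x + k.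
Proof.
apply/vfloorP => i; have /vfloorP/(_ i) := erefl (vfloor x).
rewrite !mxE -addrA [k i 0 + 1]addrC addrA !(intrD _ _ (k i 0)) lerD2r.
by rewrite ltrD2r.
Qed.

Lemma measurable_vfloor v : measurable (vfloor @^-1` [set v]).
Proof.
rewrite (_ : _ @^-1` _ = \bigcap_(i in [set: 'I_d])
  (@coord R d i @^-1` `[(v i 0)%:~R, (v i 0 + 1)%:~R[%classic)).
  apply: fin_bigcap_measurable => // i _; rewrite -[X in measurable X]setTI.
  by apply: measurable_coord => //; exact: measurable_itv.
apply/seteqP; split=> x /=.
  by move=> /vfloorP h i _ /=; rewrite in_itv /=; exact: h.
by move=> h; apply/vfloorP => i; have := h i I; rewrite /= in_itv.
Qed.

Lemma measure_vfloor v : mu (vfloor @^-1` [set v]) = 1%E.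
Proof.
pose A (i : 'I_d) : set (measurableTypeR R) := `[(v i 0)%:~R, (v i 0 + 1)%:~R[%classic.
have -> : vfloor @^-1` [set v] = [set x : 'cV[R]_d | forall i, A i (x i 0)].
  apply/seteqP; split=> x /=.
    by move=> /vfloorP h i; rewrite /A /= in_itv /=; exact: h.
  by move=> h; apply/vfloorP => i; have := h i; rewrite /A /= in_itv.
rewrite measure_box; last by move=> i; exact: measurable_itv.
rewrite big1// => i _; rewrite lebesgue_measure_itv /= lte_fin ltr_int ltzD1 lexx.
by rewrite -EFinB intrD addrC addKr.
Qed.

Section residues.
Variable Nz : 'M[int]_d.
Let N : 'M[R]_d := map_mx intr Nz.
Hypothesis uN : N \in unitmx.

(** The lattice points of the parallelepiped N (v + [0, 1[^d), a complete system of representatives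
    modulo N Z^d for each v. The choice of v is used to keep the residues away from 0. *)
Definition residues v : set 'cV[int]_d := [set e | vfloor (invmx N *m iv e) = v].

Lemma residuesP v m : exists e k, residues v e /\ m = e + Nz *m k.
Proof.
pose k := vfloor (invmx N *m iv m) - v; exists (m - Nz *m k), k; split; last first.
  by rewrite subrK.
rewrite /residues /= intvecD intvecN intvecM mulmxDr mulmxN mulmxA mulVmx// mul1mx.
by rewrite -intvecN vfloorD /k opprB addrC subrK.
Qed.

Lemma residues_inj v e e' k k' : residues v e -> residues v e' ->
  e + Nz *m k = e' + Nz *m k' -> e = e' /\ k = k'.
Proof.
move=> he he' E.
have F a b : vfloor (invmx N *m iv (a + Nz *m b)) = vfloor (invmx N *m iv a) + b.
  by rewrite intvecD intvecM mulmxDr mulmxA mulVmx// mul1mx vfloorD.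
have := F e k; rewrite E F he he' => /addrI kk.
by split=> //; move: E; rewrite kk => /addIr.
Qed.

Lemma esum_residues v (F : 'cV[int]_d -> \bar R) : (forall m, 0 <= F m)%E ->
  (\esum_(m in setT) F m =
   \esum_(e in residues v) \esum_(k in setT) F (e + Nz *m k)%R)%E.
Proof.
move=> F0; rewrite esum_esum//.
rewrite (reindex_esum (residues v `*`` fun=> setT) setT (fun p => p.1 + Nz *m p.2))//.
split => //.
- move=> [e k] [e' k'] /set_mem[/= he _] /set_mem[/= he' _] E.
  by have [-> ->] := residues_inj he he' E.
- by move=> m _; have [e [k [he ->]]] := residuesP v m; exists (e, k).
Qed.

(** The parallelepiped has volume |det N|. Cut it along the unit cells and move the pieces into the
    cell at 0: for each residue e, the pieces coming from e + N k partition this cell, so e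
    contributes volume 1. *)
Lemma card_residues v : (\esum_(e in residues v) 1 = `|\det N|%:E :> \bar R)%E.
Proof.
have dN : \det N != 0 by rewrite -unitfE -unitmxE.
pose B := [set x : 'cV[R]_d | vfloor (invmx N *m x) = v].
have mB : measurable (vfloor @^-1` [set v] : set 'cV[R]_d) by exact: measurable_vfloor.
have [_ mT sT] : scales mu mu (fun x => invmx N *m x) `|\det (invmx N)|^-1.
  by apply: scales_lin; rewrite det_inv invr_eq0.
have mf w : measurable (vfloor @^-1` [set w]) by exact: measurable_vfloor.
have mF (e w : 'cV[int]_d) : measurable [set x | vfloor (invmx N *m (x + iv e)) = w].
  have [_ m1 _] := scales_shift (iv e).
  have := measurableT_comp mT m1; move=> /(_ measurableT _ (mf w)).
  by rewrite setTI.
have : mu B = `|\det N|%:E.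
  have := sT _ mB; rewrite measure_vfloor mule1 det_inv normfV invrK => <-.
  by [].
move=> <-.
have mBB : measurable B.
  by have := mT measurableT _ (mf v); rewrite setTI.
rewrite (measure_fibers _ mBB mf).
transitivity (\esum_(k in [set: 'cV[int]_d])
    mu ([set x | vfloor (invmx N *m (x + iv k)%R) = v] `&` vfloor @^-1` [set 0%R]))%E; last first.
  apply: eq_esum => k _; have [_ m1 s1] := scales_shift (iv k).
  have := s1 _ (measurableI _ _ mBB (mf k)); rewrite mul1e => <-.
  congr (mu _); apply/seteqP; split=> x [] /=; rewrite /B /= vfloorD => h1 h2; split=> //.
    by rewrite h2 add0r.
  by apply: (addIr k); rewrite add0r.
rewrite (esum_residues v); last by move=> m; exact: measure_ge0.
apply: eq_esum => e he.
rewrite -(measure_vfloor 0).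
pose g x := v - vfloor (invmx N *m (x + iv e)).
have mg w : measurable (g @^-1` [set w]).
  rewrite (_ : _ @^-1` _ = [set x | vfloor (invmx N *m (x + iv e)) = v - w])//.
  by apply/seteqP; split=> x /= E; [rewrite -E /g|rewrite /g E]; rewrite subKr.
rewrite (measure_fibers _ (mf 0) mg); apply: eq_esum => k _.
congr (mu _); rewrite setIC; congr (_ `&` _).
have E x : invmx N *m (x + iv (e + Nz *m k)) = invmx N *m (x + iv e) + iv k.
  by rewrite intvecD intvecM addrA mulmxDr mulmxA mulVmx// mul1mx.
apply/seteqP; split=> x /=; rewrite E vfloorD /g.
  by move=> <-; rewrite addrC subrK.
by move=> <-; rewrite [X in X - _]addrC addrK.
Qed.

End residues.
End lattice.

(** * Counting lattice points in boxes and along orbits of an expansive matrix *)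

Section counting.
Context {R : realType}.

Lemma esum_le_size (T : choiceType) (F : T -> \bar R) (l : seq T) :
  (forall x, F x <= (x \in l)%:R%:E)%E -> (\esum_(x in setT) F x <= (size l)%:R%:E)%E.
Proof.
move=> h; apply: esum_le => X _.
apply: (@le_trans _ _ (\sum_(x <- X) (x \in l)%:R%:E)%E); first exact: lee_sum.
rewrite sumEFin lee_fin -natr_sum ler_nat.
have -> : (\sum_(x <- X) (x \in l) = size [seq x <- X | x \in l])%N.
  by rewrite size_filter -sum1_count [RHS]big_mkcond; apply: eq_bigr => x _; case: (x \in l).
apply: uniq_leq_size; first by rewrite filter_uniq// fset_uniq.
by move=> x; rewrite mem_filter => /andP[].
Qed.

Definition inbox {d : nat} (c : R) (x : 'cV[R]_d) := forall i, `|x i 0| < c.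

Lemma measurable_inbox {d : nat} c : measurable (@inbox d c : set 'cV[R]_d).
Proof.
rewrite (_ : inbox c = \bigcap_(i in [set: 'I_d]) (@coord R d i @^-1` `]- c, c[%classic)).
  apply: fin_bigcap_measurable => // i _; rewrite -[X in measurable X]setTI.
  by apply: measurable_coord => //; exact: measurable_itv.
apply/seteqP; split=> x /= h i; first by move=> _; rewrite /= in_itv /= -ltr_norml; exact: h.
by have := h i I; rewrite /= in_itv /= -ltr_norml.
Qed.

(** k is determined by the integer part of y + k, whose coordinates lie between -m and m whatever
    y. *)
Lemma count_box {d : nat} (c : R) : exists2 D : R, 0 <= D & forall y : 'cV[R]_d,
  (\esum_(k in setT) (\1_(inbox c) (y + intvec R k))%:E <= D%:E)%E.
Proof.
have [m cm] : exists m : nat, c <= m%:R.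
  by exists (Num.truncn c).+1; apply: ltW; exact: truncnS_gt.
exists (#|{ffun 'I_d -> 'I_(m + m).+1}|)%:R; first by rewrite ler0n.
move=> y.
pose g (f : {ffun 'I_d -> 'I_(m + m).+1}) : 'cV[int]_d :=
  \col_i ((f i : nat)%:Z - m%:Z) - vfloor y.
have := @esum_le_size _ (fun k => (\1_(inbox c) (y + intvec R k))%:E) (map g (enum predT)).
rewrite size_map -cardE; apply => k; rewrite lee_fin indicE.
have [h|h] := pselect (inbox c (y + intvec R k)); last by rewrite memNset// ler0n.
rewrite mem_set//.
rewrite (_ : k \in _ = true)//; apply/mapP.
have hi i : (- m%:Z <= (vfloor y + k) i 0 <= m%:Z)%R.
  rewrite -vfloorD; have := h i; set x := y + _; have := erefl (vfloor x).
  move=> /vfloorP/(_ i); set w := vfloor x i 0; rewrite ltr_norml => /andP[w1 w2] /andP[x1 x2].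
  rewrite intrD in w2; have -> : (w <= m%:Z) = (w%:~R <= m%:R :> R).
    by rewrite -[m%:R]/(m%:Z%:~R) ler_int.
  apply/andP; split; last by lra.
  rewrite -ltzD1 -(ltr_int R) intrD mulrNz -[m%:Z%:~R]/(m%:R); lra.
exists [ffun i => inord `|((vfloor y + k) i 0 + m%:Z)%R|%N]; first by rewrite mem_enum.
apply/colP => i; have /andP[h1 h2] := hi i; rewrite !mxE ffunE inordK.
  move: h1 h2; rewrite !mxE; move: (Num.floor _ : int) (k i 0 : int) => a b h1 h2.
  have abm : 0 <= a + b + m%:Z by lia.
  by rewrite (gez0_abs abm); lia.
move: h1 h2; move: ((vfloor y + k) i 0 : int) => a h1 h2.
by lia.
Qed.

End counting.

Section counting_expansive.
Context {R : realType} {n : nat}.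
Variable M : 'M[R]_n.+1.
Hypothesis hM : expansive M.
Local Notation B := (invmx M).
Local Notation cV := 'cV[R]_n.+1.

Lemma inverse_powers_inbox : exists2 c0 : R, 0 < c0 &
  forall k c (x : cV), 0 < c -> inbox c x -> inbox (c0 * c) (B ^+ k *m x).
Proof.
have [C [s [C0 s0 s1 h]]] := inverse_decay hM.
(* A row has n+1 entries, each at most C for all powers; the extra 1 makes the constant positive and
   the bound strict. *)
exists (n.+1%:R * C + 1) => [|k c x c0 hx i].
  by rewrite ltr_wpDl// mulr_ge0// ler0n.
rewrite mxE; apply: le_lt_trans (ler_norm_sum _ _ _) _.
apply: (@le_lt_trans _ _ (\sum_(j < n.+1) C * c)).
  apply: ler_sum => j _; rewrite normrM ler_pM ?normr_ge0//; last exact: ltW.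
  by apply: le_trans (h k i j) _; rewrite ler_piMr// exprn_ile1// ltW.
by rewrite sumr_const card_ord -[ltLHS]mulr_natl mulrDl mul1r mulrA ltrDl.
Qed.

Lemma inverse_powers_small (a b : R) : 0 < a -> 0 < b -> exists k0 : nat,
  forall k (x : cV), (k0 <= k)%N -> inbox b x -> inbox a (B ^+ k *m x).
Proof.
move=> a0 b0; have [C [s [C0 s0 s1 h]]] := inverse_decay hM.
have [k0 hk0] : exists k0, forall k, (k0 <= k)%N -> (n.+1%:R * C * b + 1) * s ^+ k < a.
  have s1' : `|s| < 1 by rewrite ger0_norm// ltW.
  have K0 : 0 < n.+1%:R * C * b + 1 by rewrite ltr_wpDl// !mulr_ge0 ?ler0n// ltW.
  have := cvg_expr s1'; move=> /cvgr0_norm_lt/(_ (a / (n.+1%:R * C * b + 1))).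
  have aK : 0 < a / (n.+1%:R * C * b + 1) by rewrite divr_gt0.
  move=> /(_ aK)[k0 _ hk]; exists k0 => k kk0; have := hk k kk0.
  by rewrite /= ger0_norm ?exprn_ge0 ?(ltW s0)// ltr_pdivlMr// mulrC.
exists k0 => k x kk0 hx i; apply: le_lt_trans (hk0 k kk0).
rewrite mxE; apply: le_trans (ler_norm_sum _ _ _) _.
apply: (@le_trans _ _ (\sum_(j < n.+1) (C * s ^+ k) * b)).
  apply: ler_sum => j _; rewrite normrM ler_pM ?normr_ge0//; last exact: ltW.
rewrite sumr_const card_ord -[leLHS]mulr_natl.
have sk : 0 <= s ^+ k by rewrite exprn_ge0// ltW.
by rewrite mulrDl mul1r !mulrA [_ * s ^+ k * b]mulrAC lerDl.
Qed.

Definition annulus (a b : R) : set cV := [set x | inbox b x /\ ~ inbox a x].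

Lemma measurable_annulus a b : measurable (annulus a b).
Proof.
have -> : annulus a b = inbox b `&` ~` inbox a by [].
by apply: measurableI; [|apply: measurableC]; exact: measurable_inbox.
Qed.

(** After the first visit of the orbit of z to the annulus, a visit L or more steps later is
    impossible: powers of M^-1 would carry it back into the inner box at the time of the first one.
    So z has at most L visits, and a z with any visit lies in a fixed box, which contains boundedly
    many y + k. *)
Lemma count_annulus (a b : R) : 0 < a -> 0 < b -> exists2 D : R, 0 <= D & forall y : cV,
  (\esum_(m in [set: nat]) \esum_(k in setT)
     (\1_(annulus a b) (M ^+ m *m (y + intvec R k)))%:E <= D%:E)%E.
Proof.
move=> a0 b0; have [c0 c0_gt0 hc] := inverse_powers_inbox.
have [L hL] := inverse_powers_small a0 b0.
have [D D0 hD] := @count_box R n.+1 (c0 * b).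
have uM := expansive_unit hM.
have BM k m (x : cV) : B ^+ k *m (M ^+ (k + m) *m x) = M ^+ m *m x.
  rewrite mulmxA; congr (_ *m _); rewrite exprD mulmxA.
  rewrite -[invmx M ^+ k *m _]/(M^-1 ^+ k * _) exprVn mulVr ?mul1mx//.
  exact: unitrX.
exists (L%:R * D) => [|y]; first by rewrite mulr_ge0// ler0n.
rewrite esum_swap; last by move=> *; rewrite lee_fin.
rewrite EFinM; apply: le_trans (lee_wpmul2l _ (hD y)); last by rewrite lee_fin ler0n.
rewrite -[leRHS]esumZ; [|by rewrite ler0n|by move=> *; rewrite lee_fin].
apply: le_esum => k _; set z := y + _.
have [hz|hz] := pselect (exists m : nat, annulus a b (M ^+ m *m z)); last first.
  rewrite esum1 ?mule_ge0 ?lee_fin ?ler0n// => m _; rewrite indicE memNset//.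
  by move=> h; apply: hz; exists m.
have zb : inbox (c0 * b) z.
  have [m [h _]] := hz; have := hc m b _ b0 h.
  by have := BM m 0%N z; rewrite addn0 expr0 mul1mx => ->.
rewrite [X in (_ * X)%E](_ : _ = 1%:E) ?mule1; last by rewrite indicE mem_set.
have [m0 hm0 min0] : exists2 m0 : nat, annulus a b (M ^+ m0 *m z) &
    forall m, annulus a b (M ^+ m *m z) -> (m0 <= m)%N.
  have ex : exists m, `[< annulus a b (M ^+ m *m z) >] by have [m h] := hz; exists m; exact/asboolP.
  exists (ex_minn ex); first by case: ex_minnP => m /asboolP.
  by case: ex_minnP => m _ h m' /asboolP; exact: h.
rewrite -[L in leRHS](size_iota m0 L); apply: esum_le_size => m.
have [h|h] := pselect (annulus a b (M ^+ m *m z)); last first.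
  by rewrite indicE memNset// lee_fin ler0n.
rewrite indicE mem_set// lee_fin mem_iota min0//=.
case: ltnP => // Lm; exfalso; have [_] := hm0; apply.
have mm0 := min0 _ h; have := BM (m - m0)%N m0 z; rewrite subnK// => <-.
by apply: hL; [lia|case: h].
Qed.

End counting_expansive.

(** * Affine and quasi-affine energies *)

Lemma esum_const {R : realType} (T : choiceType) (I : set T) (r : R) (c : \bar R) :
  0 < r -> (\esum_(i in I) 1 = r%:E)%E -> (0 <= c)%E ->
  (\esum_(i in I) c = r%:E * c)%E.
Proof.
move=> r0 I1; case: c => [c||//] c0.
  rewrite muleC -I1 -esumZ -?lee_fin//.
  by apply: eq_esum => i _; rewrite mule1.
rewrite gt0_muley ?lte_fin//; apply/eqP; rewrite eq_le leey /=.
have [[i Ii]|nI] := pselect (exists i, I i).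
  apply: le_trans (@sum_le_esum _ _ I (fun=> +oo%E) [fset i]%fset _).
    by rewrite big_seq_fset1.
  by move=> x; rewrite inE => /eqP ->.
exfalso; have I0 : I = set0 by apply/seteqP; split=> // i Ii; case: nI; exists i.
by move: I1; rewrite I0 esum_set0 => -[r0']; rewrite -r0' ltxx in r0.
Qed.

Section maps.
Context {R : realType} {d : nat}.
Local Notation mu := (lebesgue_cV R d : {measure set 'cV[R]_d -> \bar R}).
Local Notation Cfun := ('cV[R]_d -> R[i]).
Local Notation iv := (@intvec R d).
Implicit Types (f g : Cfun) (e k : 'cV[int]_d).

Lemma translateD e k f : translate e (translate k f) = translate (e + k) f.
Proof. by apply/funext => x; rewrite /translate intvecD opprD addrA. Qed.

Lemma translate0 f : translate 0 f = f.
Proof. by apply/funext => x; rewrite /translate intvec0 subr0. Qed.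

Lemma L2_translate e f : L2 f -> L2 (translate e f).
Proof. by move=> hf; have [] := L2_comp (scales_shift (- iv e)) hf. Qed.

Lemma L2norm_translate e f : L2 f -> (L2norm (translate e f) ^+ 2 = L2norm f ^+ 2)%E.
Proof.
by move=> hf; have [_] := L2_comp (scales_shift (- iv e)) hf; rewrite mul1e.
Qed.

Lemma inner_sqr_translate e f g : L2 f -> L2 g ->
  inner_sqr (translate e f) (translate e g) = inner_sqr f g.
Proof.
move=> hf hg; have := inner_sqr_comp (scales_shift (- iv e)) hf hg.
by rewrite expr1n mul1e.
Qed.

Lemma inner_sqr_translatel e f g : L2 f -> L2 g ->
  inner_sqr (translate e f) g = inner_sqr f (translate (- e) g).
Proof.
move=> hf hg; rewrite -[LHS](inner_sqr_translate (- e))//; last exact: L2_translate.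
by rewrite translateD addNr translate0.
Qed.

Lemma L2_affine U e f : \det U != 0 -> L2 f -> L2 (affine U e f).
Proof.
move=> dU hf; apply: L2_scale.
by have [] := L2_comp (scales_comp (scales_lin dU) (scales_shift (- iv e))) hf.
Qed.

Lemma L2norm_affine U e f : \det U != 0 -> L2 f ->
  (L2norm (affine U e f) ^+ 2 = L2norm f ^+ 2)%E.
Proof.
move=> dU hf; have [hf' E] := L2_comp (scales_comp (scales_lin dU) (scales_shift (- iv e))) hf.
rewrite mulr1 in E.
transitivity (`|\det U|%:E * L2norm (f \o ((fun x => x - iv e)%R \o (fun x => U *m x))) ^+ 2)%E.
  rewrite !L2norm_sqr -ge0_integralZl//.
  - by apply: eq_integral => x _; rewrite /affine sqcM {1}/sqc /= expr0n addr0 sqr_sqrtr// EFinM.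
  - have [m1 m2 _] := hf'.
    by apply/measurable_EFinP/measurable_funD; exact: measurable_funX.
  - by move=> x _; rewrite lee_fin sqc_ge0.
by rewrite E muleA -EFinM divff ?mul1e// normr_eq0.
Qed.

End maps.

Section dilation.
Context {R : realType} {n : nat}.
Variable Mz : 'M[int]_n.+1.
Local Notation M := (map_mx intr Mz : 'M[R]_n.+1).
Hypothesis hM : expansive M.
Local Notation B := (invmx M).
Local Notation mu := (lebesgue_cV R n.+1 : {measure set 'cV[R]_n.+1 -> \bar R}).
Local Notation Cfun := ('cV[R]_n.+1 -> R[i]).
Local Notation iv := (@intvec R n.+1).
Local Notation q := (`|\det M|).
Implicit Types (f g psi : Cfun) (e k : 'cV[int]_n.+1).

Let uM : M \in unitmx := expansive_unit hM.
Let q1 : 1 < q := expansive_det hM.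
Let q0 : 0 < q := lt_trans ltr01 q1.

Lemma mx_expzE (j : int) : mx_expz M j = M ^ j.
Proof. by case: j => // j; rewrite /= -[invmx M]/(M^-1) exprVn. Qed.

Lemma mx_expzN (i : nat) : mx_expz M (- i%:Z) = B ^+ i.
Proof. by case: i. Qed.

Lemma mx_expzD (i j : int) : mx_expz M (i + j) = mx_expz M i *m mx_expz M j.
Proof. by rewrite !mx_expzE exprzDr. Qed.

Lemma mx_expz_unit j : mx_expz M j \in unitmx.
Proof. by rewrite mx_expzE; exact: unitrXz. Qed.

Lemma det_expz_neq0 j : \det (mx_expz M j) != 0.
Proof. by rewrite -unitfE -unitmxE; exact: mx_expz_unit. Qed.

Lemma det_power (A : 'M[R]_n.+1) i : \det (A ^+ i) = \det A ^+ i.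
Proof.
elim: i => [|i IH]; first by rewrite !expr0 det1.
by rewrite !exprS -[A * _]/(A *m _) det_mulmx IH.
Qed.

Lemma norm_det_power i : `|\det (M ^+ i)| = q ^+ i.
Proof. by rewrite det_power normrX. Qed.

Lemma norm_det_powerN i : `|\det (B ^+ i)| = q ^- i.
Proof. by rewrite det_power det_inv normrX normfV exprVn. Qed.

Lemma map_power i : map_mx intr (Mz ^+ i) = M ^+ i.
Proof. by rewrite rmorphXn. Qed.

Lemma intvec_power i k : iv (Mz ^+ i *m k) = M ^+ i *m iv k.
Proof. by rewrite intvecM map_power. Qed.

Lemma powerNK i (x : 'cV[R]_n.+1) : B ^+ i *m (M ^+ i *m x) = x.
Proof.
by rewrite mulmxA -[B ^+ i *m _]/(M^-1 ^+ i * M ^+ i) exprVn mulVr ?mul1mx// unitrX.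
Qed.

Lemma powerKN i (x : 'cV[R]_n.+1) : M ^+ i *m (B ^+ i *m x) = x.
Proof.
by rewrite mulmxA -[_ *m B ^+ i]/(M ^+ i * M^-1 ^+ i) exprVn mulrV ?mul1mx// unitrX.
Qed.

Lemma coarsenE i f : coarsen M i f = fun x => (q ^- i)%:C * f (B ^+ i *m x).
Proof. by rewrite /coarsen mx_expzN. Qed.

Lemma scales_power i : scales mu mu (fun x => M ^+ i *m x) (q ^- i).
Proof. by rewrite -norm_det_power; apply: scales_lin; exact: (det_expz_neq0 i). Qed.

Lemma scales_powerN i : scales mu mu (fun x => B ^+ i *m x) (q ^+ i).
Proof.
rewrite -[q ^+ i]invrK -norm_det_powerN; apply: scales_lin.
by rewrite -mx_expzN; exact: det_expz_neq0.
Qed.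

Lemma L2_coarsen i f : L2 f -> L2 (coarsen M i f).
Proof.
by move=> hf; rewrite coarsenE; apply: L2_scale; have [] := L2_comp (scales_powerN i) hf.
Qed.

(** M being an integer matrix, integer translations only permute the atoms of a nonnegative
    level. *)
Lemma affine_power i k e f :
  affine (M ^+ i) k f = translate e (affine (M ^+ i) (k - Mz ^+ i *m e) f).
Proof.
apply/funext => x; rewrite /affine /translate; congr (_ * f _).
by rewrite intvecD intvecN intvec_power mulmxBr opprB addrA addrNK.
Qed.

(** At a negative level the affine system keeps only the translates of the coarse atom by M^i Z^d,
    with weight q^(i/2); the quasi-affine system takes all integer translates, with weight 1. *)
Lemma affine_powerN i k f :
  affine (B ^+ i) k f =
  fun x => (Num.sqrt (q ^+ i))%:C * translate (Mz ^+ i *m k) (coarsen M i f) x.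
Proof.
apply/funext => x; rewrite coarsenE /affine /translate intvec_power mulmxBr powerNK.
rewrite mulrA -rmorphM norm_det_powerN; congr (_%:C * _).
rewrite sqrtrV ?exprn_ge0//; set t := Num.sqrt _.
have t0 : t != 0 by rewrite sqrtr_eq0 -ltNge exprn_gt0.
rewrite -[q ^+ i](@sqr_sqrtr _ (q ^+ i)) ?exprn_ge0// -/t.
by field.
Qed.

Lemma inner_sqr_affine_powerN i k e f psi : L2 f -> L2 psi ->
  inner_sqr (translate e f) (affine (B ^+ i) k psi) =
  ((q ^+ i)%:E * inner_sqr f (translate (Mz ^+ i *m k - e) (coarsen M i psi)))%E.
Proof.
move=> hf hp; have hc := L2_translate (Mz ^+ i *m k) (L2_coarsen i hp).
rewrite affine_powerN (inner_sqr_scaler _ (L2_translate e hf) hc).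
have -> : Num.sqrt (q ^+ i) ^+ 2 = q ^+ i by apply: sqr_sqrtr; exact/exprn_ge0/ltW.
by rewrite (inner_sqr_translatel e hf hc) translateD [- e + _]addrC.
Qed.

Lemma inner_sqr_dilate (N : nat) (j : int) k f psi : L2 f -> L2 psi ->
  inner_sqr (affine (M ^+ N) 0 f) (affine (mx_expz M j) k psi) =
  inner_sqr f (affine (mx_expz M (j - N%:Z)) k psi).
Proof.
move=> hf hp; set A := mx_expz M (j - N%:Z).
have AE : mx_expz M j = A *m M ^+ N.
  by rewrite -[M ^+ N]/(mx_expz M N) -mx_expzD subrK.
have hg : L2 (affine A k psi) by apply: L2_affine => //; exact: det_expz_neq0.
pose T (x : 'cV[R]_n.+1) := M ^+ N *m x.
have -> : affine (mx_expz M j) k psi =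
    fun x => (Num.sqrt (q ^+ N))%:C * (affine A k psi \o T) x.
  apply/funext => x; rewrite /affine /T /= mulrA -rmorphM; congr (_%:C * psi (_ - _)).
    by rewrite AE det_mulmx normrM norm_det_power mulrC sqrtrM ?exprn_ge0.
  by rewrite AE mulmxA.
have -> : affine (M ^+ N) 0 f = fun x => (Num.sqrt (q ^+ N))%:C * (f \o T) x.
  by apply/funext => x; rewrite /affine norm_det_power intvec0 subr0.
have [hfT _] := L2_comp (scales_power N) hf.
have [hgT _] := L2_comp (scales_power N) hg.
rewrite inner_sqr_scaler//; last exact: L2_scale.
rewrite inner_sqr_scalel// (inner_sqr_comp (scales_power N))// !muleA -!EFinM.
rewrite sqr_sqrtr ?exprn_ge0//.
have -> : q ^+ N * q ^+ N * q ^- N ^+ 2 = 1.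
  by field; rewrite expf_eq0 gt_eqF ?andbF.
by rewrite mul1r.
Qed.

End dilation.

Section levels.
Context {R : realType} {n : nat}.
Variable Mz : 'M[int]_n.+1.
Local Notation M := (map_mx intr Mz : 'M[R]_n.+1).
Hypothesis hM : expansive M.
Local Notation B := (invmx M).
Local Notation mu := (lebesgue_cV R n.+1 : {measure set 'cV[R]_n.+1 -> \bar R}).
Local Notation Cfun := ('cV[R]_n.+1 -> R[i]).
Local Notation iv := (@intvec R n.+1).
Local Notation q := (`|\det M|).
Variable Psi : set Cfun.
Hypothesis hPsi : Psi `<=` @L2 R n.+1.
Implicit Types (f g psi : Cfun) (e k : 'cV[int]_n.+1).
Local Notation E_ J v := (@residues R n.+1 (Mz ^+ J) v).

Let uM : M \in unitmx := expansive_unit hM.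
Let q1 : 1 < q := expansive_det hM.
Let q0 : 0 < q := lt_trans ltr01 q1.

Definition level (j : int) f : \bar R := (\esum_(psi in Psi)
  \esum_(k in [set: 'cV[int]_n.+1]) inner_sqr f (affine (mx_expz M j) k psi))%E.

Definition coarse_level (i : nat) f : \bar R := (\esum_(psi in Psi)
  \esum_(k in [set: 'cV[int]_n.+1]) inner_sqr f (translate k (coarsen M i psi)))%E.

Lemma level_ge0 j f : (0 <= level j f)%E.
Proof. by apply: esum_ge0 => psi _; apply: esum_ge0 => k _; exact: inner_sqr_ge0. Qed.

Lemma coarse_level_ge0 j f : (0 <= coarse_level j f)%E.
Proof. by apply: esum_ge0 => psi _; apply: esum_ge0 => k _; exact: inner_sqr_ge0. Qed.

Lemma homogeneous_energyE f : (homogeneous_energy M Psi f =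
  affine_energy M Psi [set j | (0 <= j)%R] f +
  \esum_(i in [set i | (0 < i)%N]) level (- i%:Z) f)%E.
Proof.
rewrite /homogeneous_energy /affine_energy (esumID [set j : int | 0 <= j])//; last first.
  by move=> j _; exact: level_ge0.
rewrite !setTI; congr (_ + _)%E.
rewrite (reindex_esum [set i | (0 < i)%N] _ (fun i : nat => - i%:Z))//; split.
- by move=> i /= i0; lia.
- by move=> i j _ _; lia.
- by move=> j /= j0; exists `|j|%N => /=; lia.
Qed.

Lemma level_translate (j : nat) e f : L2 f -> level j (translate e f) = level j f.
Proof.
move=> hf; apply: eq_esum => psi hp.
rewrite -[RHS](@esum_bij _ _ _ (fun k => k - Mz ^+ j *m e) (fun k => k + Mz ^+ j *m e));
  [|by move=> k; exact: subrK|by move=> k; exact: addrK].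
apply: eq_esum => k _; rewrite -[mx_expz M j]/(M ^+ j) [in LHS](affine_power Mz j k e).
apply: inner_sqr_translate => //; apply: L2_affine; last exact: hPsi.
exact: (det_expz_neq0 hM j).
Qed.

Lemma unit_power J : map_mx intr (Mz ^+ J) \in @unitmx R n.+1.
Proof. by rewrite map_power; exact: unitrX. Qed.

Lemma card_residues_power J v : (\esum_(e in E_ J v) 1 = (q ^+ J)%:E :> \bar R)%E.
Proof. by rewrite card_residues ?unit_power// map_power norm_det_power. Qed.

(* Splitting k = k1 + M^(J - i) k2 over residues k1 modulo M^(J - i), the
   vectors M^J k2 - e run through Z^d exactly once for each k1. *)
Lemma esum_residues_power (i J : nat) v (G : 'cV[int]_n.+1 -> R) : (i <= J)%N ->
  (forall l, 0 <= G l) ->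
  (\esum_(e in E_ J v) \esum_(k in setT) (G (Mz ^+ i *m k - e)%R)%:E =
    (q ^+ (J - i))%:E * \esum_(l in setT) (G l)%:E)%E.
Proof.
move=> iJ G0.
have Gn l : (0 <= (G l)%:E)%E by rewrite lee_fin.
transitivity (\esum_(k1 in E_ (J - i) 0) \esum_(e in E_ J v) \esum_(k2 in setT)
    (G (Mz ^+ i *m k1 - (e + Mz ^+ J *m k2))%R)%:E)%E.
  rewrite [RHS]esum_swap; last by move=> *; apply: esum_ge0.
  apply: eq_esum => e _.
  rewrite (esum_residues (unit_power (J - i)) 0)//; apply: eq_esum => k1 _.
  rewrite -[LHS](@esum_bij _ _ _ -%R -%R); [|exact: opprK|exact: opprK].
  apply: eq_esum => k2 _; congr (G _)%:E.
  rewrite mulmxDr mulmxA -[Mz ^+ i *m Mz ^+ _]/(Mz ^+ i * Mz ^+ _) -exprD subnKC//.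
  by rewrite mulmxN opprD addrAC addrA.
transitivity (\esum_(k1 in E_ (J - i) 0) \esum_(l in setT) (G l)%:E)%E.
  apply: eq_esum => k1 _.
  rewrite -(esum_residues (unit_power J) v (F := fun m => (G (Mz ^+ i *m k1 - m)%R)%:E))//.
  by rewrite -[RHS](@esum_bij _ _ _ (fun m => Mz ^+ i *m k1 - m) (fun m => Mz ^+ i *m k1 - m));
    [|move=> m; exact: subKr|move=> m; exact: subKr].
apply: esum_const; [exact: exprn_gt0|exact: card_residues_power|].
by apply: esum_ge0.
Qed.

(** The factor q^J is q^i, from the normalization of the atoms, times q^(J - i), the number of times
    each integer translate is met. *)
Lemma esum_residues_level (i J : nat) v f : (i <= J)%N -> L2 f ->
  (\esum_(e in E_ J v) level (- i%:Z) (translate e f) = (q ^+ J)%:E * coarse_level i f)%E.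
Proof.
move=> iJ hf; rewrite /level esum_swap; last first.
  by move=> *; apply: esum_ge0 => k _; exact: inner_sqr_ge0.
rewrite /coarse_level -esumZ ?exprn_ge0 ?(ltW q0)//; last first.
  by move=> *; apply: esum_ge0 => k _; exact: inner_sqr_ge0.
apply: eq_esum => psi hp.
have -> : q ^+ J = q ^+ i * q ^+ (J - i) by rewrite -exprD subnKC.
rewrite EFinM -muleA.
have := @esum_residues_power i J v
  (fun l => Normc.normc (inner f (translate l (coarsen M i psi))) ^+ 2) iJ (fun l => sqr_ge0 _).
rewrite -/(inner_sqr _ _) => <-.
rewrite -esumZ ?exprn_ge0 ?(ltW q0)//; last first.
  by move=> *; apply: esum_ge0 => k _; exact: inner_sqr_ge0.
apply: eq_esum => e _; rewrite -esumZ ?exprn_ge0 ?(ltW q0)//; last first.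
  by move=> *; exact: inner_sqr_ge0.
apply: eq_esum => k _; rewrite mx_expzN inner_sqr_affine_powerN//; exact: hPsi.
Qed.

End levels.

Section esum_more.
Local Open Scope ereal_scope.
Context {R : realType}.

Lemma esum_subset (T : choiceType) (I J : set T) (a : T -> \bar R) :
  I `<=` J -> \esum_(i in I) a i <= \esum_(i in J) a i.
Proof. by move=> IJ; apply: esum_le => X XI; apply: sum_le_esum => x /XI/IJ. Qed.

Lemma esum3 (T1 T2 T3 : choiceType) (I : set T1) (J : set T2) (K : set T3)
    (a : T1 -> T2 -> T3 -> \bar R) : (forall i j k, 0 <= a i j k) ->
  \esum_(i in I) \esum_(j in J) \esum_(k in K) a i j k =
  \esum_(p in I `*`` (fun=> J `*`` (fun=> K))) a p.1 p.2.1 p.2.2.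
Proof.
move=> a0; transitivity (\esum_(i in I) \esum_(p in J `*`` (fun=> K)) a i p.1 p.2).
  by apply: eq_esum => i _; rewrite esum_esum.
by rewrite esum_esum.
Qed.

Lemma esum_nat_le (a : nat -> \bar R) c : (forall i, 0 <= a i) ->
  (forall m, \sum_(0 <= i < m) a i <= c) -> \esum_(i in setT) a i <= c.
Proof.
move=> a0 h; rewrite -nneseries_esumT//; apply: lime_le.
  by apply: is_cvg_nneseries => i _ _; exact: a0.
by near=> m; exact: h.
Unshelve. all: by end_near. Qed.

Lemma esum_geometric (r : R) : (0 <= r)%R -> (r < 1)%R ->
  \esum_(i in [set: nat]) (r ^+ i)%:E <= ((1 - r)^-1)%:E.
Proof.
move=> r0 r1; apply: esum_nat_le => [i|m]; first by rewrite lee_fin exprn_ge0.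
rewrite sumEFin lee_fin big_mkord.
have s : (0 < 1 - r)%R by rewrite subr_gt0.
rewrite -(@ler_pM2l _ (1 - r)%R)// divff ?gt_eqF//.
have := subrX1 r m; move/(congr1 (fun x => - x)%R); rewrite -mulNr !opprB => <-.
by rewrite gerBl exprn_ge0.
Qed.

End esum_more.

(** * Leftover levels for functions supported in a box or an annulus *)

Section tails.
Context {R : realType} {n : nat}.
Variable Mz : 'M[int]_n.+1.
Local Notation M := (map_mx intr Mz : 'M[R]_n.+1).
Hypothesis hM : expansive M.
Local Notation B := (invmx M).
Local Notation mu := (lebesgue_cV R n.+1 : {measure set 'cV[R]_n.+1 -> \bar R}).
Local Notation Cfun := ('cV[R]_n.+1 -> R[i]).
Local Notation iv := (@intvec R n.+1).
Local Notation q := (`|\det M|).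
Variable Psi : set Cfun.
Hypothesis hPsi : Psi `<=` @L2 R n.+1.
Variable S : R.
Hypothesis hS : (\esum_(psi in Psi) (L2norm psi ^+ 2) <= S%:E)%E.
Implicit Types (f g psi : Cfun) (e k : 'cV[int]_n.+1).
Local Notation E_ J v := (@residues R n.+1 (Mz ^+ J) v).

Let uM : M \in unitmx := expansive_unit hM.
Let q1 : 1 < q := expansive_det hM.
Let q0 : 0 < q := lt_trans ltr01 q1.

Lemma measurable_sqc f : L2 f -> measurable_fun setT (fun x => sqc (f x)).
Proof. by move=> [m1 m2 _]; apply: measurable_funD; exact: measurable_funX. Qed.

Lemma measurable_power_preimage (A : set 'cV[R]_n.+1) i v : measurable A ->
  measurable [set y : 'cV[R]_n.+1 | A (M ^+ i *m y + v)].
Proof.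
move=> mA; have [_ m1 _] := scales_comp (scales_power hM i) (scales_shift v).
by rewrite -[X in measurable X]setTI; exact: m1.
Qed.

(* f vanishes outside A, so the inner product sees only the part of the coarse
   atom over A; then substitute x = M^i y + l. *)
Lemma inner_sqr_coarsen_supp (A : set 'cV[R]_n.+1) (F : R) f psi l i : measurable A ->
  (forall x, ~ A x -> f x = 0) -> L2 f -> (L2norm f ^+ 2 = F%:E)%E -> L2 psi ->
  (inner_sqr f (translate l (coarsen M i psi)) <= (2 * F * q ^- i)%:E *
    \int[mu]_y ((\1_[set y | A (M ^+ i *m y + iv l)] y)%:E * (sqc (psi y))%:E))%E.
Proof.
move=> mA fA hf hF hp.
have hc := L2_translate l (L2_coarsen hM i hp).
apply: le_trans (inner_sqr_supp mA fA hf hc) _.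
pose T (x : 'cV[R]_n.+1) := B ^+ i *m (x + - iv l).
have sT : scales mu mu T (1 * q ^+ i).
  exact: scales_comp (scales_shift (- iv l)) (scales_powerN hM i).
set G := fun y : 'cV[R]_n.+1 => ((\1_[set y | A (M ^+ i *m y + iv l)] y)%:E * (sqc (psi y))%:E)%E.
have mG : measurable_fun setT G.
  apply: emeasurable_funM; apply/measurable_EFinP; last exact: measurable_sqc.
  by apply: measurable_indic; exact: measurable_power_preimage.
have G0 y : (0 <= G y)%E by rewrite mule_ge0 ?lee_fin ?sqc_ge0.
have q_i : 0 < q ^+ i by exact: exprn_gt0.
have -> : (\int[mu]_x ((\1_A x)%:E * (sqc (translate l (coarsen M i psi) x))%:E) =
    (q ^- i ^+ 2)%:E * \int[mu]_x G (T x))%E.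
  have [_ mT _] := sT; have mGT : measurable_fun setT (fun x => G (T x)).
    exact: measurableT_comp mG mT.
  rewrite -ge0_integralZl; [|exact: measurableT|exact: mGT|by []|by rewrite lee_fin sqr_ge0].
  apply: eq_integral => x _; rewrite /G /T muleCA -!EFinM.
  have -> : \1_[set y | A (M ^+ i *m y + iv l)] (B ^+ i *m (x + - iv l)) = \1_A x :> R.
    have EA : A (M ^+ i *m (B ^+ i *m (x + - iv l)) + iv l) = A x by rewrite powerKN// subrK.
    rewrite !indicE; congr (nat_of_bool _)%:R.
    by apply/idP/idP => /set_mem /= h; apply/mem_set; move: h; rewrite /= EA.
  congr (_ * _)%:E.
  by rewrite /translate coarsenE sqcM {1}/sqc /= expr0n addr0.
rewrite (integral_scales sT mG)// mul1r hF !muleA -!EFinM.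
rewrite lee_wpmul2r ?integral_ge0// lee_fin le_eqVlt; apply/orP; left; apply/eqP.
by field; rewrite gt_eqF.
Qed.

Lemma ler_S (c : R) : 0 <= c ->
  (\esum_(psi in Psi) (c%:E * L2norm psi ^+ 2) <= (c * S)%:E)%E.
Proof.
move=> c0; rewrite esumZ//; last by move=> *; exact: L2norm_sqr_ge0.
by rewrite EFinM; apply: lee_wpmul2l; rewrite ?lee_fin.
Qed.

(** For fixed i the sets met over all N and k overlap at most D times, so the sum over N costs 2 F D
    S q^-i, which is summable in i. Summability in N provides dilates of f with small coarse
    energy. *)
Lemma dilated_coarse_summable (a b : R) f : 0 < a -> 0 < b -> L2 f ->
  (forall x, ~ annulus a b x -> f x = 0) -> exists D : R,
  (\esum_(N in [set: nat]) \esum_(i in [set i | (0 < i)%N])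
     coarse_level Mz Psi i (affine (M ^+ N) 0 f) <= D%:E)%E.
Proof.
move=> a0 b0 hf fA; have [v fv] := L2_toC hf.
pose F := ip v v; have hF : (L2norm f ^+ 2 = F%:E)%E by rewrite fv toC_L2norm.
have F0 : 0 <= F by exact: ip_ge0.
have [D D0 hD] := count_annulus hM a0 b0.
exists (2 * F * D * S * (1 - q^-1)^-1).
have c0 i psi k N : (0 <= inner_sqr (affine (M ^+ N) 0 f) (translate k (coarsen M i psi)))%E.
  exact: inner_sqr_ge0.
rewrite esum_swap; last by move=> *; exact: coarse_level_ge0.
apply: (@le_trans _ _ (\esum_(i in [set i | (0 < i)%N]) (2 * F * D * S * q^-1 ^+ i)%:E)%E).
  apply: le_esum => i _; rewrite /coarse_level esum_swap; last first.
    by move=> *; apply: esum_ge0.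
  rewrite (_ : 2 * F * D * S * _ = (2 * F * D * q^-1 ^+ i) * S); last by ring.
  apply: le_trans (ler_S _); last first.
    by rewrite !mulr_ge0// exprn_ge0// invr_ge0 ltW.
  apply: le_esum => psi /hPsi hp.
  pose Bs N k := [set y | annulus a b (M ^+ N *m (M ^+ i *m y + iv k))].
  apply: (@le_trans _ _ (\esum_(N in [set: nat]) \esum_(k in setT) (2 * F * q ^- i)%:E *
     \int[mu]_y ((\1_(Bs N k) y)%:E * (sqc (psi y))%:E))%E).
    apply: le_esum => N _; apply: le_esum => k _.
    have dN := det_expz_neq0 hM N.
    apply: (@inner_sqr_coarsen_supp [set x | annulus a b (M ^+ N *m x)]) => //.
    - have := @measurable_power_preimage (annulus a b) N 0 (measurable_annulus a b).
      by congr (measurable _); apply/seteqP; split=> x /=; rewrite addr0.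
    - move=> x /= nx; rewrite /affine intvec0 subr0 fA ?mulr0//.
    - exact: L2_affine.
    - by rewrite L2norm_affine.
  have c1 : 0 <= 2 * F * q ^- i by rewrite !mulr_ge0// invr_ge0 exprn_ge0// ltW.
  under eq_esum => N _.
    rewrite esumZ//; last by move=> *; apply: integral_ge0 => y _; rewrite mule_ge0 ?lee_fin ?sqc_ge0.
    over.
  rewrite esumZ//; last first.
    by move=> *; apply: esum_ge0 => k _; apply: integral_ge0 => y _; rewrite mule_ge0 ?lee_fin ?sqc_ge0.
  rewrite (_ : 2 * F * D * _ = 2 * F * q ^- i * D); last by rewrite exprVn; ring.
  rewrite [X in (_ <= X * _)%E]EFinM -muleA; apply: lee_wpmul2l; first by rewrite lee_fin.
  rewrite L2norm_sqr esum_esum; last first.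
    by move=> *; apply: integral_ge0 => y _; rewrite mule_ge0 ?lee_fin ?sqc_ge0.
  apply: (@esum_integral_le _ _ _ mu _ _ (fun p => Bs p.1 p.2)) => //.
  - move=> [N k] /=; rewrite /Bs.
    have := @measurable_power_preimage [set y | annulus a b (M ^+ N *m y)] i (iv k).
    apply; have := @measurable_power_preimage (annulus a b) N 0 (measurable_annulus a b).
    by congr (measurable _); apply/seteqP; split=> x /=; rewrite addr0.
  - exact: measurable_sqc.
  - by move=> x; exact: sqc_ge0.
  - move=> y; have := hD (M ^+ i *m y); rewrite esum_esum; last by move=> *; rewrite lee_fin.
    exact.
under eq_esum do rewrite EFinM.
have qV : 0 <= q^-1 by rewrite invr_ge0 ltW.
have S0 : 0 <= S.
  have := hS; rewrite -lee_fin; apply: le_trans.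
  by apply: esum_ge0 => *; exact: L2norm_sqr_ge0.
have cc : 0 <= 2 * F * D * S by rewrite !mulr_ge0.
rewrite esumZ; [|exact: cc|by move=> i _; rewrite lee_fin exprn_ge0].
rewrite [leRHS]EFinM; apply: lee_wpmul2l; first by rewrite lee_fin.
apply: le_trans (esum_subset _ (@subsetT _ _)) _; apply: esum_geometric => //.
by rewrite invf_lt1.
Qed.

Lemma invmx_power J : invmx (map_mx intr (Mz ^+ J)) = B ^+ J.
Proof. by rewrite map_power -[LHS]/((M ^+ J)^-1) -exprVn. Qed.

(* The residues e with floor (M^-J e) = (1, ..., 1) keep M^-J e away from 0, so
   for large J all the dilated supports lie in a fixed annulus. *)
Lemma count_translated_residues (a : R) : 0 < a -> exists2 D : R, 0 <= D &
  exists J0, forall J, (J0 <= J)%N -> forall y : 'cV[R]_n.+1,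
  (\esum_(i in [set i | (J < i)%N]) \esum_(k in setT) \esum_(e in E_ J (const_mx 1%Z))
     (\1_(inbox a) (M ^+ i *m y + iv (Mz ^+ i *m k - e)%R))%:E <= D%:E)%E.
Proof.
move=> a0; have h0 : (0 : R) < 2^-1 by lra.
have h3 : (0 : R) < 3 by lra.
have [J0 hJ0] := inverse_powers_small hM h0 a0.
have [D1 D10 hD1] := @count_box R n.+1 a.
have [D2 D20 hD2] := count_annulus hM h0 h3.
(* [D1] bounds the number of residues for given i and k, [D2] the number of pairs (i, k) that have
   any. *)
exists (D1 * D2); first exact: mulr_ge0.
exists J0 => J JJ0 y.
apply: (@le_trans _ _ (\esum_(i in [set i | (J < i)%N]) \esum_(k in setT)
    D1%:E * (\1_(annulus 2^-1 3) (M ^+ (i - J) *m (y + iv k)%R))%:E)%E).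
  apply: le_esum => i /= Ji; apply: le_esum => k _.
  pose w := M ^+ i *m (y + iv k).
  have wE e : M ^+ i *m y + iv (Mz ^+ i *m k - e) = w + iv (- e).
    by rewrite intvecD intvec_power addrA -mulmxDr.
  have BJw : B ^+ J *m w = M ^+ (i - J) *m (y + iv k).
    rewrite /w -{1}(subnKC (ltnW Ji)) exprD -[_ * _]/(_ *m _) -mulmxA.
    exact: powerNK.
  have [[e [he hb]]|no] := pselect (exists e, E_ J (const_mx 1%Z) e /\ inbox a (w + iv (- e))).
    rewrite -BJw (_ : \1_(annulus 2^-1 3) _ = 1); last first.
      rewrite indicE mem_set//.
      have sm := hJ0 J _ JJ0 hb; rewrite mulmxDr intvecN mulmxN in sm.
      move: he; rewrite /residues /= invmx_power => /vfloorP he.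
      (* M^-J e has coordinates in [1, 2[ and M^-J shrinks the box to half-side 1/2, so the
         coordinates of M^-J w lie between 1/2 and 5/2; hence the radii 1/2 and 3. *)
      have co j : 2^-1 < (B ^+ J *m w) j 0 < 5 / 2.
        have := he j; have := sm j; rewrite !mxE; move: (\sum_ _ _) (\sum_ _ _) => u v.
        by rewrite intrD !mulr1z ltr_norml => /andP[? ?] /andP[? ?]; apply/andP; split; lra.
      split=> [j|/(_ ord0)]; have /andP[c1 c2] := co ord0; first have /andP[c3 c4] := co j.
        by rewrite ger0_norm; lra.
      by rewrite ger0_norm; lra.
    rewrite mule1; apply: le_trans (hD1 w).
    rewrite -[leRHS](@esum_bij _ _ _ -%R -%R); [|exact: opprK|exact: opprK].
    apply: le_trans (esum_subset _ (@subsetT _ _)) _.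
    by apply: le_esum => e' _; rewrite wE.
  rewrite esum1 ?mule_ge0 ?lee_fin// => e he; rewrite wE indicE memNset// => hb.
  by apply: no; exists e.
rewrite EFinM; apply: le_trans (lee_wpmul2l _ (hD2 y)); last by rewrite lee_fin.
rewrite -[leRHS]esumZ//; last by move=> *; apply: esum_ge0 => *; rewrite lee_fin.
apply: (@le_trans _ _ (\esum_(m in [set m | (0 < m)%N]) (D1%:E * \esum_(k in setT)
     (\1_(annulus 2^-1 3) (M ^+ m *m (y + iv k)%R))%:E))%E); last exact: esum_subset.
rewrite (reindex_esum [set m | (0 < m)%N] _ (addn J)); last first.
  split.
  - by move=> i /= i0; lia.
  - by move=> i j _ _; lia.
  - by move=> j /= j0; exists (j - J)%N => /=; lia.
by apply: le_esum => m _; rewrite addKn esumZ.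
Qed.

(** The normalization q^i of the affine atoms cancels the q^-i of the coarse ones, so nothing decays
    in i. Bounded overlap alone gives the bound, and it does not depend on J although the sum runs
    over q^J residues. *)
Lemma translated_tail (a : R) f : 0 < a -> L2 f -> (forall x, ~ inbox a x -> f x = 0) ->
  exists D : R, exists J0 : nat, forall J, (J0 <= J)%N ->
  (\esum_(e in E_ J (const_mx 1%Z)) \esum_(i in [set i | (J < i)%N])
     level Mz Psi (- i%:Z) (translate e f) <= D%:E)%E.
Proof.
move=> a0 hf fA; have [v fv] := L2_toC hf.
pose F := ip v v; have hF : (L2norm f ^+ 2 = F%:E)%E by rewrite fv toC_L2norm.
have F0 : 0 <= F by exact: ip_ge0.
have [D D0 [J0 hD]] := count_translated_residues a0.
exists (2 * F * D * S), J0 => J JJ0.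
have i0 i psi k e : (0 <= inner_sqr (translate e f) (affine (mx_expz M (- i%:Z)) k psi))%E.
  exact: inner_sqr_ge0.
rewrite esum_swap; last by move=> *; exact: level_ge0.
under eq_esum => i _.
  rewrite esum_swap; last by move=> *; apply: esum_ge0.
  over.
rewrite esum_swap; last by move=> *; do 2 apply: esum_ge0 => *.
apply: le_trans (ler_S _); last by rewrite !mulr_ge0.
apply: le_esum => psi /hPsi hp.
pose Bs i k e := [set y | inbox a (M ^+ i *m y + iv (Mz ^+ i *m k - e))].
have I0 i k e : (0 <= \int[mu]_y ((\1_(Bs i k e) y)%:E * (sqc (psi y))%:E))%E.
  by apply: integral_ge0 => y _; rewrite mule_ge0 ?lee_fin ?sqc_ge0.
apply: (@le_trans _ _ (\esum_(i in [set i | (J < i)%N]) \esum_(k in setT)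
  \esum_(e in E_ J (const_mx 1%Z)) (2 * F)%:E *
     \int[mu]_y ((\1_(Bs i k e) y)%:E * (sqc (psi y))%:E))%E).
  apply: le_esum => i _; rewrite esum_swap//.
  apply: le_esum => k _; apply: le_esum => e _.
  rewrite mx_expzN (inner_sqr_affine_powerN hM)//.
  have := @inner_sqr_coarsen_supp (inbox a) F f psi (Mz ^+ i *m k - e) i
    (measurable_inbox a) fA hf hF hp.
  have qi : (0 <= (q ^+ i)%:E)%E by rewrite lee_fin exprn_ge0// ltW.
  have E : ((q ^+ i)%:E * (2 * F * q ^- i)%:E = (2 * F)%:E)%E.
    by rewrite -EFinM; congr _%:E; field; rewrite expf_eq0 gt_eqF ?andbF.
  by move=> /(lee_wpmul2l qi); rewrite muleA E.
have c1 : 0 <= 2 * F by rewrite mulr_ge0.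
rewrite esum3; last by move=> *; rewrite mule_ge0.
rewrite esumZ//.
rewrite [X in (_ <= X * _)%E]EFinM -muleA; apply: lee_wpmul2l; first by rewrite lee_fin.
rewrite L2norm_sqr.
apply: (@esum_integral_le _ _ _ mu _ _ (fun p => Bs p.1 p.2.1 p.2.2)) => //.
- move=> [i [k e]] /=; apply: measurable_power_preimage; exact: measurable_inbox.
- exact: measurable_sqc.
- by move=> x; exact: sqc_ge0.
- move=> y; have := hD J JJ0 y; rewrite esum3; last by move=> *; rewrite lee_fin.
  exact.
Qed.

End tails.

(** * Lower bounds from a dense class of functions *)

Section density.
Context {R : realType} {d : nat}.
Local Notation mu := (lebesgue_cV R d : {measure set 'cV[R]_d -> \bar R}).
Local Notation Cfun := ('cV[R]_d -> R[i]).
Implicit Types (f g h : Cfun).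

(** A form of the triangle inequality for the square root of E that makes sense for infinite values
    and is inherited by sums. *)
Definition perturbable (E : Cfun -> \bar R) := forall (t : R) f g, 0 < t -> L2 f -> L2 g ->
  (E f <= (1 + t)%:E * E g + (1 + t^-1)%:E * E (fun x => (f x - g x)%R))%E.

Lemma perturbable_inner_sqr h : L2 h -> perturbable (fun f => inner_sqr f h).
Proof. by move=> hh t f g t0 hf hg; exact: inner_sqr_perturb. Qed.

Lemma perturbable_esum (T : choiceType) (I : set T) (E : T -> Cfun -> \bar R) :
  (forall i f, 0 <= E i f)%E -> (forall i, I i -> perturbable (E i)) ->
  perturbable (fun f => \esum_(i in I) E i f)%E.
Proof.
move=> E0 hE t f g t0 hf hg.
have t1 : 0 <= 1 + t by lra.
have t2 : 0 <= 1 + t^-1 by rewrite addr_ge0// invr_ge0 ltW.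
rewrite -!esumZ//; rewrite -esumD.
- by apply: le_esum => i Ii; exact: hE.
- by move=> i _; rewrite mule_ge0 ?lee_fin.
- by move=> i _; rewrite mule_ge0 ?lee_fin.
Qed.

Lemma perturbable_add (E E' : Cfun -> \bar R) : (forall f, 0 <= E f)%E ->
  (forall f, 0 <= E' f)%E -> perturbable E -> perturbable E' ->
  perturbable (fun f => E f + E' f)%E.
Proof.
move=> E0 E'0 hE hE' t f g t0 hf hg.
have t1 : 0 <= 1 + t by lra.
have t2 : 0 <= 1 + t^-1 by rewrite addr_ge0// invr_ge0 ltW.
rewrite !ge0_muleDr// addeACA; apply: leeD; [exact: hE|exact: hE'].
Qed.

Lemma L2norm_sqr_real f : L2 f -> exists2 F : R, 0 <= F & (L2norm f ^+ 2 = F%:E)%E.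
Proof.
by move=> /L2_toC[v ->]; exists (ip v v); [exact: ip_ge0|exact: toC_L2norm].
Qed.

(** The upper bound makes E continuous for the norm. A squared distance of at most t^2 to g
    compensates the factor [1 + t^-1], so that every error is linear in t. *)
Lemma lower_bound_dense (E : Cfun -> \bar R) (C1 C2 : R) (G : set Cfun) :
  perturbable E -> (forall f, 0 <= E f)%E -> 0 <= C1 -> 0 <= C2 ->
  (forall f, L2 f -> E f <= C2%:E * L2norm f ^+ 2)%E ->
  (forall g, G g -> L2 g /\ (C1%:E * L2norm g ^+ 2 <= E g)%E) ->
  (forall f eps, L2 f -> 0 < eps ->
     exists2 g, G g & (L2norm (fun x => (g x - f x)%R) ^+ 2 <= eps%:E)%E) ->
  forall f, L2 f -> (C1%:E * L2norm f ^+ 2 <= E f)%E.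
Proof.
move=> hE E0 C10 C20 up low dense f hf.
have fin g : L2 g -> exists2 y : R, 0 <= y & E g = y%:E.
  move=> hg; have [F _ hF] := L2norm_sqr_real hg.
  have := up g hg; rewrite hF -EFinM; have := E0 g.
  case: (E g) => [y||]//; first by rewrite lee_fin => y0 _; exists y.
have [x x0 hx] := L2norm_sqr_real hf; have [y y0 hy] := fin f hf.
rewrite hx hy -EFinM lee_fin; apply/ler_addgt0Pr => e e0.
(* K collects the coefficients of t in the errors, the terms in t^2 being bounded through t <= 1. *)
pose K := 3 * y + 2 * C1 + 4 * C2 + 1.
have K0 : 0 < K by rewrite /K; nra.
pose t := Num.min 1 (e / K).
have t0 : 0 < t by rewrite lt_min ltr01 divr_gt0.
have t1 : t <= 1 by rewrite ge_min lexx.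
have tK : t * K <= e by rewrite -ler_pdivlMr// ge_min lexx orbT.
have [g Gg gd] := dense f (t * t) hf (mulr_gt0 t0 t0).
have [hg lg] := low g Gg.
have hgf : L2 (fun x => (g x - f x)%R) by exact: L2_sub.
have hfg : L2 (fun x => (f x - g x)%R) by exact: L2_sub.
have [u u0 hu] := L2norm_sqr_real hg; have [w w0 hw] := fin g hg.
have [z z0 hz] := fin _ hgf; have [dl dl0 hdl] := L2norm_sqr_real hgf.
have sym : (L2norm (fun x => (f x - g x)%R) ^+ 2 = dl%:E)%E.
  rewrite -hdl !L2norm_sqr; apply: eq_integral => s _; rewrite -opprB -mulN1r sqcM.
  by rewrite /sqc /= oppr0 sqrrN expr1n expr0n addr0 mul1r.
move: lg; rewrite hu hw -EFinM lee_fin => lg.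
move: gd; rewrite hdl lee_fin => gd.
have := up _ hgf; rewrite hz hdl -EFinM lee_fin => zC.
have := hE t g f t0 hg hf; rewrite hw hy hz -!EFinM -EFinD lee_fin => p1.
have := L2norm_sqr_perturb t0 hf hg; rewrite hx hu sym -!EFinM -EFinD lee_fin => p2.
have tV (a b : R) : 0 <= a -> a <= b * (t * t) -> (1 + t^-1) * a <= 2 * b * t.
  move=> a0 ab; have b0 : 0 <= b.
    by rewrite -(@pmulr_lge0 _ (t * t)) ?mulr_gt0// (le_trans a0).
  rewrite -(ler_pM2l t0) mulrA mulrDr divff ?gt_eqF// mulr1.
  have : (t + 1) * a <= 2 * a by nra.
  nra.
have q1 := tV z C2 z0 (le_trans zC (ler_wpM2l C20 gd)).
have q2 : (1 + t^-1) * dl <= 2 * 1 * t by apply: tV => //; rewrite mul1r.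
have r1 : C1 * x <= C1 * ((1 + t) * u + 2 * 1 * t).
  by apply: ler_wpM2l => //; lra.
have r2 : (1 + t) * (C1 * u) <= (1 + t) * ((1 + t) * y + 2 * C2 * t).
  by apply: ler_wpM2l; lra.
have r3 : (1 + t) * ((1 + t) * y + 2 * C2 * t) <= y + t * (3 * y + 4 * C2).
  have : t * t * y <= t * y by rewrite ler_wpM2r// ler_piMl// ltW.
  have : t * t * C2 <= t * C2 by rewrite ler_wpM2r// ler_piMl// ltW.
  nra.
have : t * K = t * (3 * y + 4 * C2) + C1 * (2 * t) + t by rewrite /K; ring.
nra.
Qed.

End density.

(** The annuli exhaust the complement of the origin, which is a null set in positive dimension;
    dominated convergence does the rest. *)
Lemma truncation_dense {R : realType} {n : nat} (f : 'cV[R]_n.+1 -> R[i]) (eps : R) :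
  L2 f -> 0 < eps -> exists2 g : 'cV[R]_n.+1 -> R[i],
  (exists m : nat, L2 g /\ forall x, ~ annulus m.+1%:R^-1 m.+1%:R x -> g x = 0) &
  (L2norm (fun x => (g x - f x)%R) ^+ 2 <= eps%:E)%E.
Proof.
move=> hf eps0.
pose mu := (lebesgue_cV R n.+1 : {measure set 'cV[R]_n.+1 -> \bar R}).
pose A m : set 'cV[R]_n.+1 := annulus m.+1%:R^-1 m.+1%:R.
have mA m : measurable (A m) by exact: measurable_annulus.
pose g m x := (\1_(A m) x)%:C * f x.
have E m x : sqc (g m x - f x) = \1_(~` A m) x * sqc (f x).
  have -> : g m x - f x = (\1_(A m) x - 1)%:C * f x.
    by rewrite /g rmorphB mulrBl mul1r.
  rewrite sqcM; congr (_ * _); rewrite /sqc /= expr0n addr0 !indicE in_setC.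
  by case: (x \in A m); rewrite ?subrr ?sub0r ?sqrrN ?expr0n ?expr1n.
have ms : measurable_fun setT (fun x => sqc (f x)) by exact: measurable_sqc.
have [_ _ /L2norm_lty fi] := hf.
have mE m : measurable_fun setT (fun x => (\1_(~` A m) x * sqc (f x))%:E : \bar R).
  apply/measurable_EFinP/measurable_funM => //; apply: measurable_indic.
  exact: measurableC.
have z0E : [set 0] = [set x : 'cV[R]_n.+1 | forall i, [set (0 : measurableTypeR R)] (x i 0)].
  by apply/seteqP; split=> [x /= -> i|x /= h]; [rewrite mxE|apply/colP => i; rewrite mxE h].
have : (fun m => \int[mu]_x (\1_(~` A m) x * sqc (f x))%:E)%E @ \oo --> (\int[mu]_x 0)%E.
  have := @dominated_convergence _ _ _ mu setT measurableT
    (fun m x => (\1_(~` A m) x * sqc (f x))%:E) (fun=> 0%E) (fun x => (sqc (f x))%:E) mE.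
  case => //.
  - exists [set 0]; split; rewrite ?z0E.
    + rewrite (_ : [set x | _] = \bigcap_(i in [set: 'I_n.+1]) (@coord R n.+1 i @^-1` [set 0])).
        apply: fin_bigcap_measurable => // i _; rewrite -[X in measurable X]setTI.
        exact: measurable_coord.
      by apply/seteqP; split=> x /= h i => [_|]; [exact: h|exact: h i I].
    + have -> : mu [set x | forall i, [set (0 : measurableTypeR R)] (x i 0)] =
          (\prod_(i < n.+1) @lebesgue_measure R [set 0%R])%E by exact: measure_box.
      by rewrite big_ord_recl lebesgue_measure_set1 mul0e.
    + rewrite -z0E => x /=; apply: contra_notP => x0 _.
      have [i xi] : exists i, x i 0 != 0.
        apply: contra_notP x0 => nx; apply/colP => i; rewrite mxE.
        by apply: contra_notP nx => /eqP xi; exists i.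
      pose c := \sum_i `|x i 0|.
      have hc i' : `|x i' 0| <= c by rewrite /c (bigD1 i')//= lerDl sumr_ge0.
      (* The first bound puts x in the outer box, the second keeps it out of the inner one. *)
      pose m0 := maxn (Num.truncn c) (Num.truncn `|x i 0|^-1).
      apply: cvg_near_cst; exists m0 => // m /= m0m.
      rewrite indicE memNset ?mul0r// => /=; apply; split.
        move=> j; apply: le_lt_trans (hc j) _; apply: lt_le_trans (truncnS_gt _) _.
        by rewrite ler_nat ltnS; apply: leq_trans m0m; exact: leq_maxl.
      move=> /(_ i); apply/negP; rewrite -leNgt invf_ple ?posrE ?normr_gt0//.
      apply: ltW; apply: lt_le_trans (truncnS_gt _) _.
      by rewrite ler_nat ltnS; apply: leq_trans m0m; exact: leq_maxr.
  - apply/integrableP; split; first exact/measurable_EFinP.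
    by under eq_integral do rewrite gee0_abs ?lee_fin ?sqc_ge0//.
  - apply: aeW => x m _; rewrite gee0_abs ?lee_fin ?mulr_ge0 ?sqc_ge0//.
    by rewrite ler_piMl ?sqc_ge0// indicE; case: (x \in _).
rewrite integral0 => /fine_cvgP[_ /cvgr0_norm_lt/(_ eps eps0)[m0 _ hm]].
exists (g m0).
  exists m0; split; first exact: L2_indic.
  by move=> x nA; rewrite /g indicE memNset// mul0r.
have -> : (L2norm (fun x => (g m0 x - f x)%R) ^+ 2 =
    \int[mu]_x (\1_(~` A m0) x * sqc (f x))%:E)%E.
  by rewrite L2norm_sqr; apply: eq_integral => x _; rewrite E.
have := hm m0 (leqnn _); rewrite /=.
set I := (\int[_]_x _)%E.
have I0 : (0 <= I)%E by apply: integral_ge0 => x _; rewrite lee_fin mulr_ge0// sqc_ge0.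
have If : (I < +oo)%E.
  apply: le_lt_trans fi; apply: ge0_le_integral => //.
  - by move=> x _; rewrite lee_fin mulr_ge0// sqc_ge0.
  - exact/measurable_EFinP.
  - by move=> x _; rewrite lee_fin ler_piMl ?sqc_ge0// indicE; case: (x \in _).
have : I \is a fin_num by rewrite ge0_fin_numE.
move: I I0 If => [r||]//= r0 _ _; rewrite lee_fin; rewrite lee_fin in r0.
by rewrite ger0_norm// => /ltW.
Qed.

(** * Equivalence of the homogeneous and the quasi-affine frame inequalities *)

Section equivalence.
Context {R : realType} {n : nat}.
Variable Mz : 'M[int]_n.+1.
Local Notation M := (map_mx intr Mz : 'M[R]_n.+1).
Hypothesis hM : expansive M.
Local Notation Cfun := ('cV[R]_n.+1 -> R[i]).
Local Notation q := (`|\det M|).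
Variable Psi : set Cfun.
Hypothesis hPsi : Psi `<=` @L2 R n.+1.
Hypothesis hS : (\esum_(psi in Psi) (L2norm psi ^+ 2) < +oo)%E.
Implicit Types (f g psi : Cfun) (e k : 'cV[int]_n.+1).
Local Notation E_ J := (@residues R n.+1 (Mz ^+ J) (const_mx 1%Z)).
Local Notation fine_energy := (affine_energy M Psi [set j | (0 <= j)%R]).

Let q1 : 1 < q := expansive_det hM.
Let q0 : 0 < q := lt_trans ltr01 q1.

(** The energy of the quasi-affine system. It is the nonhomogeneous energy of any Phi whose
    translates have the same energy as those of H. *)
Definition quasi_energy f := (coarse_energy M Psi f + fine_energy f)%E.

Lemma fine_energy_ge0 f : (0 <= fine_energy f)%E.
Proof. by apply: esum_ge0 => j _; exact: level_ge0. Qed.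

Lemma fine_energy_translate e f : L2 f -> fine_energy (translate e f) = fine_energy f.
Proof.
move=> hf; rewrite /affine_energy; apply: eq_esum => j /= j0.
rewrite -(gez0_abs j0); exact: (level_translate hM hPsi).
Qed.

Lemma coarse_energy_ge0 f : (0 <= coarse_energy M Psi f)%E.
Proof. by apply: esum_ge0 => j _; exact: coarse_level_ge0. Qed.

Lemma perturbable_level_sum (h : Cfun -> 'cV[int]_n.+1 -> Cfun) :
  (forall psi k, Psi psi -> L2 (h psi k)) -> perturbable (fun f =>
    \esum_(psi in Psi) \esum_(k in [set: 'cV[int]_n.+1]) inner_sqr f (h psi k))%E.
Proof.
move=> hh; apply: (@perturbable_esum _ _ _ Psi
    (fun psi f => \esum_(k in [set: 'cV[int]_n.+1]) inner_sqr f (h psi k))%E).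
  by move=> psi f; apply: esum_ge0 => k _; exact: inner_sqr_ge0.
move=> psi hp; apply: (@perturbable_esum _ _ _ setT (fun k f => inner_sqr f (h psi k))).
  by move=> k f; exact: inner_sqr_ge0.
by move=> k _; apply: perturbable_inner_sqr; exact: hh.
Qed.

Lemma perturbable_level j : perturbable (level Mz Psi j).
Proof.
apply: perturbable_level_sum => psi k hp.
by apply: L2_affine; [exact: det_expz_neq0|exact: hPsi].
Qed.

Lemma perturbable_coarse_level i : perturbable (coarse_level Mz Psi i).
Proof.
apply: perturbable_level_sum => psi k hp.
by apply: L2_translate; apply: L2_coarsen => //; exact: hPsi.
Qed.

Lemma perturbable_affine_energy I : perturbable (affine_energy M Psi I).
Proof.
apply: (@perturbable_esum _ _ _ I (level Mz Psi)) => [j f|j _]; first exact: level_ge0.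
exact: perturbable_level.
Qed.

Lemma perturbable_quasi : perturbable quasi_energy.
Proof.
apply: perturbable_add.
- exact: coarse_energy_ge0.
- exact: fine_energy_ge0.
- apply: (@perturbable_esum _ _ _ [set i | (0 < i)%N] (coarse_level Mz Psi)) => [j f|j _].
    exact: coarse_level_ge0.
  exact: perturbable_coarse_level.
- exact: perturbable_affine_energy.
Qed.

(** An exact identity for every J. The levels beyond J stay as they are: M^i Z^d with i > J is too
    sparse for the residues modulo M^J to fill Z^d. *)
Lemma averaged_homogeneous_energy J f : L2 f ->
  (\esum_(e in E_ J) homogeneous_energy M Psi (translate e f) =
   (q ^+ J)%:E * (fine_energy f +
      \esum_(i in [set i | (0 < i)%N] `&` [set i | (i <= J)%N]) coarse_level Mz Psi i f) +
   \esum_(e in E_ J) \esum_(i in [set i | (J < i)%N]) level Mz Psi (- i%:Z) (translate e f))%E.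
Proof.
move=> hf.
have qJ : 0 < q ^+ J by exact: exprn_gt0.
have cr : (\esum_(e in E_ J) 1 = (q ^+ J)%:E :> \bar R)%E by exact: card_residues_power.
under eq_esum => e _.
  rewrite homogeneous_energyE// (esumID [set i | (i <= J)%N]); last first.
    by move=> *; exact: level_ge0.
  rewrite (_ : _ `&` ~` _ = [set i | (J < i)%N]); last first.
    apply/seteqP; split=> i /=; first by move=> [_ /negP]; rewrite -ltnNge.
    by move=> Ji; split; [exact: leq_ltn_trans Ji|apply/negP; rewrite -ltnNge].
  over.
have t0 e (I : set nat) : (0 <= \esum_(i in I) level Mz Psi (- i%:Z) (translate e f))%E.
  by apply: esum_ge0 => i _; exact: level_ge0.
have f0 := fine_energy_ge0.
rewrite esumD; [|by move=> *; exact: f0|by move=> *; exact: adde_ge0].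
rewrite esumD; [|by move=> *; exact: t0|by move=> *; exact: t0].
rewrite addeA; congr (_ + _)%E; rewrite ge0_muleDr; last first.
- by apply: esum_ge0 => *; exact: coarse_level_ge0.
- exact: fine_energy_ge0.
congr (_ + _)%E.
  rewrite -(esum_const qJ cr (f0 f)).
  by apply: eq_esum => e _; exact: fine_energy_translate.
rewrite esum_swap; last by move=> *; exact: level_ge0.
rewrite -esumZ ?ltW//; last by move=> *; exact: coarse_level_ge0.
apply: eq_esum => i [_ iJ]; exact: (esum_residues_level hM hPsi).
Qed.

Lemma quasi_of_homogeneous (C1 C2 : R) : 0 <= C1 -> 0 <= C2 ->
  frame_inequality (homogeneous_energy M Psi) C1 C2 -> frame_inequality quasi_energy C1 C2.
Proof.
move=> C10 C20 hh.
have qJ J : 0 < q ^+ J by exact: exprn_gt0.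
have sumc J (c : R) f : L2 f -> 0 <= c ->
    (\esum_(e in E_ J) (c%:E * L2norm (translate e f) ^+ 2) =
     (q ^+ J)%:E * (c%:E * L2norm f ^+ 2))%E.
  move=> hf c0; have cr : (\esum_(e in E_ J) 1 = (q ^+ J)%:E :> \bar R)%E.
    exact: card_residues_power.
  have cf0 : (0 <= c%:E * L2norm f ^+ 2)%E by rewrite mule_ge0 ?lee_fin// L2norm_sqr_ge0.
  rewrite -(esum_const (qJ J) cr cf0).
  by apply: eq_esum => e _; rewrite L2norm_translate.
have up f : L2 f -> (quasi_energy f <= C2%:E * L2norm f ^+ 2)%E.
  move=> hf; have [F F0 hF] := L2norm_sqr_real hf.
  have part J : (fine_energy f +
      \esum_(i in [set i | (0 < i)%N] `&` [set i | (i <= J)%N]) coarse_level Mz Psi i f <=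
      (C2 * F)%:E)%E.
    rewrite -(@lee_pmul2l _ (q ^+ J)%:E)// ?lte_fin// EFinM -hF -sumc//.
    apply: (@le_trans _ _ (\esum_(e in E_ J) homogeneous_energy M Psi (translate e f))).
      rewrite averaged_homogeneous_energy// leeDl//.
      by apply: esum_ge0 => *; apply: esum_ge0 => *; exact: level_ge0.
    by apply: le_esum => e _; have /andP[] := hh _ (L2_translate e hf).
  rewrite hF -EFinM /quasi_energy.
  have := part 0%N; have := fine_energy_ge0 f.
  have fp : (fine_energy f <= (C2 * F)%:E)%E.
    apply: le_trans (part 0%N); rewrite leeDl//.
    by apply: esum_ge0 => *; exact: coarse_level_ge0.
  move: (fine_energy f) fp part => [p||]// fp part p0 _.
  rewrite addeC -leeBrDl//; apply: esum_le => X X0.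
  (* A finite set of coarse levels is reached by averaging with J its maximum. *)
  rewrite leeBrDl//; apply: le_trans (part (\max_(i <- X) i)%N); apply: leeD2l.
  apply: sum_le_esum => i iX; split; first exact: X0.
  exact: leq_bigmax_seq.
have [S S0] : exists S : R, (\esum_(psi in Psi) (L2norm psi ^+ 2) <= S%:E)%E.
  have : (0 <= \esum_(psi in Psi) (L2norm psi ^+ 2))%E.
    by apply: esum_ge0 => *; exact: L2norm_sqr_ge0.
  by move: hS; case: (esum _ _) => [s||]// _ _; exists s.
have quasi0 f : (0 <= quasi_energy f)%E.
  by rewrite adde_ge0//; [exact: coarse_energy_ge0|exact: fine_energy_ge0].
move=> f hf; apply/andP; split; last exact: up.
apply: (lower_bound_dense perturbable_quasi quasi0 C10 C20 up _
  (fun f eps hf h => truncation_dense hf h)) => //.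
move=> g [m [hg gA]]; split => //.
have [F F0 hF] := L2norm_sqr_real hg.
have gB x : ~ inbox m.+1%:R x -> g x = 0 by move=> nx; apply: gA => -[].
have m0 : (0 : R) < m.+1%:R by rewrite ltr0n.
have [D [J0 hD]] := translated_tail hM hPsi S0 m0 hg gB.
rewrite hF -EFinM; apply/lee_addgt0Pr => eps eps0.
(* The leftover is bounded independently of J, so dividing by the number q^J of residues makes it
   small. *)
have [J [JJ0 JD]] : exists J, (J0 <= J)%N /\ D <= eps * q ^+ J.
  have qV : `|q^-1| < 1 by rewrite normfV normr_id invf_lt1.
  have eD : 0 < eps / (`|D| + 1) by rewrite divr_gt0// ltr_wpDl.
  have := cvg_expr qV; move=> /cvgr0_norm_lt/(_ _ eD)[K _ hK].
  exists (maxn J0 K); split; first exact: leq_maxl.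
  have := hK (maxn J0 K) (leq_maxr _ _); rewrite /= exprVn normfV ger0_norm ?(ltW (qJ _))//.
  rewrite ltr_pdivlMr ?ltr_wpDl// => h; rewrite -ler_pdivrMr//.
  apply: le_trans (ltW h); rewrite mulrC; apply: ler_wpM2l; first by rewrite invr_ge0 ltW.
  by have := ler_norm D; lra.
rewrite -(@lee_pmul2l _ (q ^+ J)%:E)// ?lte_fin// EFinM -hF -sumc//.
apply: (@le_trans _ _ (\esum_(e in E_ J) homogeneous_energy M Psi (translate e g))).
  by apply: le_esum => e _; have /andP[] := hh _ (L2_translate e hg).
rewrite averaged_homogeneous_energy// [leRHS]ge0_muleDr//; last by rewrite lee_fin ltW.
apply: leeD.
  apply: lee_wpmul2l; first by rewrite lee_fin ltW.
  rewrite /quasi_energy addeC leeD2r//; apply: esum_subset.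
  by move=> i [].
by apply: le_trans (hD J JJ0) _; rewrite -EFinM lee_fin mulrC.
Qed.

Lemma dilated_fine_energy (N : nat) f : L2 f ->
  fine_energy (affine (M ^+ N) 0 f) =
  affine_energy M Psi [set j | (- N%:Z <= j)%R] f.
Proof.
move=> hf; rewrite /affine_energy (reindex_esum [set j | (- N%:Z <= j)%R] _ (fun j => j + N%:Z)).
  apply: eq_esum => j _; apply: eq_esum => psi hp; apply: eq_esum => k _.
  by rewrite inner_sqr_dilate ?addrK//; exact: hPsi.
split=> [j /=|i j _ _ /addIr//|j /= j0]; first by lia.
by exists (j - N%:Z) => /=; lia.
Qed.

Lemma homogeneous_of_quasi (C1 C2 : R) : 0 <= C1 -> 0 <= C2 ->
  frame_inequality quasi_energy C1 C2 -> frame_inequality (homogeneous_energy M Psi) C1 C2.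
Proof.
move=> C10 C20 hq.
have dM N : \det (M ^+ N) != 0 := det_expz_neq0 hM N.
have hD N f (hf : L2 f) : L2 (affine (M ^+ N) 0 f) by exact: L2_affine.
have up f : L2 f -> (homogeneous_energy M Psi f <= C2%:E * L2norm f ^+ 2)%E.
  move=> hf; apply: esum_le => X _.
  (* Dilation by M^N moves the finitely many levels of X to nonnegative ones. *)
  pose N := (\max_(j <- X) absz j)%N.
  apply: (@le_trans _ _ (affine_energy M Psi [set j | (- N%:Z <= j)%R] f)).
    apply: sum_le_esum => j jX /=.
    have := @leq_bigmax_seq int (enum_fset X) xpredT (fun j : int => absz j) j jX isT; rewrite -/N.
    by lia.
  rewrite -dilated_fine_energy// -(L2norm_affine (U := M ^+ N) 0)//.
  have /andP[_] := hq _ (hD N f hf); apply: le_trans.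
  by rewrite /quasi_energy leeDr// coarse_energy_ge0.
have [S S0] : exists S : R, (\esum_(psi in Psi) (L2norm psi ^+ 2) <= S%:E)%E.
  have : (0 <= \esum_(psi in Psi) (L2norm psi ^+ 2))%E.
    by apply: esum_ge0 => *; exact: L2norm_sqr_ge0.
  by move: hS; case: (esum _ _) => [s||]// _ _; exists s.
have hom0 f : (0 <= homogeneous_energy M Psi f)%E.
  by apply: esum_ge0 => j _; exact: level_ge0.
move=> f hf; apply/andP; split; last exact: up.
apply: (lower_bound_dense (@perturbable_affine_energy setT) hom0 C10 C20 up _
  (fun f eps hf h => truncation_dense hf h)) => //.
move=> g [m [hg gA]]; split => //.
have m0 : (0 : R) < m.+1%:R by rewrite ltr0n.
have mV : (0 : R) < m.+1%:R^-1 by rewrite invr_gt0.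
have [D hDs] := dilated_coarse_summable hM hPsi S0 mV m0 hg gA.
apply/lee_addgt0Pr => eps eps0.
have [N hN] : exists N, (coarse_energy M Psi (affine (M ^+ N) 0 g) <= eps%:E)%E.
  apply: contrapT => no.
  have big N : (eps%:E <= coarse_energy M Psi (affine (M ^+ N) 0 g))%E.
    by apply/ltW; rewrite ltNge; apply/negP => h; apply: no; exists N.
  (* K terms, each at least eps, exceed the bound D on the whole sum. *)
  pose K := (Num.truncn (D / eps)).+1.
  have : ((eps *+ K)%:E <= D%:E)%E.
    apply: le_trans hDs; rewrite -nneseries_esumT; last by move=> N; exact: coarse_energy_ge0.
    apply: le_trans (nneseries_lim_ge K _); last by move=> *; exact: coarse_energy_ge0.
    apply: (@le_trans _ _ (\sum_(0 <= i < K) eps%:E)%E); last by apply: lee_sum => N _; exact: big.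
    by rewrite sumEFin big_const_nat subn0 iter_addr addr0.
  rewrite lee_fin -mulr_natl -ler_pdivlMr// leNgt truncnS_gt//.
rewrite -(L2norm_affine (U := M ^+ N) 0)//.
have /andP[le _] := hq _ (hD N g hg); apply: le_trans le _.
rewrite /quasi_energy addeC dilated_fine_energy//; apply: leeD => //.
exact: esum_subset.
Qed.

End equivalence.

(** * Generators of shift-invariant spaces *)

(** The double orthogonal complement: the component of y orthogonal to W is one of the test vectors
    f, so it is orthogonal to y, hence null. *)
Lemma hclosure_of_orth (R : realType) (H : hilbert R) (W : set H) y : subspace W ->
  (forall f, (forall w, W w -> ip f w = 0) -> ip f y = 0) -> hclosure W y.
Proof.
move=> Ws hy; have [p Wp pP] := projection y (hclosure_sub Ws) (@hclosure_idem _ _ W).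
apply: hclosure_idem => e e0; exists p => //.
rewrite [X in ip _ X]addrC ipDr ipNr (pP _ Wp) oppr0 add0r hy ?ltW// => w Ww.
by apply: pP; exact: sub_hclosure.
Qed.

(** * Tight generators for a group action on an abstract Hilbert space *)

Section orbits.
Context {R : realType} {H : hilbert R} {Z : zmodType}.
Variables (J : H -> H) (tr : Z -> H -> H).
Hypotheses (J_lin : lin J) (J_adj : forall v w, ip (J v) w = - ip v (J w)).
Hypothesis (JJ : forall v, J (J v) = - v).
Hypotheses (tr_lin : forall k, lin (tr k)).
Hypothesis (tr_adj : forall k v w, ip (tr k v) w = ip v (tr (- k) w)).
Hypotheses (trD : forall k l v, tr k (tr l v) = tr (k + l) v) (tr0 : forall v, tr 0 v = v).
Hypothesis (trJ : forall k v, tr k (J v) = J (tr k v)).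

Definition Jb (b : bool) (v : H) : H := if b then J v else v.

(** The index consists of a translation, a generator and a bit that selects an orbit vector or its
    image under J; the two bits carry the real and the imaginary part of a complex coefficient. *)
Definition orbit_coef (X : Type) (a : X -> H) (f : H) (p : Z * X * bool) : R :=
  ip f (Jb p.2 (tr p.1.1 (a p.1.2))).

(** The complex span of the orbits, as the least real subspace containing them and their images
    under J. *)
Definition ospan (A : set H) : set H := [set v | forall W, subspace W ->
  (forall k a, A a -> W (tr k a) /\ W (J (tr k a))) -> W v].

Lemma ospan_subspace A : subspace (ospan A).
Proof.
split=> [W [W0 _] _//|c x y hx hy W Ws WA]; have [_ Wl] := Ws.
by apply: Wl; [exact: hx|exact: hy].
Qed.

Lemma ospan_orbit A k a b : A a -> ospan A (Jb b (tr k a)).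
Proof. by move=> Aa W Ws WA; have [? ?] := WA k a Aa; case: b. Qed.

Lemma ospan_orth A f : (forall k a b, A a -> ip f (Jb b (tr k a)) = 0) ->
  forall v, hclosure (ospan A) v -> ip f v = 0.
Proof.
move=> fA; apply: hclosure_orth => w hw; apply: (hw [set w | ip f w = 0]) => /=.
  split=> /=; first exact: ip0r.
  by move=> c x y /= hx hy; rewrite ipDr ipZr hx hy mulr0 addr0.
by move=> k a Aa; split; [exact: (fA k a false)|exact: (fA k a true)].
Qed.

Lemma hclosure_ospan_sub (A B : set H) :
  (forall k a b, A a -> hclosure (ospan B) (Jb b (tr k a))) ->
  hclosure (ospan A) `<=` hclosure (ospan B).
Proof.
move=> AB v vA; apply: hclosure_idem => e /vA[w Aw vw]; exists w => //.
apply: Aw; first by apply: hclosure_sub; exact: ospan_subspace.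
by move=> k a Aa; split; [exact: (AB k a false)|exact: (AB k a true)].
Qed.

Lemma Jb_lin b : lin (Jb b).
Proof. by case: b => //; exact: J_lin. Qed.

Section coef_symmetries.
Context {X : choiceType}.
Local Notation I := (Z * X * bool)%type.

(** The adjoint of J is -J, so J acts on coefficients by exchanging the two bits with a sign; a
    translation shifts the first index. *)
Definition jsign (p : I) : R := if p.2 then 1 else - 1.
Definition jflip (p : I) : I := (p.1, ~~ p.2).
Definition tshift (m : Z) (p : I) : I := (p.1.1 - m, p.1.2, p.2).

Lemma jsign_sqr p : jsign p ^+ 2 = 1.
Proof. by rewrite /jsign; case: p.2; rewrite ?sqrrN expr1n. Qed.
Lemma jsignN_sqr p : (- jsign p) ^+ 2 = 1.
Proof. by rewrite sqrrN jsign_sqr. Qed.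
Lemma jflipK : cancel jflip jflip.
Proof. by case=> -[k x] b; rewrite /jflip /= negbK. Qed.
Lemma tshiftK m : cancel (tshift m) (tshift (- m)).
Proof. by case=> -[k x] b; rewrite /tshift /= opprK subrK. Qed.
Lemma tshiftNK m : cancel (tshift (- m)) (tshift m).
Proof. by case=> -[k x] b; rewrite /tshift /= opprK addrK. Qed.
Lemma one_sqr (p : I) : (1 : R) ^+ 2 = 1. Proof. exact: expr1n. Qed.

Definition lJ : ell2_hilbert R I -> ell2_hilbert R I := sperm jsign_sqr jflipK jflipK.
Definition lJi : ell2_hilbert R I -> ell2_hilbert R I := sperm jsignN_sqr jflipK jflipK.
Definition lT m : ell2_hilbert R I -> ell2_hilbert R I :=
  sperm one_sqr (tshiftK m) (tshiftNK m).
Definition lTi m : ell2_hilbert R I -> ell2_hilbert R I :=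
  sperm one_sqr (tshiftNK m) (tshiftK m).

Lemma lJ_adj x y : ip (lJ x) y = ip x (lJi y).
Proof.
apply: (ip_sperm_adj jsign_sqr jsignN_sqr) => p; rewrite /jsign /jflip /=.
by case: p.2 => /=; rewrite ?opprK ?mulr1// mulN1r opprK.
Qed.

Lemma lT_adj m x y : ip (lT m x) y = ip x (lTi m y).
Proof. by apply: ip_sperm_adj => p; rewrite mulr1. Qed.

Lemma lJiE x p : lJi x p = - lJ x p.
Proof. by rewrite !spermE mulNr. Qed.

Lemma lTiE m x p : lTi m x p = lT (- m) x p.
Proof. by rewrite !spermE. Qed.

Variable a : X -> H.

Lemma orbit_coef_J f p : orbit_coef a (J f) p = jsign p * orbit_coef a f (jflip p).
Proof.
case: p => -[k x] [] /=; rewrite /orbit_coef /jsign /jflip /= J_adj.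
  by rewrite JJ ipNr opprK mul1r.
by rewrite mulN1r.
Qed.

Lemma tr_Jb m b v : tr m (Jb b v) = Jb b (tr m v).
Proof. by case: b => //=. Qed.

Lemma orbit_coef_tr m f p : orbit_coef a (tr m f) p = orbit_coef a f (tshift m p).
Proof.
by case: p => -[k x] b; rewrite /orbit_coef /tshift /= tr_adj tr_Jb trD addrC.
Qed.

Lemma orbit_coef_lin c f g p :
  orbit_coef a (c *: f + g) p = c * orbit_coef a f p + orbit_coef a g p.
Proof. by rewrite /orbit_coef ipDl ipZl. Qed.

End coef_symmetries.

Section tight.
Context {T : choiceType} {r : nat}.
Variables (h : T -> H) (gam : 'I_r -> H) (C : R).
Hypothesis hC : forall f, (sqsum (orbit_coef h f) <= (C * ip f f)%:E)%E.
Hypothesis gam_dense : forall k t b, hclosure (ospan (range gam)) (Jb b (tr k (h t))).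
Local Notation I := (Z * T * bool)%type.
Local Notation K := (Z * 'I_r * bool)%type.
Local Notation V := (ell2_hilbert R I).
Local Notation W := (ell2_hilbert R K).

Lemma analysis_subproof f : orbit_coef h f \in @ell2pred R I.
Proof. by apply/ell2predP; apply: le_lt_trans (hC f) _; rewrite ltry. Qed.

Definition analysis f : V := Ell2 (analysis_subproof f).
Local Notation A := analysis.

Lemma analysisE f p : A f p = orbit_coef h f p. Proof. by []. Qed.

Lemma analysis_lin : lin A.
Proof. by move=> c f g; apply: ell2_ext => p; rewrite !ell2E !analysisE orbit_coef_lin. Qed.

Lemma analysis_sqn f : (ip (A f) (A f))%:E = sqsum (orbit_coef h f).
Proof. by rewrite /= ell2_ipxx sqnE. Qed.

Lemma analysis_bound f : ip (A f) (A f) <= C * ip f f.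
Proof. by rewrite -lee_fin analysis_sqn. Qed.

Lemma analysis_J f : A (J f) = lJ (A f).
Proof. by apply: ell2_ext => p; rewrite spermE !analysisE orbit_coef_J. Qed.

Lemma analysis_tr m f : A (tr m f) = lT m (A f).
Proof. by apply: ell2_ext => p; rewrite spermE !analysisE orbit_coef_tr mul1r. Qed.

(** The coordinates of B x exist for every x; the domain of B consists of the x for which they are
    square-summable. *)
Definition bcoef (x : V) (p : K) : R := ip x (A (Jb p.2 (tr p.1.1 (gam p.1.2)))).

Lemma bcoefE x k i b : bcoef x (k, i, b) = ip x (A (Jb b (tr k (gam i)))).
Proof. by []. Qed.

Lemma bcoef_lin c x y p : bcoef (c *: x + y) p = c * bcoef x p + bcoef y p.
Proof. by rewrite /bcoef ipDl ipZl. Qed.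

Lemma bcoef_lJ x p : bcoef (lJ x) p = jsign p * bcoef x (jflip p).
Proof.
have E y : ip (lJ x) y = - ip x (lJ y).
  rewrite lJ_adj (_ : lJi y = - lJ y) ?ipNr//.
  by apply: ell2_ext => j; rewrite lJiE ell2E.
case: p => -[k i] []; rewrite bcoefE E -analysis_J.
  rewrite [J _]JJ (linN analysis_lin) ipNr opprK; exact/esym/mul1r.
exact/esym/mulN1r.
Qed.

Lemma bcoef_lJi x p : bcoef (lJi x) p = - (jsign p * bcoef x (jflip p)).
Proof.
have -> : lJi x = - lJ x by apply: ell2_ext => j; rewrite lJiE ell2E.
by rewrite -(bcoef_lJ x p); exact: ipNl.
Qed.

Lemma bcoef_lT m x p : bcoef (lT m x) p = bcoef x (tshift m p).
Proof.
case: p => -[k i] b; rewrite [RHS]bcoefE bcoefE lT_adj; congr (ip _ _).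
apply: ell2_ext => j; rewrite lTiE -analysis_tr; congr (A _ _).
by rewrite tr_Jb trD addrC.
Qed.

Lemma bcoef_lTi m x p : bcoef (lTi m x) p = bcoef x (tshift (- m) p).
Proof.
have -> : lTi m x = lT (- m) x by apply: ell2_ext => j; rewrite lTiE.
exact: bcoef_lT.
Qed.

Definition coef_graph : set (hprod V W) := [set z | forall p, (z.2 : W) p = bcoef z.1 p].

Local Notation G := coef_graph.

(** Each coordinate equation is orthogonality to a fixed vector, so the graph is an orthogonal
    complement, hence a closed subspace. *)
Lemma coef_graphP z : G z <-> forall p,
  @ip R (hprod V W) (- A (Jb p.2 (tr p.1.1 (gam p.1.2))), delta R p) z = 0.
Proof.
case: z => x c; pose a (p : K) := A (Jb p.2 (tr p.1.1 (gam p.1.2))).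
have E p : @ip R (hprod V W) (- a p, delta R p) (x, c) = c p - bcoef x p.
  rewrite hprod_ipE -[c p]ip_delta addrC; congr (_ + _); first exact: ipC.
  by rewrite [LHS]ipNl [in LHS]ipC.
split=> h' p; first by apply: etrans (E p) _; rewrite (h' p : c p = _) subrr.
by apply: subr0_eq; apply: etrans (esym (E p)) (h' p).
Qed.

Lemma coef_graph_subspace : subspace G.
Proof.
split=> [p|c z w /coef_graphP hz /coef_graphP hw]; first exact/esym/ip0l.
by apply/coef_graphP => p; rewrite ipDr ipZr hz hw mulr0 addr0.
Qed.

Lemma coef_graph_closed : hclosure G `<=` G.
Proof.
move=> z cl; apply/coef_graphP => p; apply: (hclosure_orth _ cl) => w /coef_graphP; exact.
Qed.

(** The domain is dense because it contains the unit vectors: there the coordinates of B are, up to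
    sign and order, analysis coefficients of the finitely many gamma_i, which the Bessel bound makes
    square-summable. *)
Lemma delta_domain (j : I) : bcoef (delta R j) \in @ell2pred R K.
Proof.
apply/ell2predP; case: j => -[k' t] b'.
have E k i b : bcoef (delta R (k', t, b')) (k, i, b) ^+ 2 =
    orbit_coef h (gam i) (k' - k, t, b (+) b') ^+ 2.
  rewrite /bcoef ipC /= ip_delta analysisE; case: b => /=.
    by rewrite orbit_coef_J exprMn jsign_sqr mul1r /jflip orbit_coef_tr.
  by rewrite orbit_coef_tr.
rewrite /sqsum esum_prod; last by move=> *; rewrite lee_fin sqr_ge0.
rewrite esum_prod; last by move=> *; apply: esum_ge0 => *; rewrite lee_fin sqr_ge0.
rewrite esum_swap; last first.
  by move=> *; apply: esum_ge0 => *; rewrite lee_fin sqr_ge0.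
rewrite esum_ord; last by move=> i; do 2 apply: esum_ge0 => *; rewrite lee_fin sqr_ge0.
apply: (@le_lt_trans _ _ (\sum_(i < r) (C * ip (gam i) (gam i))%:E)%E); last first.
  by rewrite sumEFin ltry.
apply: lee_sum => i _; apply: le_trans (hC (gam i)).
rewrite /sqsum [leRHS]esum_prod; last by move=> *; rewrite lee_fin sqr_ge0.
rewrite [leRHS]esum_prod; last by move=> *; apply: esum_ge0 => *; rewrite lee_fin sqr_ge0.
rewrite -(@esum_bij _ _ _ (fun k => k' - k) (fun k => k' - k)
  (fun k => \esum_(t in setT) \esum_(b in setT) (orbit_coef h (gam i) (k, t, b) ^+ 2)%:E)%E);
  [|by move=> k; exact: subKr|by move=> k; exact: subKr].
apply: le_esum => k _.
apply: (@le_trans _ _ (\esum_(b in setT) (orbit_coef h (gam i) (k' - k, t, b) ^+ 2)%:E)%E).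
  rewrite -[leRHS](@esum_bij _ _ _ (addb^~ b') (addb^~ b'));
    [|by move=> b; rewrite -addbA addbb addbF|by move=> b; rewrite -addbA addbb addbF].
  by apply: le_esum => b _; rewrite E.
have := @sum_le_esum R T setT
  (fun t => \esum_(b in setT) (orbit_coef h (gam i) (k' - k, t, b) ^+ 2)%:E)%E [fset t]%fset.
by rewrite big_seq_fset1; apply.
Qed.

Lemma coef_graph_dense (w : V) : (forall v c, G (v, c) -> ip w v = 0) -> w = 0.
Proof.
move=> hw; apply: ell2_ext => j; rewrite ell2E -[w j]ip_delta.
by apply: (hw (delta R j) (Ell2 (delta_domain j))) => p.
Qed.

Lemma tight_generators : exists phi : 'I_r -> H,
  [/\ forall k i b, hclosure (ospan (range h)) (Jb b (tr k (phi i))),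
      forall k t b, hclosure (ospan (range phi)) (Jb b (tr k (h t))) &
      forall f, sqsum (orbit_coef phi f) = sqsum (orbit_coef h f)].
Proof.
have Vd := @ell2_definite R I; have Wd := @ell2_definite R K.
have [Th [Tl T1 TG TU]] := graph_contraction Vd Wd coef_graph_subspace coef_graph_closed coef_graph_dense.
have [P [Pl Pi PU]] := polar Vd Wd Tl T1.
have GJ x c : G (x, c) -> G (lJ x, lJ c).
  move=> hx p; exact: etrans (congr1 (fun t => jsign p * t) (hx (jflip p))) (esym (bcoef_lJ x p)).
have GJi x c : G (x, c) -> G (lJi x, lJi c).
  move=> hx p; apply: etrans (lJiE c p) _; apply: etrans _ (esym (bcoef_lJi x p)).
  by rewrite -[bcoef x (jflip p)](hx (jflip p)).
have GT m x c : G (x, c) -> G (lT m x, lT m c).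
  move=> hx p; apply: etrans (mul1r _) _; apply: etrans _ (esym (bcoef_lT m x p)).
  exact: hx (tshift m p).
have GTi m x c : G (x, c) -> G (lTi m x, lTi m c).
  move=> hx p; apply: etrans (mul1r _) _; apply: etrans _ (esym (bcoef_lTi m x p)).
  exact: hx (tshift (- m) p).
have lJl X : lin (@lJ X) by exact: sperm_lin.
have lJil X : lin (@lJi X) by exact: sperm_lin.
have lTl X m : lin (@lT X m) by exact: sperm_lin.
have lTil X m : lin (@lTi X m) by exact: sperm_lin.
have lJi_adj X x y : ip (@lJi X x) y = ip x (lJ y) by rewrite ipC -lJ_adj ipC.
have lTi_adj X m x y : ip (@lTi X m x) y = ip x (lT m y) by rewrite ipC -lT_adj ipC.
have PJ x : P (lJ x) = lJ (P x).
  apply: (PU lJ lJi lJ lJi) => //.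
  - by move=> y; exact: ip_sperm.
  - by move=> y z; exact: lJ_adj.
  - by move=> y z; exact: lJ_adj.
  - apply: (TU lJ lJi lJ lJi); [exact: lJl| | |exact: GJ|exact: GJi].
      by move=> y z; exact: lJ_adj.
    by move=> y z; exact: lJ_adj.
  - by apply: (TU lJi lJ lJi lJ); [exact: lJil|exact: lJi_adj|exact: lJi_adj|exact: GJi|exact: GJ].
have PT m x : P (lT m x) = lT m (P x).
  apply: (PU (lT m) (lTi m) (lT m) (lTi m)) => //.
  - by move=> y; exact: ip_sperm.
  - by move=> y z; exact: lT_adj.
  - by move=> y z; exact: lT_adj.
  - apply: (TU (lT m) (lTi m) (lT m) (lTi m)); [exact: lTl| | |exact: GT|exact: GTi].
      by move=> y z; exact: lT_adj.
    by move=> y z; exact: lT_adj.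
  - apply: (TU (lTi m) (lT m) (lTi m) (lT m)); [exact: lTil| | |exact: GTi|exact: GT].
      exact: lTi_adj.
    exact: lTi_adj.
(* The range of A is orthogonal to the kernel of [Th]. For x in this kernel, g = A^* x is orthogonal
   to the translates of the gamma_i, hence to those of h; so A g = 0 and |g|^2 = ip (A g) x = 0. *)
have PA f : ip (P (A f)) (P (A f)) = ip (A f) (A f).
  apply: Pi => x /TG Gx.
  have l1 c u v : ip (A (c *: u + v)) x = c * ip (A u) x + ip (A v) x.
    by rewrite analysis_lin ipDl ipZl.
  have l2 u : ip (A u) x ^+ 2 <= C * ip x x * ip u u.
    have := cauchy_schwarz (A u) x; have := analysis_bound u; have := ip_ge0 x.
    move: (ip (A u) x) (ip (A u) (A u)) (ip x x) (ip u u) => a b c e c0 be ab.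
    apply: le_trans ab _; rewrite mulrAC; exact: ler_wpM2r.
  have [g hg] := riesz l1 l2.
  have g_orth k i b : ip g (Jb b (tr k (gam i))) = 0.
    by rewrite ipC -hg ipC; exact/esym/(Gx (k, i, b)).
  have Ag0 : A g = 0.
    apply: ell2_ext => -[[k t] b]; rewrite analysisE [RHS]ell20.
    apply: (ospan_orth _ (gam_dense k t b)) => k' a b' [i _ <-]; exact: g_orth.
  rewrite hg ipC; apply: ip_eq0.
  by rewrite -hg Ag0 ip0l.
(* The i-th function represents the coordinate of P A at translation 0 and bit [false]; commutation
   with translations and J recovers all other coordinates. *)
have rep i : exists y, forall f, P (A f) (0, i, false) = ip f y.
  apply: (@riesz _ _ _ C) => [c u v|f].
    by rewrite analysis_lin Pl ell2E.
  apply: le_trans (analysis_bound f); rewrite -PA /= [leRHS]ell2_ipxx.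
  exact: coord_le_sqn.
have [phi phiP] := choice rep.
have coefE f p : orbit_coef phi f p = P (A f) p.
  case: p => -[k i] b; rewrite /orbit_coef /=.
  have E0 : ip f (tr k (phi i)) = P (A f) (k, i, false).
    have := tr_adj (- k) f (phi i); rewrite opprK => <-.
    rewrite -phiP analysis_tr PT spermE mul1r /tshift /= opprK add0r.
    by [].
  case: b => //=.
  have := tr_adj (- k) (J f) (phi i); rewrite opprK.
  rewrite -phiP analysis_tr analysis_J PT PJ J_adj => /esym/eqP; rewrite eqr_oppLR => /eqP ->.
  rewrite spermE mul1r spermE /jsign /jflip /tshift /= opprK add0r.
  by rewrite mulN1r opprK.
exists phi; split => [k i b|k t b|f].
(* Both inclusions go through orthogonal complements: A f = 0 exactly when P (A f) = 0, as P
   preserves norms on the range of A. *)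
- apply: (hclosure_of_orth (ospan_subspace _)) => f fh.
  have Af0 : A f = 0.
    apply: ell2_ext => -[[k' t] b']; rewrite analysisE [RHS]ell20; apply: fh.
    by apply: ospan_orbit; exists t.
  apply: etrans (coefE f (k, i, b)) _; rewrite Af0.
  by have -> : P 0 = 0 by exact: lin0.
- apply: (hclosure_of_orth (ospan_subspace _)) => f fphi.
  have PAf0 : P (A f) = 0.
    apply: ell2_ext => -[[k' i] b']; rewrite -coefE [RHS]ell20; apply: fphi.
    by apply: ospan_orbit; exists i.
  have /Vd Af0 : ip (A f) (A f) = 0 by rewrite -PA PAf0 ip0l.
  by rewrite -[LHS](analysisE f (k, t, b)) Af0.
rewrite -analysis_sqn -PA /= ell2_ipxx sqnE.
by apply: eq_esum => p _; rewrite coefE.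
Qed.

End tight.
End orbits.

(** * Shift-invariant subspaces of L2 as closed orbit spans *)

Section shift_spaces.
Context {R : realType} {d : nat}.
Local Notation mu := (lebesgue_cV R d : {measure set 'cV[R]_d -> \bar R}).
Local Notation Cfun := ('cV[R]_d -> R[i]).
Local Notation H := (@L2C R d).
Local Notation J := (@mul_i R d).
Local Notation Z := 'cV[int]_d.
Implicit Types (v w u : H) (Phi : set Cfun).

Lemma toC_inj v w : toC v = toC w -> v = w.
Proof.
case: v w => [v1 v2] [w1 w2] E; congr (_, _); apply/LfuneqP => x.
  by have := congr1 (fun f : Cfun => complex.Re (f x)) E.
by have := congr1 (fun f : Cfun => complex.Im (f x)) E.
Qed.

Lemma toC0 : toC (0 : H) = fun=> 0.
Proof. by apply/funext. Qed.

Lemma tr_subproof (k : Z) v : exists w, translate k (toC v) = toC w.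
Proof. exact/L2_toC/L2_translate/toC_L2. Qed.

Definition tr (k : Z) v : H := projT1 (cid (tr_subproof k v)).

Lemma toC_tr k v : toC (tr k v) = translate k (toC v).
Proof. by rewrite /tr; case: cid. Qed.

Lemma tr_lin k : lin (tr k).
Proof.
move=> a x y; apply: toC_inj; rewrite toC_tr; apply/funext => z.
by rewrite lin_toC !toC_tr /translate lin_toC.
Qed.

Lemma trD k l v : tr k (tr l v) = tr (k + l) v.
Proof. by apply: toC_inj; rewrite !toC_tr translateD. Qed.

Lemma tr0 v : tr 0 v = v.
Proof. by apply: toC_inj; rewrite toC_tr translate0. Qed.

Lemma tr_isom k v w : ip (tr k v) (tr k w) = ip v w.
Proof.
have := inner_comp (scales_shift (- intvec R k)) (toC_L2 v) (toC_L2 w).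
rewrite -[toC v \o _]/(translate k (toC v)) -[toC w \o _]/(translate k (toC w)).
by rewrite -!toC_tr !inner_toC mul1r => -[].
Qed.

Lemma tr_adj k v w : ip (tr k v) w = ip v (tr (- k) w).
Proof. by rewrite -[RHS](tr_isom k) trD subrr tr0. Qed.

Lemma trJ k v : tr k (J v) = J (tr k v).
Proof.
apply: toC_inj; rewrite toC_tr; apply/funext => x.
by rewrite /translate !toC_mul_i toC_tr.
Qed.

Local Notation ocoef := (orbit_coef J tr).
Local Notation ospan := (ospan J tr).

Lemma orbit_energy (X : choiceType) (a : X -> H) v :
  (\esum_(x in setT) \esum_(k in [set: Z]) inner_sqr (toC v) (translate k (toC (a x))) =
   sqsum (ocoef a v))%E.
Proof.
have nn (p : Z * X * bool) : (0 <= (ocoef a v p ^+ 2)%:E)%E by rewrite lee_fin sqr_ge0.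
rewrite /sqsum esum_prod// esum_prod; last by move=> *; apply: esum_ge0.
rewrite esum_swap; last by move=> *; exact: inner_sqr_ge0.
apply: eq_esum => k _; apply: eq_esum => x _.
by rewrite esum_bool// -toC_tr inner_sqr_toC EFinD.
Qed.

Lemma translates_span_toC Phi g : Phi `<=` @L2 R d -> translates_span Phi g ->
  exists2 v, g = toC v & ospan [set w | Phi (toC w)] v.
Proof.
move=> PL [n [c [phi [k [Pphi ->]]]]].
have /choice[w hw] i : exists w, phi i = toC w by apply/L2_toC/PL.
exists (\sum_(i < n) (complex.Re (c i) *: tr (k i) (w i) + complex.Im (c i) *: J (tr (k i) (w i)))).
  apply/funext => x.
  have toCD u v : toC (u + v) x = toC u x + toC v x.
    by rewrite -[u]scale1r lin_toC scale1r mul1r.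
  rewrite (big_morph (fun v => toC v x) toCD (_ : toC 0 x = 0))//.
  apply: eq_bigr => i _; rewrite lin_toC -[complex.Im (c i) *: _]addr0 lin_toC toC_mul_i toC_tr -hw.
  rewrite (_ : toC 0 x = 0)// addr0 mulrA -mulrDl; congr (_ * _).
  by case: (c i) => a b; apply/eqP; rewrite eq_complex /=; apply/andP; split; apply/eqP; ring.
move=> W [W0 Wl] WA; apply: big_ind => //.
  by move=> u v hu hv; rewrite -[u]scale1r; exact: Wl.
move=> i _; have [h1 h2] : W (tr (k i) (w i)) /\ W (J (tr (k i) (w i))).
  by apply: WA; rewrite /= -hw.
by apply: (Wl) => //; rewrite -[_ *: _]addr0; exact: Wl.
Qed.

Lemma toC_translates_span Phi v : ospan [set w | Phi (toC w)] v ->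
  translates_span Phi (toC v).
Proof.
move=> hv; apply: (hv [set v | translates_span Phi (toC v)]) => [|k a /= Pa].
  split=> [|a x y [n [c [phi [k [Pphi hx]]]]] [n' [c' [phi' [k' [Pphi' hy]]]]]] /=.
    exists 0%N, (fun=> 0), (fun=> fun=> 0), (fun=> 0); split; first by case.
    by rewrite toC0; apply/funext => x; rewrite big_ord0.
  pose sel (T : Type) (f : 'I_n -> T) (f' : 'I_n' -> T) (i : 'I_(n + n')) :=
    match fintype.split i with inl j => f j | inr j => f' j end.
  exists (n + n')%N, (sel _ (fun i => a%:C * c i) c'), (sel _ phi phi'), (sel _ k k'); split.
    by move=> i; rewrite /sel; case: (fintype.split i).
  apply/funext => z; rewrite lin_toC hx hy big_split_ord /= mulr_sumr; congr (_ + _).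
    apply: eq_bigr => i _; rewrite /sel; case: splitP => j /=.
      by move=> /ord_inj <-; rewrite mulrA.
    by move=> E; have := ltn_ord i; rewrite E ltnNge leq_addr.
  apply: eq_bigr => i _; rewrite /sel; case: splitP => j /=.
    by move=> E; have := ltn_ord j; rewrite -E ltnNge leq_addr.
  by move=> /addnI/ord_inj <-.
split.
  exists 1%N, (fun=> 1), (fun=> toC a), (fun=> k); split => //.
  by rewrite toC_tr; apply/funext => x; rewrite big_ord1 mul1r.
exists 1%N, (fun=> 'i), (fun=> toC a), (fun=> k); split => //.
by apply/funext => x; rewrite toC_mul_i toC_tr big_ord1.
Qed.

Lemma L2norm_toC v : L2norm (toC v) = (hn v)%:E.
Proof.
have := toC_L2norm v; have : (0 <= L2norm (toC v))%E by exact: Lnorm_ge0.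
case: (L2norm _) => [r|_|//]; last by rewrite expe2 mulyy.
rewrite lee_fin -EFin_expe => r0 rv; have E : r ^+ 2 = ip v v := EFin_inj rv.
by rewrite /hn -E sqrtr_sqr ger0_norm.
Qed.

(** [shift_space] measures distances by the norm and [hclosure] by its square, so tolerances change
    by a square root. *)
Lemma shift_space_toC Phi v : Phi `<=` @L2 R d ->
  shift_space Phi (toC v) <-> hclosure (ospan [set w | Phi (toC w)]) v.
Proof.
move=> PL; split=> [[_ hv] e e0|hv].
  have se0 : 0 < Num.sqrt e by rewrite sqrtr_gt0.
  have [g /(translates_span_toC PL)[w -> hw]] := hv _ se0.
  rewrite toC_sub L2norm_toC lte_fin => lt; exists w => //.
  have : ip (v - w) (v - w) <= Num.sqrt e ^+ 2 by rewrite (hn_le _ (ltW se0)) ltW.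
  by rewrite sqr_sqrtr// ltW.
split; first exact: toC_L2.
move=> eps eps0; have [w hw vw] := hv ((eps / 2) ^+ 2) (exprn_gt0 2 (divr_gt0 eps0 (ltr0n _ 2))).
exists (toC w); first exact: toC_translates_span.
rewrite toC_sub L2norm_toC lte_fin; have := vw; rewrite (hn_le _ (ltW (divr_gt0 eps0 (ltr0n _ 2)))).
by move=> h; apply: le_lt_trans h _; lra.
Qed.

Lemma ae_eq_toC v w : {ae mu, forall x, toC v x = toC w x} -> ip (v - w) (v - w) = 0.
Proof.
move=> vw; apply: EFin_inj; rewrite -toC_L2norm -toC_sub L2norm_sqr.
rewrite (ae_eq_integral (fun=> 0%E))//; first exact: integral0.
- have [m1 m2 _] : L2 (fun x => toC v x - toC w x) by apply: L2_sub; exact: toC_L2.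
  by apply/measurable_EFinP/measurable_funD; exact: measurable_funX.
- by move: vw; apply: filterS => x E _; rewrite E subrr /sqc /= expr0n addr0.
Qed.

Lemma Jb_tr_isom b k v w : ip (Jb J b (tr k v)) (Jb J b (tr k w)) = ip v w.
Proof. by case: b; rewrite /Jb ?ip_mul_i2 tr_isom. Qed.

End shift_spaces.

(** * Minimality of the length and distinctness of the generators *)

Section minimal_generators.
Context {R : realType} {d : nat}.
Local Notation mu := (lebesgue_cV R d : {measure set 'cV[R]_d -> \bar R}).
Local Notation Cfun := ('cV[R]_d -> R[i]).
Local Notation H := (@L2C R d).
Local Notation J := (@mul_i R d).
Local Notation tr := (@tr R d).
Local Notation Z := 'cV[int]_d.
Local Notation ocoef := (orbit_coef J tr).
Local Notation ospan := (ospan J tr).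

Lemma card_enumeration (T : Type) (A : set T) r : (A #= `I_r)%card ->
  exists g : 'I_r -> T, A = range g.
Proof.
move=> Ar; have : ([set: 'I_r] #= A)%card.
  by apply: card_esym; apply: card_eq_trans Ar card_II.
move=> /card_bijP[f [f' ff' f'f]].
exists (fun i => set_val (f (SigSub (mem_setT i)))); apply/seteqP; split=> [x Ax|_ [i _ <-]].
  exists (set_val (f' (SigSub (mem_set Ax)))) => //.
  rewrite (_ : SigSub _ = f' (SigSub (mem_set Ax))) ?f'f//.
  exact/val_inj.
exact: set_valP.
Qed.

(** Among the r functions constructed, some might agree almost everywhere. Discarding repetitions
    does not change the closed span, so the minimality of r excludes them. *)
Lemma tight_generating_set (T : choiceType) (h : T -> H) (C : R) (S : set Cfun) r :
  (forall f, sqsum (ocoef h f) <= (C * ip f f)%:E)%E ->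
  S `<=` @L2 R d -> (forall v, S (toC v) <-> hclosure (ospan (range h)) v) ->
  has_len S r -> exists Phi : set Cfun,
    [/\ L2_subset Phi, (Phi #= `I_r)%card, Phi `<=` S, shift_space Phi = S &
        forall v, translates_energy Phi (toC v) = sqsum (ocoef h v)].
Proof.
move=> hC SL Sh [[Phi0 [[P0L _] P0r SP0]] minr].
have [g0 P0E] := card_enumeration P0r.
have /choice[gam gamE] i : exists w, g0 i = toC w.
  by apply/L2_toC/P0L; rewrite P0E; exists i.
have gam_range : [set w | Phi0 (toC w)] = range gam.
  rewrite P0E; apply/seteqP; split=> w /=.
    by move=> [i _ E]; exists i => //; apply: toC_inj; rewrite -gamE.
  by move=> [i _ <-]; exists i => //; rewrite gamE.
have gam_dense k t b : hclosure (ospan (range gam)) (Jb J b (tr k (h t))).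
  rewrite -gam_range -shift_space_toC// -SP0; apply/Sh/sub_hclosure.
  by apply: ospan_orbit; exists t.
have [phi [phi_in h_in phi_en]] :=
  tight_generators (@ip_mul_i R d) (@mul_i2 R d) tr_adj trD trJ hC gam_dense.
have phiL i : L2 (toC (phi i)) by exact: toC_L2.
have phiS i : S (toC (phi i)).
  by apply/Sh; have := phi_in 0 i false; rewrite /= tr0.
(* The index i is the least one of its class modulo null functions. *)
pose rep (i : 'I_r) := forall j : 'I_r, (j < i)%N -> ip (phi i - phi j) (phi i - phi j) != 0.
have shiftE (D : set 'I_r) : (forall i, exists2 j, D j & ip (phi i - phi j) (phi i - phi j) = 0) ->
    shift_space [set toC (phi i) | i in D] = S.
  move=> hD; set Phi := [set _ | _ in _].
  have PL : Phi `<=` @L2 R d by move=> _ [i _ <-].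
  have PE : [set w | Phi (toC w)] = [set phi i | i in D].
    apply/seteqP; split=> w /=; first by move=> [i Di /toC_inj <-]; exists i.
    by move=> [i Di <-]; exists i.
  suff hull v : hclosure (ospan [set phi i | i in D]) v <-> hclosure (ospan (range h)) v.
    apply/seteqP; split=> f.
      move=> sf; have [/L2_toC[v fv] _] := sf; move: sf; rewrite fv.
      by rewrite shift_space_toC// PE => /hull/Sh.
    move=> sf; have [v fv] := L2_toC (SL f sf); move: sf; rewrite fv => /Sh/hull.
    by rewrite -PE -shift_space_toC.
  split; apply: hclosure_ospan_sub => k a b.
    by move=> [i _ <-]; exact: phi_in.
  move=> [t _ <-]; apply: hclosure_ospan_sub (h_in k t b) => {t} k' _ b' [i _ <-] e e0.
  have [j Dj ij] := hD i; exists (Jb J b' (tr k' (phi j))).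
    by apply: ospan_orbit; exists j.
  rewrite -(linB (Jb_lin mul_i_lin b')) -(linB (tr_lin k')) Jb_tr_isom ij; exact: ltW.
have repP i : exists2 j, rep j & ip (phi i - phi j) (phi i - phi j) = 0.
  elim: {i}(val i).+1 {-2}i (ltnSn (val i)) => // m IH i im.
  have [ri|] := pselect (rep i); first by exists i => //; rewrite subrr ip0l.
  move=> /existsNP[j /not_implyP[ji /negP/negPn/eqP ij0]].
  have jm : (val j < m)%N by apply: leq_trans ji _; rewrite -ltnS.
  have [l rl jl] := IH j jm; exists l; first exact: rl.
  apply/eqP; rewrite eq_le ip_ge0 andbT.
  have -> : phi i - phi l = (phi i - phi j) + (phi j - phi l) by rewrite addrA subrK.
  by apply: le_trans (ip_addr_le _ _) _; rewrite ij0 jl mulr0 addr0.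
have rep_inj i j : rep i -> rep j -> ip (phi i - phi j) (phi i - phi j) = 0 -> i = j.
  move=> ri rj ij0; apply/val_inj; case: (ltngtP i j) => //= lt.
    have := rj i lt; rewrite -opprB ipNl ipNr opprK ij0 eqxx//.
  by have := ri j lt; rewrite ij0 eqxx.
have sub D : D `<=` rep -> L2_subset [set toC (phi i) | i in D].
  move=> Dr; split=> [_ [i _ <-]//|_ _ [i Di <-] [j Dj <-] /ae_eq_toC ij].
  by rewrite (rep_inj i j (Dr _ Di) (Dr _ Dj) ij).
have rep_all i0 : rep i0.
  apply: contrapT => ni0.
  have [r' rE] : exists r', r = r'.+1 by exists r.-1; rewrite prednK//; exact: leq_ltn_trans (ltn_ord i0).
  pose Phi' := [set toC (phi i) | i in rep].
  have Phi'le : (Phi' #<= `I_r')%card.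
    (* If [i0] repeats an earlier function, all representatives are found among the other r - 1
       indices. *)
    pose F (j : 'I_r') := toC (phi (cast_ord (esym rE) (lift (cast_ord rE i0) j))).
    apply: (@card_le_trans _ _ _ (range F)).
      apply: subset_card_le => _ [i ri <-].
      case: (unliftP (cast_ord rE i0) (cast_ord rE i)) => [j ij|/cast_ord_inj ii0].
        by exists j => //; rewrite /F -ij cast_ordK.
      by case: ni0; rewrite -ii0.
    apply: card_le_trans (card_image_le F setT) _.
    by have /card_eqPle[] := @card_II r'.
  have [m Pm] : exists m, (Phi' #= `I_m)%card.
    by apply/finite_setP/finite_set_leP; exists r'.
  have rm := minr Phi' m (sub _ (@subset_refl _ _)) Pm (esym (shiftE _ repP)).
  have : (`I_m #<= `I_r')%card by rewrite -(card_le_eql Pm).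
  by rewrite card_le_II => mr'; move: rm; rewrite rE ltnNge mr'.
have phi_inj i j : toC (phi i) = toC (phi j) -> i = j.
  by move=> /toC_inj ij; apply: rep_inj => //; rewrite ij subrr ip0l.
exists (range (fun i => toC (phi i))); split.
- by apply: sub.
- apply: card_eq_trans (card_esym card_II).
  by apply: inj_card_eq => i j _ _; exact: phi_inj.
- by move=> _ [i _ <-].
- by apply: shiftE => i; exists i => //; rewrite subrr ip0l.
move=> v; rewrite -phi_en -orbit_energy /translates_energy.
rewrite (reindex_esum setT _ (fun i => toC (phi i)))//; split=> [i _|i j _ _|//].
  by exists i.
exact: phi_inj.
Qed.

End minimal_generators.

Section coarse_generating_set.
Context {R : realType} {n : nat}.
Variable Mz : 'M[int]_n.+1.
Local Notation M := (map_mx intr Mz : 'M[R]_n.+1).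
Hypothesis hM : expansive M.
Local Notation Cfun := ('cV[R]_n.+1 -> R[i]).
Local Notation H := (@L2C R n.+1).
Variable Psi : set Cfun.
Hypothesis hPsi : Psi `<=` @L2 R n.+1.

Lemma coarse_generators_L2 : coarse_generators M Psi `<=` @L2 R n.+1.
Proof. by move=> _ [j [psi [_ /hPsi hp ->]]]; exact: L2_coarsen. Qed.

(** The family is indexed by pairs (j, psi): the coarse energy counts an atom once for each pair
    producing it, which the set of generators forgets. Pairs that do not contribute are sent to
    0. *)
Lemma coarse_generating_set (C : R) r :
  (forall f, L2 f -> coarse_energy M Psi f <= C%:E * L2norm f ^+ 2)%E ->
  has_len (shift_space (coarse_generators M Psi)) r -> exists Phi : set Cfun,
    [/\ L2_subset Phi, (Phi #= `I_r)%card,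
        Phi `<=` shift_space (coarse_generators M Psi),
        shift_space Phi = shift_space (coarse_generators M Psi) &
        forall f, L2 f -> translates_energy Phi f = coarse_energy M Psi f].
Proof.
move=> hC hr.
pose good (p : nat * Cfun) := (0 < p.1)%N /\ Psi p.2.
have /choice[h hh] (p : nat * Cfun) : exists w : H,
    (good p -> toC w = coarsen M p.1 p.2) /\ (~ good p -> w = 0).
  have [gp|np] := pselect (good p); last by exists 0.
  have [w wE] := L2_toC (L2_coarsen hM p.1 (hPsi gp.2)).
  by exists w; split.
have energyE v : sqsum (orbit_coef (@mul_i R n.+1) (@tr R n.+1) h v) = coarse_energy M Psi (toC v).
  have z k : inner_sqr (toC v) (translate k (toC (0 : H))) = 0%E.
    by rewrite -toC_tr (lin0 (tr_lin k)) inner_sqr_toC (lin0 mul_i_lin) !ip0r expr0n addr0.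
  rewrite -orbit_energy esum_prod; last first.
    by move=> p; apply: esum_ge0 => k _; exact: inner_sqr_ge0.
  rewrite /coarse_energy [RHS]esum_mkcond; apply: eq_esum => j _.
  case: ifPn => [/set_mem j0|/negP nj]; last first.
    apply: esum1 => psi _; apply: esum1 => k _; have [_ ->] := hh (j, psi); first exact: z.
    by move=> [j0 _]; apply: nj; exact: mem_set.
  rewrite [RHS]esum_mkcond; apply: eq_esum => psi _.
  case: ifPn => [/set_mem hp|/negP np].
    by apply: eq_esum => k _; have [-> ] := hh (j, psi).
  apply: esum1 => k _; have [_ ->] := hh (j, psi); first exact: z.
  by move=> [_ hp]; apply: np; exact: mem_set.
have [||||Phi [P1 P2 P3 P4 P5]] := @tight_generating_set R n.+1 _ h C
    (shift_space (coarse_generators M Psi)) r.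
- by move=> v; rewrite energyE EFinM -toC_L2norm; apply: hC; exact: toC_L2.
- by move=> f [].
- move=> v; rewrite shift_space_toC; last exact: coarse_generators_L2.
  split; apply: hclosure_ospan_sub => k a b.
    move=> [j [psi [j0 hp E]]]; apply: sub_hclosure; apply: ospan_orbit.
    exists (j, psi) => //; apply: toC_inj; rewrite E.
    by have [->] := hh (j, psi).
  move=> [p _ <-]; apply: sub_hclosure; have [gp|np] := pselect (good p).
    apply: ospan_orbit => /=; have [-> //] := hh p.
    by exists p.1, p.2; case: gp.
  have [_ ->//] := hh p; rewrite (lin0 (tr_lin k)) (lin0 (Jb_lin mul_i_lin b)).
  by have [] := ospan_subspace (@mul_i R n.+1) (@tr R n.+1)
    [set w | coarse_generators M Psi (toC w)].
- exact: hr.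
exists Phi; split => // f /L2_toC[v ->].
by rewrite P5 energyE.
Qed.

End coarse_generating_set.

Theorem proposition3p3 (R : realType) (d : nat) (hd : (0 < d)%N)
    (M : 'M[R]_d) (hMint : M \is a mxOver Num.int) (hM : expansive M)
    (Psi : set ('cV[R]_d -> R[i])) (hPsi : L2_subset Psi)
    (hPsi_count : countable Psi)
    (hPsi_sum : (\esum_(psi in Psi) (L2norm psi ^+ 2) < +oo)%E)
    (r : nat) (hr : has_len (shift_space (coarse_generators M Psi)) r)
    (C1 C2 : R) (hC1 : 0 < C1) (hC2 : 0 < C2) :
  (homogeneous_framelet M Psi /\
   frame_inequality (homogeneous_energy M Psi) C1 C2)
  <->
  (exists Phi : set ('cV[R]_d -> R[i]),
    [/\ [/\ L2_subset Phi, (Phi #= `I_r)%card &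
            Phi `<=` shift_space (coarse_generators M Psi)],
        shift_space Phi = shift_space (coarse_generators M Psi),
        (forall f, L2 f -> translates_energy Phi f = coarse_energy M Psi f),
        framelet M Phi Psi &
        frame_inequality (nonhomogeneous_energy M Phi Psi) C1 C2]).
Proof.
(* Powers of M are taken in the ring of square matrices, of dimension n+1. *)
case: d hd M hMint hM Psi hPsi hPsi_count hPsi_sum hr => // n _ M hMint hM Psi [hL _] _ hS hr.
have [Mz ME] : exists Mz : 'M[int]_n.+1, M = map_mx intr Mz.
  exists (map_mx Num.floor M); apply/matrixP => i j; rewrite !mxE.
  by have /mxOverP/(_ i j)/floorK := hMint.
subst M; have C10 := ltW hC1; have C20 := ltW hC2.
split=> [[_ hh]|[Phi [_ _ PE _ hn]]].
  have hq := quasi_of_homogeneous hM hL hS C10 C20 hh.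
  have [f hf|Phi [P1 P2 P3 P4 P5]] := @coarse_generating_set R n Mz hM Psi hL C2 r _ hr.
    have /andP[_] := hq f hf; apply: le_trans.
    by rewrite leeDl// fine_energy_ge0.
  have hn : frame_inequality (nonhomogeneous_energy (map_mx intr Mz) Phi Psi) C1 C2.
    by move=> f hf; rewrite /nonhomogeneous_energy P5//; exact: hq.
  by exists Phi; split => //; exists C1, C2.
(* By the energy identity for Phi, the nonhomogeneous inequality is the quasi-affine one with the
   same constants. *)
have hq : frame_inequality (quasi_energy Mz Psi) C1 C2.
  by move=> f hf; rewrite /quasi_energy -PE//; exact: hn.
have hh := homogeneous_of_quasi hM hL hS C10 C20 hq.
by split=> //; exists C1, C2.
Qed.
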